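(* Let $\tau\in\mathbb C$ with $t=\mathrm{Im}(\tau)>0$, let $k,l$ be positive integers and let $w\in\mathbb C$. There exists a linear map $$n_2:H^1(L(-k,0))\otimes H^0(L(k+l,w))\to H^0(L(l,w))$$ (depending on $k,l,w$ only) such that for every $u\in\mathbb C\setminus(\mathbb Z+\mathbb Z\tau)$, with $v=w-u$, and for all $\alpha\in H^1(L(-k,0))$, $\beta_1\in H^0(L(k,u))$, $\beta_2\in H^0(L(l,v))$ one has $$m_3(\alpha,\beta_1,\beta_2)-m_3'(\alpha,\beta_1,\beta_2)=n_2(\alpha,\beta_1\beta_2),$$ where $m_3$ is the triple product defined by the complex structure (via harmonic forms) and $m_3'$ is the corresponding Fukaya triple product of the symplectic torus, both described explicitly in the context.
   Context: Let $E_\tau=\mathbb C/(\mathbb Z+\mathbb Z\tau)$. For $x,u,w\in\mathbb C$ write $x=x_1+\tau x_2$, $u=u_1+\tau u_2$, $w=w_1+\tau w_2$ with real $x_i,u_i,w_i$. Line bundles. For $k\in\mathbb Z$, $u\in\mathbb C$, $L(k,u)$ is the holomorphic line bundle on $E_\tau$ whose sections are functions $f$ on $\mathbb C$ with $f(x+1)=f(x)$, $f(x+\tau)=\exp(-\pi i k\tau-2\pi i(kx+u))f(x)$; thus $L(k,u)=L^{k-1}\otimes t_u^*L$, where $L=L(1,0)$ has the holomorphic section $\theta(x,\tau)=\sum_{n\in\mathbb Z}\exp(\pi i\tau n^2+2\pi i nx)$ and $t_u$ is translation by $u$. Multiplication of functions gives $L(k,u)\otimes L(k',u')\simeq L(k+k',u+u')$.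 The hermitian metric on $L(k,u)$ is such that $$\langle f,g\rangle=\int_{\mathbb C/(\mathbb Z+\mathbb Z\tau)}f(x)\overline{g(x)}\exp(-2\pi t(kx_2^2+2x_2u_2))\,dx_1dx_2 .$$ Bases. For $r\in\mathbb Q/\mathbb Z$ put $\theta_r(x,\tau)=\sum_{n\in\mathbb Z}\exp(\pi i\tau(n+r)^2+2\pi i(n+r)x)$. For $k>0$, the functions $\theta_{a/k}(kx+u,k\tau)$, $a\in\mathbb Z/k\mathbb Z$, form a basis of $H^0(L(k,u))$, and the forms $\overline{\theta_{a/k}(kx,k\tau)}\exp(-2\pi tkx_2^2)\,d\bar x$, $a\in\mathbb Z/k\mathbb Z$, form a basis of the harmonic $(0,1)$-forms with values in $L(-k,0)$, which are identified with $H^1(L(-k,0))$. The product $m_3$. Since $u\notin\mathbb Z+\mathbb Z\tau$, all cohomology of $L(0,u)$ vanishes, so $\bar\partial$ is invertible from $C^\infty$ sections of $L(0,u)$ to $(0,1)$-forms with values in $L(0,u)$. For $\alpha$ a harmonic form representing a class in $H^1(L(-k,0))$, $\beta_1\in H^0(L(k,u))$, $\beta_2\in H^0(L(l,v))$, $w=u+v$, $$m_3(\alpha,\beta_1,\beta_2)=\mathrm{pr}\bigl(\bar\partial^{-1}(\alpha\beta_1)\,\beta_2\bigr)\in H^0(L(l,w)),$$ where $\mathrm{pr}$ is the orthogonal projection of $C^\infty$ sections of $L(l,w)$ onto holomorphic sections with respect to the hermitian product $\langle f,g\rangle=\int_{\mathbb C/(\mathbb Z+\mathbb Z\tau)}f(x)\overline{g(x)}\exp(-2\pi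 t(lx_2^2+2x_2w_2))\,dx_1dx_2$ on sections of $L(l,w)$. The product $m_3'$. It is the trilinear map $H^1(L(-k,0))\otimes H^0(L(k,u))\otimes H^0(L(l,v))\to H^0(L(l,w))$, $w=u+v$, given on the basis elements $$\alpha=\frac{\pi\sqrt{2k}}{\sqrt t}\,\overline{\theta_{a/k}(kx,k\tau)}\exp(-2\pi tkx_2^2)\,d\bar x,\quad \beta_1=\theta_{b/k}(kx+u,k\tau),\quad \beta_2=\theta_{c/l}(lx+v,l\tau)$$ by $$m_3'(\alpha,\beta_1,\beta_2)=\sum_{d\in\mathbb Z/l\mathbb Z}F^d_{a,b,c}(u,w)\,\theta_{d/l}(lx+w,l\tau),$$ $$F^d_{a,b,c}(u,w)=-2\pi i\sum_{\substack{m\in\mathbb Z\\ m\equiv b-a\,(k),\ m\equiv d-c\,(l)}}\frac{\exp\left(\frac{\pi i(k+l)}{kl}(\tau m^2+2mu)-2\pi i\frac{mw}{l}+2\pi i(m\tau+u)\left(n_0-\frac dl+\frac ak\right)\right)}{1-\exp(2\pi i(m\tau+u))},$$ where $n_0$ is the minimal integer $n$ with $n\ge\frac{w_2+d}{l}-\frac ak$. (This is the Fukaya product for the geodesic circles $(s,0)$, $(s,-ks)$, $(s,-u_2)$, $(s,ls-w_2)$ in $\mathbb R^2/\mathbb Z^2$, the first two with trivial connections and the last two with connections $-2\pi iu_1dx$ and $-2\pi iw_1dx$.) *)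

(* Defs.v *)
(* Stdlib reals with Coquelicot: complex numbers are Coquelicot's [C]. *)
From Stdlib Require Export Reals ZArith ClassicalEpsilon.
From Coquelicot Require Export Coquelicot.

Open Scope C_scope.

Definition cexp (z : C) : C :=
  RtoC (exp (Re z)) * (RtoC (cos (Im z)) + Ci * RtoC (sin (Im z))).

(* Coquelicot's [Series] is real-valued. *)
Definition CSeries (f : nat -> C) : C :=
  (Series (fun n => Re (f n)), Series (fun n => Im (f n))).

(* Sum over all integers; every series below converges absolutely. *)
Definition ZSeries (f : Z -> C) : C :=
  CSeries (fun n => f (Z.of_nat n)) + CSeries (fun n => f (- Z.of_nat (S n))%Z).

(* The sum of f 0, ..., f (n - 1). *)
Fixpoint Csum (n : nat) (f : nat -> C) : C :=
  match n with
  | O => 0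
  | S p => Csum p f + f p
  end.

(* Real coordinates x = x_1 + tau * x_2; [coord2 tau x] is x_2. *)
Definition coord2 (tau x : C) : R := (Im x / Im tau)%R.

Definition in_lattice (tau u : C) : Prop :=
  exists m n : Z, u = RtoC (IZR m) + RtoC (IZR n) * tau.

(** Smooth functions on the plane and the operator d/dxbar *)

(* Partial derivatives with respect to the real and imaginary parts. *)
Definition CDerive (f : R -> C) (s : R) : C :=
  (Derive (fun r => Re (f r)) s, Derive (fun r => Im (f r)) s).

Definition dRe (f : C -> C) (z : C) : C := CDerive (fun s => f (s, Im z)) (Re z).
Definition dIm (f : C -> C) (z : C) : C := CDerive (fun s => f (Re z, s)) (Im z).

Definition ex_partials (f : C -> C) (z : C) : Prop :=
  ex_derive (V := C_R_NormedModule) (fun s : R => f (s, Im z)) (Re z) /\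
  ex_derive (V := C_R_NormedModule) (fun s : R => f (Re z, s)) (Im z).

Fixpoint Cn (n : nat) (f : C -> C) : Prop :=
  match n with
  | O => forall z : C, continuous f z
  | S p => (forall z : C, continuous f z) /\ (forall z : C, ex_partials f z) /\
           Cn p (dRe f) /\ Cn p (dIm f)
  end.

Definition smooth (f : C -> C) : Prop := forall n : nat, Cn n f.

Definition dbar (f : C -> C) (z : C) : C := (dRe f z + Ci * dIm f z) / 2.

Definition entire (f : C -> C) : Prop :=
  forall z : C, ex_derive (K := C_AbsRing) (V := C_NormedModule) f z.

(** Sections of L(k,u), as functions on C.  A (0,1)-form g dxbar with values in
    L(k,u) is represented by its coefficient g, which satisfies the same
    quasi-periodicity because dxbar is translation invariant. *)

Definition quasi_periodic (tau : C) (k : Z) (u : C) (f : C -> C) : Prop :=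
  forall x : C,
    f (x + 1) = f x /\
    f (x + tau) =
      cexp (- (PI * Ci * IZR k * tau) - 2 * PI * Ci * (IZR k * x + u)) * f x.

Definition smooth_section (tau : C) (k : Z) (u : C) (f : C -> C) : Prop :=
  smooth f /\ quasi_periodic tau k u f.

Definition H0 (tau : C) (k : Z) (u : C) (f : C -> C) : Prop :=
  entire f /\ quasi_periodic tau k u f.

Definition herm (tau : C) (k : Z) (u : C) (f g : C -> C) : C :=
  RInt (V := C_R_CompleteNormedModule) (fun x2 : R =>
    RInt (V := C_R_CompleteNormedModule) (fun x1 : R =>
      let x := RtoC x1 + tau * RtoC x2 in
      f x * Cconj (g x) *
      RtoC (exp (- (2 * PI * Im tau *
                    (IZR k * x2 ^ 2 + 2 * x2 * coord2 tau u))))) 0 1) 0 1.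

(* On a curve every (0,1)-form is dbar-closed, so g dxbar is harmonic when it is
   killed by the formal adjoint of dbar, i.e. orthogonal to every dbar f.  The
   flat metric on dxbar only contributes a constant factor to the product. *)
Definition harmonic (tau : C) (k : Z) (u : C) (g : C -> C) : Prop :=
  smooth_section tau k u g /\
  forall f : C -> C, smooth_section tau k u f -> herm tau k u (dbar f) g = 0.

(* H^1(L(k,u)), identified with the harmonic (0,1)-forms. *)
Definition H1 (tau : C) (k : Z) (u : C) (g : C -> C) : Prop := harmonic tau k u g.

(** The product m_3 *)

(* The inverse of dbar from smooth sections of L(0,u) to (0,1)-forms with values
   in L(0,u), which exists and is unique for u outside the lattice. *)
Definition dbar_inv (tau u : C) (omega : C -> C) : C -> C :=
  epsilon (inhabits (fun _ : C => RtoC 0)) (fun h : C -> C =>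
    smooth_section tau 0 u h /\ forall x : C, dbar h x = omega x).

(* Orthogonal projection of smooth sections of L(l,w) onto H^0(L(l,w)). *)
Definition pr (tau : C) (l : Z) (w : C) (f : C -> C) : C -> C :=
  epsilon (inhabits (fun _ : C => RtoC 0)) (fun g : C -> C =>
    H0 tau l w g /\
    forall s : C -> C, H0 tau l w s -> herm tau l w (fun x => f x - g x) s = 0).

(* For beta2 in H^0(L(l,v)), with w = u + v. *)
Definition m3 (tau : C) (l : nat) (u w : C) (alpha beta1 beta2 : C -> C) : C -> C :=
  pr tau (Z.of_nat l) w
    (fun x => dbar_inv tau u (fun y => alpha y * beta1 y) x * beta2 x).

(** Bases *)

Definition theta (r : R) (x tau : C) : C :=
  ZSeries (fun n : Z =>
    let q := RtoC (IZR n + r)%R in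
    cexp (PI * Ci * tau * (q * q) + 2 * PI * Ci * q * x)).

Definition basis_H0 (tau : C) (k : nat) (u : C) (a : nat) (x : C) : C :=
  theta (INR a / INR k) (INR k * x + u) (INR k * tau).

(* Basis of H^1(L(-k,0)). *)
Definition basis_H1 (tau : C) (k : nat) (a : nat) (x : C) : C :=
  RtoC (PI * sqrt (2 * INR k) / sqrt (Im tau)) *
  Cconj (theta (INR a / INR k) (INR k * x) (INR k * tau)) *
  RtoC (exp (- (2 * PI * Im tau * INR k * coord2 tau x ^ 2))).

(* Coordinates of f in the basis e 0, ..., e (n - 1); only the values at indices
   below n are meaningful. *)
Definition coords (n : nat) (e : nat -> C -> C) (f : C -> C) : nat -> C :=
  epsilon (inhabits (fun _ : nat => RtoC 0)) (fun c : nat -> C =>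
    forall x : C, f x = Csum n (fun a => c a * e a x)).

(** The product m_3'.  Classes in Z/k and Z/l are represented by 0 <= a, b < k
    and 0 <= c, d < l. *)

Definition n_zero (tau : C) (k l : nat) (a d : nat) (w : C) : Z :=
  Zceil ((coord2 tau w + INR d) / INR l - INR a / INR k).

Definition Fukaya_coef (tau : C) (k l : nat) (a b c d : nat) (u w : C) : C :=
  - (2 * PI * Ci) *
  ZSeries (fun m : Z =>
    if (Z.eqb (m mod Z.of_nat k) ((Z.of_nat b - Z.of_nat a) mod Z.of_nat k) &&
        Z.eqb (m mod Z.of_nat l) ((Z.of_nat d - Z.of_nat c) mod Z.of_nat l))%Z%bool
    then
      cexp (PI * Ci * (INR k + INR l) / (INR k * INR l) *
              (tau * (IZR m * IZR m) + 2 * IZR m * u)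
            - 2 * PI * Ci * (IZR m * w / INR l)
            + 2 * PI * Ci * (IZR m * tau + u) *
              (IZR (n_zero tau k l a d w) - INR d / INR l + INR a / INR k))
      / (1 - cexp (2 * PI * Ci * (IZR m * tau + u)))
    else 0).

(* The trilinear extension from basis elements, for alpha in H^1(L(-k,0)),
   beta1 in H^0(L(k,u)) and beta2 in H^0(L(l,v)), with v = w - u. *)
Definition m3' (tau : C) (k l : nat) (u w : C) (alpha beta1 beta2 : C -> C)
    (x : C) : C :=
  let A := coords k (basis_H1 tau k) alpha in
  let B := coords k (basis_H0 tau k u) beta1 in
  let G := coords l (basis_H0 tau l (w - u)) beta2 in
  Csum k (fun a => Csum k (fun b => Csum l (fun c =>
    A a * B b * G c *
    Csum l (fun d => Fukaya_coef tau k l a b c d u w * basis_H0 tau l w d x)))).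

(* n is a bilinear map V x W -> U between spaces of functions, that is, a linear
   map from the tensor product of V and W to U. *)
Definition bilinear_on (V W U : (C -> C) -> Prop)
    (n : (C -> C) -> (C -> C) -> (C -> C)) : Prop :=
  (forall f g, V f -> W g -> U (n f g)) /\
  (forall (p : C) f1 f2 g, V f1 -> V f2 -> W g ->
     forall x, n (fun y => p * f1 y + f2 y) g x = p * n f1 g x + n f2 g x) /\
  (forall (p : C) f g1 g2, V f -> W g1 -> W g2 ->
     forall x, n f (fun y => p * g1 y + g2 y) x = p * n f g1 x + n f g2 x).

(* Main.v *)
Require Import Defs.
From Stdlib Require Import Lra Lia Psatz FunctionalExtensionality.

(** Write [t] for [Im tau], [s] for [Im z / t], [e_m] for the function exp (2 pi i m z) and
    [zeta_m] for exp (2 pi i (m tau + u)).  The proof computes m_3 from an explicit inverse of dbar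
    that contains a free integer [N], chosen only when the result is compared with m_3'.

    Inverting dbar.  The basis form of index [a] is, up to a constant, the series of the terms
    [b_n e_(-(kn+a))] times the Gaussian exp (- 2 pi t k (s + n + a/k)^2), where [1/b_n] is a theta
    coefficient ([basis_H1_gauss_series]).  Replace each Gaussian by a primitive: the odd one, minus
    its limit at plus infinity if [N <= n] and minus its limit at minus infinity if [n < N], so that
    the terms still decay in both directions ([tail_prim_bound]).  The sum [theta_prim] is smooth, and
    a constant [prim_const] times its dbar is the basis form ([dbar_theta_prim]).  Translation by
    [tau] moves the index [n] by one, and only one term changes sides; hence [theta_prim] has the
    quasi-periodicity of L(-k,0) up to a single exponential ([theta_prim_tau]).  Times [beta1], this
    defect is an entire periodic function.  Dividing its Fourier coefficients by [1 - zeta_m], which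
    is bounded away from 0 because [u] is not in the lattice ([zeta_lower]), gives an entire series
    [corr] with the opposite defect ([corr_tau]).  Therefore

      dbar^(-1) (alpha_a beta1) = prim_const * (beta1 * theta_prim + jump_const * corr)

    for every [N] ([dbar_sol_spec]); the inverse is unique since L(0,u) has no nonzero holomorphic
    section ([dbar_inv_unique]).

    Projecting.  Let [c_d(f)(y)] be the Fourier coefficient of index [d] of a smooth section [f] of
    L(l,w) on the line [Im z = y].  The pairing of [f] with the theta function of index [d] unfolds
    to the integral of [c_d(f)] over the whole line against a Gaussian ([pairing_theta]), and Stokes'
    formula gives [c_d(f)(y) = c_d(f)(0)] plus [2/i] times the integral of [c_d(dbar f)] from 0 to
    [y] ([fcoef_integral]).  So the coordinate of [pr f] of index [d] is [c_d(f)(0)] divided by a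
    theta coefficient, plus a linear functional of [dbar f] ([pr_formula], [pairing_smooth]).

    Comparing.  Apply this to [f = h * beta2] with [h] the above inverse.  The functional of
    [dbar f = alpha * (beta1 * beta2)] depends on [alpha] and on the product [beta1 * beta2] only, and
    so does the contribution of [beta1 * theta_prim * beta2] to [c_d(f)(0)].  The contribution of
    [corr * beta2], with [N] the integer [n_zero] for [a] and [d], is the Fukaya series: the Fourier
    coefficients of [beta1] and [beta2] select the two congruences, the denominators are [1 - zeta_m],
    and [prim_const * jump_const = - 2 pi i] by the Gaussian integral ([prim_const_jump_const],
    [Fukaya_sum]).  What is left of [m3 - m3'] is the bilinear map [n2map].

    Three classical facts support the coordinates used above: a continuous periodic function is
    determined by its Fourier coefficients ([fourier_unique]), the coefficients of an entire periodic
    function do not depend on [y] ([goursat], [periodic_integral_const]), and a harmonic form is a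
    Gaussian times the conjugate of a holomorphic section ([harmonic_conj_holomorphic]). *)

(** * The complex exponential *)

Lemma im_le_Cmod (z : C) : (Rabs (Im z) <= Cmod z)%R.
Proof. eapply Rle_trans; [|apply Rmax_Cmod]. apply Rmax_r. Qed.
Lemma Cmod_le_sum (z : C) : (Cmod z <= Rabs (Re z) + Rabs (Im z))%R.
Proof.
  assert (Hz : z = RtoC (Re z) + Ci * RtoC (Im z)).
  { destruct z as [a b]. unfold RtoC, Ci, Cplus, Cmult; simpl. f_equal; ring. }
  rewrite Hz at 1. eapply Rle_trans; [apply Cmod_triangle|].
  rewrite Cmod_mult, Cmod_Ci, !Cmod_R. lra.
Qed.

Lemma C_ext (z w : C) : Re z = Re w -> Im z = Im w -> z = w.
Proof. destruct z, w; simpl; intros -> ->; reflexivity. Qed.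

Lemma Re_cexp z : Re (cexp z) = (exp (Re z) * cos (Im z))%R.
Proof. unfold cexp. simpl. ring. Qed.
Lemma Im_cexp z : Im (cexp z) = (exp (Re z) * sin (Im z))%R.
Proof. unfold cexp. simpl. ring. Qed.
Lemma cexp_plus z w : cexp (z + w) = cexp z * cexp w.
Proof.
  apply C_ext; rewrite ?re_mult, ?im_mult, ?Re_cexp, ?Im_cexp, ?re_plus, ?im_plus, exp_plus;
  [rewrite cos_plus|rewrite sin_plus]; ring.
Qed.
Lemma cexp_0 : cexp 0 = 1.
Proof. apply C_ext; rewrite ?Re_cexp, ?Im_cexp; simpl; rewrite exp_0, ?cos_0, ?sin_0; ring. Qed.
Lemma Cmod_cexp z : Cmod (cexp z) = exp (Re z).
Proof.
  unfold Cmod. change (fst (cexp z)) with (Re (cexp z)). change (snd (cexp z)) with (Im (cexp z)).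
  rewrite Re_cexp, Im_cexp.
  replace ((exp (Re z) * cos (Im z)) ^ 2 + (exp (Re z) * sin (Im z)) ^ 2)%R
    with (Rsqr (exp (Re z))).
  - apply sqrt_Rsqr. left; apply exp_pos.
  - pose proof (sin2_cos2 (Im z)) as H. unfold Rsqr in *.
    replace ((exp (Re z) * cos (Im z)) ^ 2 + (exp (Re z) * sin (Im z)) ^ 2)%R
    with (exp (Re z) * exp (Re z) * (sin (Im z) * sin (Im z) + cos (Im z) * cos (Im z)))%R by ring.
    rewrite H; ring.
Qed.
Lemma cexp_neq_0 z : cexp z <> 0.
Proof. intro H. assert (Cmod (cexp z) = 0)%R by (rewrite H; apply Cmod_0).
  rewrite Cmod_cexp in H0. pose proof (exp_pos (Re z)). lra. Qed.
Lemma cexp_opp z : cexp (- z) = / cexp z.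
Proof.
  assert (cexp (-z) * cexp z = 1) by (rewrite <- cexp_plus; replace (-z+z) with (RtoC 0) by ring; apply cexp_0).
  pose proof (cexp_neq_0 z). rewrite <- (Cmult_1_r (cexp (-z))), <- (Cinv_r (cexp z)) by auto.
  rewrite Cmult_assoc, H. ring.
Qed.
Lemma cexp_conj z : Cconj (cexp z) = cexp (Cconj z).
Proof. apply C_ext; rewrite ?re_conj, ?im_conj, ?Re_cexp, ?Im_cexp, re_conj, im_conj, ?cos_neg, ?sin_neg; ring. Qed.
Lemma cexp_R (x : R) : cexp (RtoC x) = RtoC (exp x).
Proof. apply C_ext; rewrite ?Re_cexp, ?Im_cexp; simpl; rewrite ?cos_0, ?sin_0; ring. Qed.

Lemma cos_2PI_Z (n : Z) : cos (2 * PI * IZR n) = 1%R /\ sin (2 * PI * IZR n) = 0%R.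
Proof.
  assert (Hn : forall m : nat, cos (2 * PI * INR m) = 1%R /\ sin (2 * PI * INR m) = 0%R).
  { intro m. replace (2 * PI * INR m)%R with (0 + 2 * INR m * PI)%R by ring.
    rewrite cos_period, sin_period, cos_0, sin_0. auto. }
  destruct (Z_le_gt_dec 0 n) as [H|H].
  - rewrite <- (Z2Nat.id n H), <- INR_IZR_INZ. apply Hn.
  - destruct (Hn (Z.to_nat (-n))) as [H1 H2].
    rewrite INR_IZR_INZ, Z2Nat.id, opp_IZR in H1, H2 by lia.
    replace (2 * PI * IZR n)%R with (- (2 * PI * - IZR n))%R by ring.
    rewrite cos_neg, sin_neg, H1, H2. split; ring.
Qed.
Lemma cexp_2PI_Z (n : Z) : cexp (2 * PI * Ci * IZR n) = 1.
Proof.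
  destruct (cos_2PI_Z n) as [H1 H2].
  replace (2 * PI * Ci * IZR n) with ((0, (2 * PI * IZR n)%R) : C)
    by (apply C_ext; simpl; ring).
  apply C_ext; rewrite ?Re_cexp, ?Im_cexp; simpl; rewrite exp_0, ?H1, ?H2; ring.
Qed.

Lemma cexp_eq_1 (z : C) : cexp z = 1 -> exists n : Z, z = 2 * PI * Ci * IZR n.
Proof.
  intro H.
  assert (Hr : exp (Re z) = 1%R) by (rewrite <- Cmod_cexp, H; apply Cmod_1).
  assert (Hre : Re z = 0%R) by (apply exp_inv; rewrite exp_0; auto).
  assert (Hc : cos (Im z) = 1%R).
  { pose proof (Re_cexp z) as E. rewrite H, Hr in E. simpl in E. lra. }
  assert (Hs : sin (Im z / 2) = 0%R).
  { replace (Im z) with (2 * (Im z / 2))%R in Hc by field.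
    rewrite cos_2a_sin in Hc. assert (sin (Im z/2) * sin (Im z/2) = 0)%R by lra.
    apply Rmult_integral in H0. tauto. }
  destruct (sin_eq_0_0 _ Hs) as [n Hn]. exists n.
  apply C_ext; simpl; rewrite ?Hre; [ring|]. lra.
Qed.

(** * Continuity and derivatives of complex-valued functions *)
Definition ccont (f : R -> C) : Prop := forall t : R, continuous f t.

Lemma ctn_pair {U : UniformSpace} (f : U -> C) (x : U) :
  continuous (fun u => Re (f u)) x -> continuous (fun u => Im (f u)) x -> continuous f x.
Proof.
  intros H1 H2.
  apply (continuous_ext (fun u => (Re (f u), Im (f u)))).
  { intro u. destruct (f u); reflexivity. }
  apply (continuous_comp_2 (fun u => Re (f u)) (fun u => Im (f u)) (fun a b => (a, b)) x H1 H2).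
  apply (continuous_ext (fun u => u)). { intros [a b]; reflexivity. } apply continuous_id.
Qed.
Lemma ctn_Re {U : UniformSpace} (f : U -> C) (x : U) :
  continuous f x -> continuous (fun u => Re (f u)) x.
Proof. intro H. apply (continuous_comp f Re x H). destruct (f x) as [a b]. apply continuous_fst. Qed.
Lemma ctn_Im {U : UniformSpace} (f : U -> C) (x : U) :
  continuous f x -> continuous (fun u => Im (f u)) x.
Proof. intro H. apply (continuous_comp f Im x H). destruct (f x) as [a b]. apply continuous_snd. Qed.
Lemma ctn_RtoC {U : UniformSpace} (f : U -> R) (x : U) :
  continuous f x -> continuous (fun u => RtoC (f u)) x.
Proof. intro H. apply ctn_pair; simpl; [exact H|apply continuous_const]. Qed.
Lemma ctn_plus {U : UniformSpace} (f g : U -> C) (x : U) :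
  continuous f x -> continuous g x -> continuous (fun u => f u + g u) x.
Proof.
  intros Hf Hg. apply ctn_pair.
  - apply (continuous_plus (fun u => Re (f u)) (fun u => Re (g u)) x); now apply ctn_Re.
  - apply (continuous_plus (fun u => Im (f u)) (fun u => Im (g u)) x); now apply ctn_Im.
Qed.
Lemma ctn_opp {U : UniformSpace} (f : U -> C) (x : U) :
  continuous f x -> continuous (fun u => - f u) x.
Proof.
  intros Hf. apply ctn_pair.
  - apply (continuous_opp (fun u => Re (f u)) x); now apply ctn_Re.
  - apply (continuous_opp (fun u => Im (f u)) x); now apply ctn_Im.
Qed.
Lemma ctn_minus {U : UniformSpace} (f g : U -> C) (x : U) :
  continuous f x -> continuous g x -> continuous (fun u => f u - g u) x.
Proof. intros Hf Hg. apply ctn_plus; auto. now apply ctn_opp. Qed.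
Lemma ctn_Rmult {U : UniformSpace} (f g : U -> R) (x : U) :
  continuous f x -> continuous g x -> continuous (fun u => (f u * g u)%R) x.
Proof. intros Hf Hg. apply (continuous_mult (K:=R_AbsRing) f g x Hf Hg). Qed.
Lemma ctn_Rplus {U : UniformSpace} (f g : U -> R) (x : U) :
  continuous f x -> continuous g x -> continuous (fun u => (f u + g u)%R) x.
Proof. intros Hf Hg. apply (continuous_plus f g x Hf Hg). Qed.
Lemma ctn_Ropp {U : UniformSpace} (f : U -> R) (x : U) :
  continuous f x -> continuous (fun u => (- f u)%R) x.
Proof. intros Hf. apply (continuous_opp f x Hf). Qed.
Lemma ctn_mult {U : UniformSpace} (f g : U -> C) (x : U) :
  continuous f x -> continuous g x -> continuous (fun u => f u * g u) x.
Proof.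
  intros Hf Hg.
  pose proof (ctn_Re _ _ Hf). pose proof (ctn_Im _ _ Hf).
  pose proof (ctn_Re _ _ Hg). pose proof (ctn_Im _ _ Hg).
  apply ctn_pair; simpl.
  - apply ctn_Rplus; [|apply ctn_Ropp]; apply ctn_Rmult; auto.
  - apply ctn_Rplus; apply ctn_Rmult; auto.
Qed.
Lemma ctn_conj {U : UniformSpace} (f : U -> C) (x : U) :
  continuous f x -> continuous (fun u => Cconj (f u)) x.
Proof. intros Hf. apply ctn_pair; simpl; [|apply ctn_Ropp]; [now apply ctn_Re|now apply ctn_Im]. Qed.
Lemma ctn_Rfun {U : UniformSpace} (h : R -> R) (f : U -> R) (x : U) :
  (forall t, ex_derive h t) -> continuous f x -> continuous (fun u => h (f u)) x.
Proof. intros Hh Hf. apply (continuous_comp f h x Hf). apply (ex_derive_continuous h). apply Hh. Qed.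
Lemma ctn_exp {U : UniformSpace} (f : U -> R) (x : U) :
  continuous f x -> continuous (fun u => exp (f u)) x.
Proof. apply ctn_Rfun. intro t. auto_derive. auto. Qed.
Lemma ctn_cexp {U : UniformSpace} (f : U -> C) (x : U) :
  continuous f x -> continuous (fun u => cexp (f u)) x.
Proof.
  intro Hf. pose proof (ctn_Re _ _ Hf). pose proof (ctn_Im _ _ Hf).
  apply ctn_mult; [apply ctn_RtoC, ctn_exp; auto|].
  apply ctn_plus; [|apply ctn_mult; [apply continuous_const|]]; apply ctn_RtoC, ctn_Rfun; auto;
  intro t; auto_derive; auto.
Qed.

(** Turns the norm estimates for integrals of C-valued functions into estimates of [Cmod]. *)
Lemma norm_C (z : C) : norm (V := C_R_NormedModule) z = Cmod z.
Proof.
  unfold norm; simpl. unfold prod_norm, Cmod. unfold norm; simpl. unfold abs; simpl.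
  rewrite !Rmult_1_r. change (Rabs (fst z) * Rabs (fst z))%R with (Rsqr (Rabs (fst z))).
  change (Rabs (snd z) * Rabs (snd z))%R with (Rsqr (Rabs (snd z))).
  rewrite <- !Rsqr_abs. reflexivity.
Qed.

Lemma ctn_Cmod {U : UniformSpace} (f : U -> C) (x : U) :
  continuous f x -> continuous (fun u => Cmod (f u)) x.
Proof.
  intro Hf. apply (continuous_comp f Cmod x Hf).
  apply (continuous_ext (norm (V := C_R_NormedModule))); [apply norm_C|].
  apply (filterlim_norm (V := C_R_NormedModule)).
Qed.
Lemma ctn_at {U V : UniformSpace} (F : C -> V) (a b : U -> R) (x : U) : (forall z, continuous F z) ->
  continuous a x -> continuous b x -> continuous (fun u => F (a u, b u)) x.
Proof.
  intros H Ha Hb. apply (continuous_comp_2 a b (fun r y => F (r, y)) x Ha Hb).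
  apply (continuous_ext F); [intros [r y]; reflexivity|]. apply H.
Qed.
Lemma ctn_csum {U : UniformSpace} (f : nat -> U -> C) n (x : U) :
  (forall i, continuous (f i) x) -> continuous (fun u => Csum n (fun i => f i u)) x.
Proof. intro H. induction n; simpl; [apply continuous_const|apply ctn_plus; auto]. Qed.
Lemma ctn_Re_id (z : C) : continuous Re z.
Proof. destruct z as [a b]. apply continuous_fst. Qed.
Lemma ctn_Im_id (z : C) : continuous Im z.
Proof. destruct z as [a b]. apply continuous_snd. Qed.

Lemma ctn_Rminus {U : UniformSpace} (f g : U -> R) (x : U) :
  continuous f x -> continuous g x -> continuous (fun u => (f u - g u)%R) x.
Proof. intros Hf Hg. apply (continuous_minus f g x Hf Hg). Qed.
Lemma ctn_Rpow {U : UniformSpace} (f : U -> R) n (x : U) : continuous f x -> continuous (fun u => (f u ^ n)%R) x.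
Proof. intro H. induction n; simpl; [apply continuous_const|now apply ctn_Rmult]. Qed.
Lemma ctn_Cpow {U : UniformSpace} (f : U -> C) n (x : U) : continuous f x -> continuous (fun u => (f u ^ n)%C) x.
Proof. intro H. induction n; simpl; [apply continuous_const|now apply ctn_mult]. Qed.

(** Lets proof search use hypotheses [ccont f]. *)
Lemma ccont_at f t : ccont f -> continuous f t.
Proof. intro H. apply H. Qed.
Create HintDb cont.
#[export] Hint Resolve ccont_at ctn_Re_id ctn_Im_id : cont.

(** Recursion on the shape of the function; the leaves are hypotheses or lemmas of the database. *)
Ltac cont :=
  intros; try match goal with |- ccont _ => intro end; cbn beta iota delta [Re Im fst snd];
  lazymatch goal with
  | |- continuous (fun _ => ?c) _ => apply continuous_const
  | |- continuous (fun x => x) _ => apply continuous_id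
  | |- continuous (fun x => (@?f x + @?g x)%C) _ => apply (ctn_plus f g); cont
  | |- continuous (fun x => (@?f x - @?g x)%C) _ => apply (ctn_minus f g); cont
  | |- continuous (fun x => (@?f x * @?g x)%C) _ => apply (ctn_mult f g); cont
  | |- continuous (fun x => (- @?f x)%C) _ => apply (ctn_opp f); cont
  | |- continuous (fun x => (@?f x + @?g x)%R) _ => apply (ctn_Rplus f g); cont
  | |- continuous (fun x => (@?f x - @?g x)%R) _ => apply (ctn_Rminus f g); cont
  | |- continuous (fun x => (@?f x * @?g x)%R) _ => apply (ctn_Rmult f g); cont
  | |- continuous (fun x => (@?f x / ?c)%R) _ => apply (ctn_Rmult f (fun _ => / c)%R); cont
  | |- continuous (fun x => Csum ?n (fun i => @?f x i)) _ => apply (ctn_csum (fun i x => f x i) n); cont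
  | |- continuous (fun x => (@?f x / ?c)%C) _ => apply (ctn_mult f (fun _ => / c)%C); cont
  | |- continuous (fun x => (- @?f x)%R) _ => apply (ctn_Ropp f); cont
  | |- continuous (fun x => (@?f x ^ ?n)%R) _ => apply (ctn_Rpow f n); cont
  | |- continuous (fun x => (@?f x ^ ?n)%C) _ => apply (ctn_Cpow f n); cont
  | |- continuous (fun x => RtoC (@?f x)) _ => apply (ctn_RtoC f); cont
  | |- continuous (fun x => Re (@?f x)) _ => apply (ctn_Re f); cont
  | |- continuous (fun x => Im (@?f x)) _ => apply (ctn_Im f); cont
  | |- continuous (fun x => Cmod (@?f x)) _ => apply (ctn_Cmod f); cont
  | |- continuous (fun x => Cconj (@?f x)) _ => apply (ctn_conj f); cont
  | |- continuous (fun x => exp (@?f x)) _ => apply (ctn_exp f); cont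
  | |- continuous (fun x => cexp (@?f x)) _ => apply (ctn_cexp f); cont
  | |- continuous (fun x => (@?a x, @?b x)) _ => apply (ctn_pair (fun x => (a x, b x))); cont
  | |- continuous (fun x => ?F (@?a x, @?b x)) _ => apply (ctn_at F a b); cont
  | |- continuous (fun x => ?F (@?a x)) _ => first [solve [auto with cont] | apply (continuous_comp a F); cont]
  | _ => solve [auto with cont]
  end.

Definition cderiv (f : R -> C) (t : R) (l : C) : Prop :=
  is_derive (V := C_R_NormedModule) f t l.

(** [CDerive] and the real differentiation rules work componentwise; this is the bridge to them. *)
Lemma cderiv_iff f t l :
  cderiv f t l <-> is_derive (fun s => Re (f s)) t (Re l) /\ is_derive (fun s => Im (f s)) t (Im l).
Proof.
  split.
  - intro H. split.
    + apply (filterdiff_ext_lin (fun s => Re (f s)) (fun y : R => Re (scal (V:=C_R_NormedModule) y l))).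
      2:{ intro y. reflexivity. }
      apply (filterdiff_comp' (V:=C_R_NormedModule) f Re t _ Re H).
      apply filterdiff_linear. apply is_linear_fst.
    + apply (filterdiff_ext_lin (fun s => Im (f s)) (fun y : R => Im (scal (V:=C_R_NormedModule) y l))).
      2:{ intro y. reflexivity. }
      apply (filterdiff_comp' (V:=C_R_NormedModule) f Im t _ Im H).
      apply filterdiff_linear. apply is_linear_snd.
  - intros [H1 H2].
    apply (filterdiff_ext (V:=C_R_NormedModule) (fun s => (Re (f s), Im (f s)))).
    { intro s. destruct (f s); reflexivity. }
    apply (filterdiff_ext_lin (V:=C_R_NormedModule) _ (fun y : R => (scal y (Re l), scal y (Im l)))).
    2:{ intro y. destruct l; reflexivity. }
    apply (filterdiff_comp'_2 (W:=C_R_NormedModule) (fun s => Re (f s)) (fun s => Im (f s)) (fun a b => (a, b)) t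
      _ _ (fun a b => (a, b)) H1 H2).
    apply (filterdiff_ext (V:=C_R_NormedModule) (fun u => u)). { intros [a b]; reflexivity. }
    apply (filterdiff_ext_lin (V:=C_R_NormedModule) _ (fun u => u)). 2:{ intros [a b]; reflexivity. }
    apply filterdiff_id.
Qed.

Lemma cderiv_ext f g t l : (forall s, f s = g s) -> cderiv f t l -> cderiv g t l.
Proof. intros H. apply (is_derive_ext (V:=C_R_NormedModule) f g t l H). Qed.
Lemma cderiv_const c t : cderiv (fun _ => c) t 0.
Proof. apply (is_derive_const (V:=C_R_NormedModule) c t). Qed.
Lemma cderiv_plus f g t a b : cderiv f t a -> cderiv g t b -> cderiv (fun s => f s + g s) t (a + b).
Proof. intros. apply (is_derive_plus (V:=C_R_NormedModule) f g t a b); auto. Qed.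
Lemma is_derive_eq (f : R -> R) t (a b : R) : is_derive f t a -> a = b -> is_derive f t b.
Proof. intros H <-; auto. Qed.
Lemma cderiv_eq f t a b : cderiv f t a -> a = b -> cderiv f t b.
Proof. intros H <-; auto. Qed.
Lemma cderiv_mult f g t a b :
  cderiv f t a -> cderiv g t b -> cderiv (fun s => f s * g s) t (a * g t + f t * b).
Proof.
  rewrite !cderiv_iff. intros [H1 H2] [H3 H4].
  assert (comm : forall n m : R_AbsRing, mult n m = mult m n) by (intros; apply Rmult_comm).
  split; simpl.
  - eapply is_derive_eq.
    + apply (is_derive_minus (V:=R_NormedModule) (fun s => (Re (f s) * Re (g s))%R) (fun s => (Im (f s) * Im (g s))%R)).
      * apply (is_derive_mult (K:=R_AbsRing) _ _ _ _ _ H1 H3 comm).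
      * apply (is_derive_mult (K:=R_AbsRing) _ _ _ _ _ H2 H4 comm).
    + unfold minus, plus, opp, mult, Re, Im; simpl. ring.
  - eapply is_derive_eq.
    + apply (is_derive_plus (V:=R_NormedModule) (fun s => (Re (f s) * Im (g s))%R) (fun s => (Im (f s) * Re (g s))%R)).
      * apply (is_derive_mult (K:=R_AbsRing) _ _ _ _ _ H1 H4 comm).
      * apply (is_derive_mult (K:=R_AbsRing) _ _ _ _ _ H2 H3 comm).
    + unfold minus, plus, opp, mult, Re, Im; simpl. ring.
Qed.
Lemma cderiv_scal c f t a : cderiv f t a -> cderiv (fun s => c * f s) t (c * a).
Proof.
  intro H. eapply cderiv_eq; [apply cderiv_mult; [apply cderiv_const|exact H]|]. cbv beta. ring.
Qed.
Lemma cderiv_RtoC (f : R -> R) t a : is_derive f t a -> cderiv (fun s => RtoC (f s)) t (RtoC a).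
Proof. intro H. apply cderiv_iff; simpl. split; auto. apply (is_derive_const (V:=R_NormedModule)). Qed.
Lemma cderiv_conj f t a : cderiv f t a -> cderiv (fun s => Cconj (f s)) t (Cconj a).
Proof.
  rewrite !cderiv_iff. intros [H1 H2]. split; simpl; auto.
  apply (is_derive_opp (V:=R_NormedModule) _ _ _ H2).
Qed.
Lemma cderiv_cexp f t a : cderiv f t a -> cderiv (fun s => cexp (f s)) t (a * cexp (f t)).
Proof.
  rewrite !cderiv_iff. intros [H1 H2].
  assert (comm : forall n m : R_AbsRing, mult n m = mult m n) by (intros; apply Rmult_comm).
  assert (He : is_derive (fun s => exp (Re (f s))) t (Re a * exp (Re (f t)))%R).
  { apply (is_derive_comp exp (fun s => Re (f s))); auto. apply is_derive_exp. }
  assert (Hc : is_derive (fun s => cos (Im (f s))) t (Im a * - sin (Im (f t)))%R).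
  { apply (is_derive_comp cos (fun s => Im (f s))); auto. apply is_derive_cos. }
  assert (Hs : is_derive (fun s => sin (Im (f s))) t (Im a * cos (Im (f t)))%R).
  { apply (is_derive_comp sin (fun s => Im (f s))); auto. apply is_derive_sin. }
  split.
  - apply (is_derive_ext (fun s => (exp (Re (f s)) * cos (Im (f s)))%R)).
    { intro s. symmetry. apply Re_cexp. }
    eapply is_derive_eq; [apply (is_derive_mult (K:=R_AbsRing) _ _ _ _ _ He Hc comm)|].
    rewrite re_mult, Re_cexp, Im_cexp. unfold plus, mult, Re, Im; simpl. ring.
  - apply (is_derive_ext (fun s => (exp (Re (f s)) * sin (Im (f s)))%R)).
    { intro s. symmetry. apply Im_cexp. }
    eapply is_derive_eq; [apply (is_derive_mult (K:=R_AbsRing) _ _ _ _ _ He Hs comm)|].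
    rewrite im_mult, Re_cexp, Im_cexp. unfold plus, mult, Re, Im; simpl. ring.
Qed.
Lemma cderiv_continuous f t a : cderiv f t a -> continuous f t.
Proof. intro H. apply (ex_derive_continuous (V:=C_R_NormedModule) f t). exists a; exact H. Qed.
Lemma cderiv_CDerive f t a : cderiv f t a -> CDerive f t = a.
Proof.
  rewrite cderiv_iff. intros [H1 H2]. unfold CDerive.
  apply C_ext; simpl; now apply is_derive_unique.
Qed.
Lemma CDerive_correct f t : ex_derive (V:=C_R_NormedModule) f t -> cderiv f t (CDerive f t).
Proof. intros [l Hl]. now rewrite (cderiv_CDerive _ _ _ Hl). Qed.

(** * Integrals of complex-valued functions *)

Definition cint (f : R -> C) (a b : R) : C := RInt (V := C_R_CompleteNormedModule) f a b.
Notation is_cint := (is_RInt (V := C_R_NormedModule)).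

Lemma ccont_ex f a b : ccont f -> ex_RInt (V := C_R_NormedModule) f a b.
Proof. intro H. apply (ex_RInt_continuous (V:=C_R_CompleteNormedModule)). intros z _. apply H. Qed.
Lemma cint_correct f a b : ccont f -> is_cint f a b (cint f a b).
Proof. intro H. apply (RInt_correct (V:=C_R_CompleteNormedModule)). now apply ccont_ex. Qed.
Lemma cint_unique f a b l : is_cint f a b l -> cint f a b = l.
Proof. apply (is_RInt_unique (V:=C_R_CompleteNormedModule)). Qed.
Lemma cint_ext f g a b : (forall t, f t = g t) -> cint f a b = cint g a b.
Proof. intro H. apply (RInt_ext (V:=C_R_CompleteNormedModule)). intros; apply H. Qed.
Lemma cint_parts f a b : ccont f ->
  cint f a b = (RInt (fun t => Re (f t)) a b, RInt (fun t => Im (f t)) a b).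
Proof.
  intro H. apply cint_unique. apply is_RInt_fct_extend_pair; apply (RInt_correct (V:=R_CompleteNormedModule));
  apply (ex_RInt_continuous (V:=R_CompleteNormedModule)); intros; [apply ctn_Re|apply ctn_Im]; apply H.
Qed.
Lemma cint_plus f g a b : ccont f -> ccont g -> cint (fun t => f t + g t) a b = cint f a b + cint g a b.
Proof. intros. apply (RInt_plus (V:=C_R_CompleteNormedModule)); now apply ccont_ex. Qed.
Lemma cint_chasles f a b c : ccont f -> cint f a b + cint f b c = cint f a c.
Proof. intros. apply (RInt_Chasles (V:=C_R_CompleteNormedModule)); now apply ccont_ex. Qed.
Lemma cint_const c a b : cint (fun _ => c) a b = RtoC (b - a) * c.
Proof. unfold cint. rewrite RInt_const. apply scal_R_Cmult. Qed.
Lemma ccont_const c : ccont (fun _ => c).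
Proof. intro t. apply continuous_const. Qed.
Lemma ccont_plus f g : ccont f -> ccont g -> ccont (fun t => f t + g t).
Proof. intros ? ? t; now apply ctn_plus. Qed.
Lemma ccont_minus f g : ccont f -> ccont g -> ccont (fun t => f t - g t).
Proof. intros ? ? t; now apply ctn_minus. Qed.
Lemma ccont_mult f g : ccont f -> ccont g -> ccont (fun t => f t * g t).
Proof. intros ? ? t; now apply ctn_mult. Qed.
Lemma ccont_conj f : ccont f -> ccont (fun t => Cconj (f t)).
Proof. intros ? t; now apply ctn_conj. Qed.
Lemma ccont_ext f g : (forall t, f t = g t) -> ccont f -> ccont g.
Proof. intros H Hf t. apply (continuous_ext f g t H). apply Hf. Qed.

Lemma rcont_ex (f : R -> R) a b : (forall t, continuous f t) -> ex_RInt f a b.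
Proof. intro H. apply (ex_RInt_continuous (V:=R_CompleteNormedModule)). intros z _. apply H. Qed.
Lemma rscal (f : R -> R) c a b : (forall t, continuous f t) ->
  RInt (fun t => (c * f t)%R) a b = (c * RInt f a b)%R.
Proof. intro H. apply (RInt_scal (V:=R_CompleteNormedModule)). now apply rcont_ex. Qed.
(** The integral is linear over the reals by construction; complex scalars need the two components. *)
Lemma cint_scal c f a b : ccont f -> cint (fun t => c * f t) a b = c * cint f a b.
Proof.
  intro H.
  assert (H1 : forall t, continuous (fun t => Re (f t)) t) by cont.
  assert (H2 : forall t, continuous (fun t => Im (f t)) t) by cont.
  assert (K : forall (c : R) (f : R -> R) (t : R), continuous f t -> continuous (fun t => (c * f t)%R) t).
  { cont. }
  rewrite !cint_parts; auto. 2: { cont. }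
  apply C_ext; simpl.
  - rewrite (RInt_minus (V:=R_CompleteNormedModule) (fun t => (Re c * Re (f t))%R) (fun t => (Im c * Im (f t))%R));
      try (apply rcont_ex; intro; apply K; auto).
    rewrite !rscal; auto.
  - rewrite (RInt_plus (V:=R_CompleteNormedModule) (fun t => (Re c * Im (f t))%R) (fun t => (Im c * Re (f t))%R));
      try (apply rcont_ex; intro; apply K; auto).
    rewrite !rscal; auto.
Qed.
Lemma cint_minus f g a b : ccont f -> ccont g -> cint (fun t => f t - g t) a b = cint f a b - cint g a b.
Proof.
  intros Hf Hg. rewrite (cint_ext _ (fun t => f t + (-(1)) * g t)) by (intro; ring).
  rewrite cint_plus; auto. 2:{ cont. }
  rewrite cint_scal; auto. ring.
Qed.
Lemma cint_conj f a b : ccont f -> cint (fun t => Cconj (f t)) a b = Cconj (cint f a b).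
Proof.
  intro H. rewrite !cint_parts; auto. 2: now apply ccont_conj.
  apply C_ext; simpl; auto.
  apply (RInt_opp (V:=R_CompleteNormedModule)). apply rcont_ex. intro; apply ctn_Im, H.
Qed.
Lemma cint_RtoC (f : R -> R) a b : (forall t, continuous f t) ->
  cint (fun t => RtoC (f t)) a b = RtoC (RInt f a b).
Proof.
  intro H. rewrite cint_parts. 2:{ cont. }
  simpl. apply C_ext; simpl; auto. rewrite RInt_const. unfold scal; simpl; unfold mult; simpl; ring.
Qed.
Lemma cint_bound f a b M : (a <= b)%R -> ccont f ->
  (forall t, (a <= t <= b)%R -> (Cmod (f t) <= M)%R) -> (Cmod (cint f a b) <= (b - a) * M)%R.
Proof.
  intros Hab Hf HM. rewrite <- norm_C.
  apply (norm_RInt_le_const (V:=C_R_NormedModule) f a b (cint f a b) M Hab).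
  - intros x Hx. rewrite norm_C. now apply HM.
  - now apply cint_correct.
Qed.
Lemma cint_bound_abs f a b M : ccont f ->
  (forall t, (Rmin a b <= t <= Rmax a b)%R -> (Cmod (f t) <= M)%R) -> (Cmod (cint f a b) <= Rabs (b - a) * M)%R.
Proof.
  intros Hf HM. rewrite <- norm_C.
  apply (norm_RInt_le_const_abs (V:=C_R_NormedModule) f a b (cint f a b) M).
  - intros x Hx. rewrite norm_C. now apply HM.
  - now apply cint_correct.
Qed.
Lemma cint_deriv f a x : ccont f -> cderiv (fun y => cint f a y) x (f x).
Proof.
  intro H. apply (is_derive_RInt (V:=C_R_NormedModule) f (fun y => cint f a y) a x).
  - apply filter_forall. intro y. now apply cint_correct.
  - apply H.
Qed.
Lemma cint_FTC F f a b : (forall t, cderiv F t (f t)) -> ccont f -> cint f a b = F b - F a.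
Proof.
  intros HF Hf. apply cint_unique.
  apply (is_RInt_derive (V:=C_R_CompleteNormedModule) F f a b); intros; auto. apply HF.
Qed.
Lemma cint_lin f u v a b : ccont f ->
  cint (fun t => RtoC u * f (u * t + v)%R) a b = cint f (u * a + v) (u * b + v).
Proof.
  intro H. unfold cint. rewrite <- (RInt_comp_lin (V:=C_R_CompleteNormedModule) f u v a b).
  2: now apply ccont_ex.
  apply (RInt_ext (V:=C_R_CompleteNormedModule)). intros. symmetry. apply scal_R_Cmult.
Qed.
Lemma cint_shift f c a b : ccont f -> cint (fun t => f (t + c)%R) a b = cint f (a + c) (b + c).
Proof.
  intro H. pose proof (cint_lin f 1 c a b H) as E. rewrite !Rmult_1_l in E. rewrite <- E.
  apply cint_ext. intro t. rewrite Rmult_1_l. ring.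
Qed.
Lemma cint_point f a : cint f a a = 0.
Proof. apply (RInt_point (V:=C_R_CompleteNormedModule)). Qed.
Lemma cint_swap f a b : ccont f -> cint f b a = - cint f a b.
Proof.
  intro H. pose proof (cint_chasles f a b a H) as E. rewrite cint_point in E.
  replace (cint f b a) with (cint f a b + cint f b a - cint f a b) by ring. rewrite E. ring.
Qed.
(** The two pieces by which the shifted period differs from [0, 1] agree by periodicity. *)
Lemma cint_periodic f c : ccont f -> (forall t, f (t + 1)%R = f t) -> cint (fun t => f (t + c)%R) 0 1 = cint f 0 1.
Proof.
  intros Hf Hp.
  assert (E : forall c, cint f 0 c = cint f 1 (1 + c)).
  { intro d. rewrite <- (cint_ext (fun t => f (t + 1)%R) f 0 d Hp).
    rewrite cint_shift by auto. f_equal; ring. }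
  rewrite cint_shift by auto. rewrite Rplus_0_l.
  rewrite <- (cint_chasles f c 0 (1 + c)), <- (cint_chasles f 0 1 (1 + c)) by auto.
  rewrite <- E, (cint_swap f 0 c) by auto. ring.
Qed.

Lemma cont2_pt (f : C -> R) (z : C) : continuous f z ->
  continuity_2d_pt (fun r y => f (r, y)) (Re z) (Im z).
Proof.
  intro H. apply continuity_2d_pt_filterlim. destruct z as [x y]; simpl in *.
  apply (filterlim_ext f); [intros [a b]; reflexivity|]. exact H.
Qed.
Lemma ctn_slice {V : UniformSpace} (F : C -> V) (y r : R) : (forall z, continuous F z) -> continuous (fun r => F (r, y)) r.
Proof. cont. Qed.
Lemma ctn_vslice {V : UniformSpace} (F : C -> V) (y r : R) : (forall z, continuous F z) -> continuous (fun y => F (r, y)) y.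
Proof. cont. Qed.

Lemma continuous_eps_R (f : R -> R) (x : R) : 
  (forall eps : posreal, exists d : posreal, forall y, (Rabs (y - x) < d)%R -> (Rabs (f y - f x) <= eps)%R) -> continuous f x.
Proof.
  intros H P [e He]. 
  assert (e2 : (0 < e / 2)%R) by (destruct e; simpl; lra).
  destruct (H (mkposreal _ e2)) as [d Hd]. exists d. intros y Hy. apply He.
  change (Rabs (f y - f x) < e)%R. specialize (Hd y Hy). simpl in Hd. destruct e; simpl in *; lra.
Qed.

(** The integrand is uniformly continuous near the compact segment over which one integrates. *)
Lemma rint_param_cont (F : C -> R) a b : (a <= b)%R -> (forall z, continuous F z) ->
  forall y, continuous (fun y => RInt (fun r => F (r, y)) a b) y.
Proof.
  intros Hab HF y. apply continuous_eps_R. intros eps.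
  assert (He : (0 < eps / (b - a + 1))%R). { apply Rdiv_lt_0_compat; [apply cond_pos|lra]. }
  destruct (uniform_continuity_2d_1d (fun r y => F (r, y)) a b y) with (mkposreal _ He) as [d Hd].
  { intros x _. apply (cont2_pt F (x, y)). apply HF. }
  assert (Hex : forall y, ex_RInt (fun r => F (r, y)) a b) by (intro; apply rcont_ex; intro; now apply ctn_slice).
  exists d. intros y' Hy'.
  rewrite <- (RInt_minus (V:=R_CompleteNormedModule) (fun r => F (r, y')) (fun r => F (r, y))) by auto.
  eapply Rle_trans; [apply (abs_RInt_le_const _ a b (eps / (b - a + 1)))|]; auto.
  - apply (ex_RInt_minus (V:=R_NormedModule)); auto.
  - intros t Ht. left. unfold minus, plus, opp; simpl.
    apply (Hd t y t y'); auto; try (apply Rabs_lt_between' in Hy'; lra).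
    rewrite Rminus_eq_0, Rabs_R0. apply cond_pos.
  - assert (E : (eps / (b - a + 1) * (b - a + 1) = eps)%R) by (field; lra). nra.
Qed.

Lemma cint_param_cont (F : C -> C) a b : (a <= b)%R -> (forall z, continuous F z) ->
  ccont (fun y => cint (fun r => F (r, y)) a b).
Proof.
  intros Hab HF y.
  apply (continuous_ext (fun y => (RInt (fun t => Re (F (t, y))) a b, RInt (fun t => Im (F (t, y))) a b))).
  { intro z. rewrite cint_parts; auto. intro; now apply ctn_slice. }
  apply ctn_pair; simpl.
  - apply (rint_param_cont (fun z => Re (F z))); auto. intro; apply ctn_Re, HF.
  - apply (rint_param_cont (fun z => Im (F z))); auto. intro; apply ctn_Im, HF.
Qed.

Lemma rint_param_deriv (F F' : C -> R) a b y : (a <= b)%R -> (forall z, continuous F z) -> (forall z, continuous F' z) ->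
  (forall z, is_derive (fun s => F (Re z, s)) (Im z) (F' z)) ->
  is_derive (fun y => RInt (fun r => F (r, y)) a b) y (RInt (fun r => F' (r, y)) a b).
Proof.
  intros Hab HF HF' HD.
  assert (E : forall r y, Derive (fun s => F (r, s)) y = F' (r, y)).
  { intros r s. apply is_derive_unique. apply (HD (r, s)). }
  rewrite (RInt_ext (fun r => F' (r, y)) (fun r => Derive (fun s => F (r, s)) y)) by (intros; now rewrite E).
  apply (is_derive_RInt_param (fun y r => F (r, y)) a b y).
  - apply filter_forall. intros s t _. exists (F' (t, s)). apply (HD (t, s)).
  - intros t _. apply (continuity_2d_pt_ext (fun u v => F' (v, u))).
    { intros; now rewrite E. }
    pose proof (cont2_pt F' (t, y) (HF' _)) as K. simpl in K.
    intros eps. destruct (K eps) as [d Hd]. exists d. intros u v Hu Hv. now apply Hd.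
  - apply filter_forall. intro s. apply rcont_ex. intro; now apply ctn_slice.
Qed.

Lemma cint_param_deriv (F F' : C -> C) a b y : (a <= b)%R -> (forall z, continuous F z) -> (forall z, continuous F' z) ->
  (forall z, cderiv (fun s => F (Re z, s)) (Im z) (F' z)) ->
  cderiv (fun y => cint (fun r => F (r, y)) a b) y (cint (fun r => F' (r, y)) a b).
Proof.
  intros Hab HF HF' HD.
  apply (cderiv_ext (fun y => (RInt (fun t => Re (F (t, y))) a b, RInt (fun t => Im (F (t, y))) a b))).
  { intro z. rewrite cint_parts; auto. intro; now apply ctn_slice. }
  rewrite cint_parts by cont.
  apply cderiv_iff; simpl. split.
  - apply (rint_param_deriv (fun z => Re (F z)) (fun z => Re (F' z))); auto.
    + intro; apply ctn_Re, HF. + intro; apply ctn_Re, HF'.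
    + intro z. exact (proj1 (proj1 (cderiv_iff _ _ _) (HD z))).
  - apply (rint_param_deriv (fun z => Im (F z)) (fun z => Im (F' z))); auto.
    + intro; apply ctn_Im, HF. + intro; apply ctn_Im, HF'.
    + intro z. exact (proj2 (proj1 (cderiv_iff _ _ _) (HD z))).
Qed.

(** * Finite sums and two-sided series *)

Lemma Csum_ext n f g : (forall i, (i < n)%nat -> f i = g i) -> Csum n f = Csum n g.
Proof. induction n; intro H; simpl; auto. rewrite IHn, H; auto. Qed.
Lemma Csum_plus n f g : Csum n (fun i => f i + g i) = Csum n f + Csum n g.
Proof. induction n; simpl; [ring|rewrite IHn; ring]. Qed.
Lemma Csum_scal n c f : Csum n (fun i => c * f i) = c * Csum n f.
Proof. induction n; simpl; [ring|rewrite IHn; ring]. Qed.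
Lemma Csum_0 n (f : nat -> C) : (forall i, (i < n)%nat -> f i = 0) -> Csum n f = 0.
Proof. induction n; intro H; simpl; auto. rewrite IHn, H; auto. ring. Qed.
Lemma Csum_single n (f : nat -> C) j : (j < n)%nat -> (forall i, (i < n)%nat -> i <> j -> f i = 0) -> Csum n f = f j.
Proof.
  induction n; intros Hj H; [lia|]. simpl. destruct (Nat.eq_dec j n) as [->|Hn].
  - rewrite Csum_0. ring. intros i Hi. apply H; lia.
  - rewrite IHn by (try lia; intros; apply H; lia). rewrite (H n); [ring|lia|lia].
Qed.
Lemma Csum_swap n m f : Csum n (fun i => Csum m (fun j => f i j)) = Csum m (fun j => Csum n (fun i => f i j)).
Proof.
  induction n; simpl. - symmetry. now apply Csum_0.
  - rewrite IHn, <- Csum_plus. reflexivity.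
Qed.
Lemma Csum_S n f : Csum (S n) f = f O + Csum n (fun i => f (S i)).
Proof.
  induction n. simpl; ring.
  change (Csum (S (S n)) f) with (Csum (S n) f + f (S n)). rewrite IHn. simpl. ring.
Qed.
Lemma Csum_conj n f : Cconj (Csum n f) = Csum n (fun i => Cconj (f i)).
Proof. induction n; simpl. apply C_ext; simpl; ring. now rewrite Cplus_conj, IHn. Qed.

(** Every series below is dominated by a geometric one. This one majorant is stable, up to the
    constant, under sums, scalar multiples and shifts. *)
Definition zdom (M : R) (f : Z -> C) : Prop := forall n, (Cmod (f n) <= M * (/ 2) ^ Z.abs_nat n)%R.
(** The indices from [- N] to [N - 1], matching the two halves of [ZSeries]. *)
Definition zpart (N : nat) (f : Z -> C) : C :=
  Csum N (fun n => f (Z.of_nat n)) + Csum N (fun n => f (- Z.of_nat (S n))%Z).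

Lemma half_pow_pos n : (0 < (/ 2) ^ n)%R.
Proof. apply pow_lt. lra. Qed.

Lemma half_series : Series (fun n => ((/ 2) ^ n)%R) = 2%R.
Proof. rewrite Series_geom. field. rewrite Rabs_right; lra. Qed.
Lemma half_ex M : ex_series (fun n => (M * (/ 2) ^ n)%R).
Proof. apply (ex_series_scal (K:=R_AbsRing) (V:=R_NormedModule) M (fun n => ((/2)^n)%R)). apply ex_series_geom. rewrite Rabs_right; lra. Qed.

Lemma ser_bound (a : nat -> R) M : (forall n, (Rabs (a n) <= M * (/ 2) ^ n)%R) ->
  ex_series a /\ (Rabs (Series a) <= 2 * M)%R.
Proof.
  intro H.
  assert (E : ex_series (fun n => Rabs (a n))).
  { apply (ex_series_le (K:=R_AbsRing) (V:=R_CompleteNormedModule) _ (fun n => (M * (/ 2) ^ n)%R)); [|apply half_ex].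
    intro n. unfold norm; simpl; unfold abs; simpl. now rewrite Rabs_Rabsolu. }
  split; [now apply ex_series_Rabs|].
  eapply Rle_trans; [apply Series_Rabs; auto|].
  eapply Rle_trans; [apply Series_le; [|apply (half_ex M)]|].
  - intro n. split; [apply Rabs_pos|apply H].
  - rewrite Series_scal_l. assert (E2 : Series (pow (/ 2)) = 2%R) by apply half_series. rewrite E2. lra.
Qed.

Lemma cs_bound (f : nat -> C) M : (forall n, (Cmod (f n) <= M * (/ 2) ^ n)%R) -> (Cmod (CSeries f) <= 4 * M)%R.
Proof.
  intro H. eapply Rle_trans; [apply Cmod_le_sum|]. simpl.
  destruct (ser_bound (fun n => Re (f n)) M) as [_ H1].
  { intro n. eapply Rle_trans; [apply re_le_Cmod|apply H]. }
  destruct (ser_bound (fun n => Im (f n)) M) as [_ H2].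
  { intro n. eapply Rle_trans; [apply im_le_Cmod|apply H]. }
  lra.
Qed.
Lemma cs_incr (f : nat -> C) M : (forall n, (Cmod (f n) <= M * (/ 2) ^ n)%R) ->
  CSeries f = f O + CSeries (fun n => f (S n)).
Proof.
  intro H.
  destruct (ser_bound (fun n => Re (f n)) M) as [H1 _].
  { intro n. eapply Rle_trans; [apply re_le_Cmod|apply H]. }
  destruct (ser_bound (fun n => Im (f n)) M) as [H2 _].
  { intro n. eapply Rle_trans; [apply im_le_Cmod|apply H]. }
  apply C_ext; simpl; [rewrite (Series_incr_1 _ H1)|rewrite (Series_incr_1 _ H2)]; reflexivity.
Qed.
Lemma cs_tail N : forall (f : nat -> C) M, (forall n, (Cmod (f n) <= M * (/ 2) ^ n)%R) ->
  (Cmod (CSeries f - Csum N f) <= 4 * M * (/ 2) ^ N)%R.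
Proof.
  induction N; intros f M H.
  - simpl. replace (CSeries f - 0) with (CSeries f) by ring. rewrite Rmult_1_r. now apply cs_bound.
  - rewrite Csum_S, (cs_incr f M H).
    replace (f O + CSeries (fun n => f (S n)) - (f O + Csum N (fun i => f (S i)))) with
      (CSeries (fun n => f (S n)) - Csum N (fun i => f (S i))) by ring.
    eapply Rle_trans; [apply (IHN _ (M / 2)%R)|simpl; right; field].
    intro n. eapply Rle_trans; [apply H|simpl; right; field].
Qed.

Lemma zdom_pos M f : zdom M f -> (0 <= M)%R.
Proof. intro H. pose proof (H 0%Z). simpl in H0. pose proof (Cmod_ge_0 (f 0%Z)). lra. Qed.

Lemma zs_tail f M N : zdom M f -> (Cmod (ZSeries f - zpart N f) <= 8 * M * (/ 2) ^ N)%R.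
Proof.
  intro H. unfold ZSeries, zpart.
  match goal with |- (Cmod (?a + ?b - (?c + ?d)) <= _)%R => replace (a + b - (c + d)) with ((a - c) + (b - d)) by ring end.
  eapply Rle_trans; [apply Cmod_triangle|].
  assert (H1 := cs_tail N (fun n => f (Z.of_nat n)) M).
  assert (H2 := cs_tail N (fun n => f (- Z.of_nat (S n))%Z) M).
  pose proof (zdom_pos _ _ H). pose proof (half_pow_pos N).
  assert ((8 * M * (/ 2) ^ N = 4 * M * (/ 2) ^ N + 4 * M * (/ 2) ^ N))%R by ring. rewrite H4.
  apply Rplus_le_compat; [apply H1|apply H2]; intro n.
  - eapply Rle_trans; [apply H|]. right. now rewrite Zabs2Nat.id.
  - eapply Rle_trans; [apply H|]. replace (Z.abs_nat (- Z.of_nat (S n))) with (S n) by lia. simpl.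
    pose proof (half_pow_pos n). nra.
Qed.
Lemma half_small (x K : R) N0 : (forall N, (N0 <= N)%nat -> (x <= K * (/ 2) ^ N)%R) -> (x <= 0)%R.
Proof.
  intro H. destruct (Rle_lt_dec x 0) as [|Hx]; auto. exfalso.
  assert (HK : (0 < K)%R). { pose proof (H N0 (Nat.le_refl _)). pose proof (half_pow_pos N0). nra. }
  destruct (pow_lt_1_zero (/ 2) ltac:(rewrite Rabs_right; lra) (x / K)) as [N HN].
  { apply Rdiv_lt_0_compat; auto. }
  specialize (H (max N N0) ltac:(lia)). specialize (HN (max N N0) ltac:(lia)).
  rewrite Rabs_right in HN by (left; apply half_pow_pos).
  apply (Rmult_lt_compat_l K) in HN; auto. replace (K * (x / K))%R with x in HN by (field; lra). lra.
Qed.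
(** A geometric rate of convergence of the partial sums identifies the sum; the algebraic rules for
    series all follow from this. *)
Lemma zs_unique f M L K N0 : zdom M f ->
  (forall N, (N0 <= N)%nat -> (Cmod (L - zpart N f) <= K * (/ 2) ^ N)%R) -> ZSeries f = L.
Proof.
  intros Hf HL.
  assert (Cmod (ZSeries f - L) <= 0)%R.
  { apply (half_small _ (8 * M + K) N0). intros N HN.
    replace (ZSeries f - L) with ((ZSeries f - zpart N f) + - (L - zpart N f)) by ring.
    eapply Rle_trans; [apply Cmod_triangle|]. rewrite Cmod_opp.
    pose proof (zs_tail f M N Hf). pose proof (HL N HN). lra. }
  assert (E : ZSeries f - L = 0) by (apply Cmod_eq_0; pose proof (Cmod_ge_0 (ZSeries f - L)); lra).
  replace (ZSeries f) with (ZSeries f - L + L) by ring. rewrite E. ring.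
Qed.
Lemma zdom_le M M' f : (M <= M')%R -> zdom M f -> zdom M' f.
Proof. intros H Hf n. eapply Rle_trans; [apply Hf|]. pose proof (half_pow_pos (Z.abs_nat n)). nra. Qed.
Lemma zdom_plus M M' f g : zdom M f -> zdom M' g -> zdom (M + M') (fun n => f n + g n).
Proof. intros Hf Hg n. eapply Rle_trans; [apply Cmod_triangle|]. pose proof (Hf n). pose proof (Hg n). lra. Qed.
Lemma zdom_scal M c f : zdom M f -> zdom (Cmod c * M) (fun n => c * f n).
Proof. intros Hf n. rewrite Cmod_mult. pose proof (Hf n). pose proof (Cmod_ge_0 c). nra. Qed.
Lemma zpart_plus N f g : zpart N (fun n => f n + g n) = zpart N f + zpart N g.
Proof. unfold zpart. rewrite !Csum_plus. ring. Qed.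
Lemma zpart_scal N c f : zpart N (fun n => c * f n) = c * zpart N f.
Proof. unfold zpart. rewrite !Csum_scal. ring. Qed.
Lemma zs_plus M M' f g : zdom M f -> zdom M' g -> ZSeries (fun n => f n + g n) = ZSeries f + ZSeries g.
Proof.
  intros Hf Hg. apply (zs_unique _ (M + M') _ (8 * M + 8 * M') 0); [now apply zdom_plus|].
  intros N _. rewrite zpart_plus.
  replace (ZSeries f + ZSeries g - (zpart N f + zpart N g)) with ((ZSeries f - zpart N f) + (ZSeries g - zpart N g)) by ring.
  eapply Rle_trans; [apply Cmod_triangle|]. pose proof (zs_tail f M N Hf). pose proof (zs_tail g M' N Hg). lra.
Qed.
Lemma zs_scal M c f : zdom M f -> ZSeries (fun n => c * f n) = c * ZSeries f.
Proof.
  intros Hf. apply (zs_unique _ (Cmod c * M) _ (Cmod c * (8 * M)) 0); [now apply zdom_scal|].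
  intros N _. rewrite zpart_scal.
  replace (c * ZSeries f - c * zpart N f) with (c * (ZSeries f - zpart N f)) by ring.
  rewrite Cmod_mult. pose proof (zs_tail f M N Hf). pose proof (Cmod_ge_0 c). nra.
Qed.
Lemma zs_ext f g : (forall n, f n = g n) -> ZSeries f = ZSeries g.
Proof. intro H. f_equal. now apply functional_extensionality. Qed.
Lemma zs_0 : ZSeries (fun _ => 0) = 0.
Proof.
  apply (zs_unique _ 0 _ 0 0).
  - intro n. rewrite Cmod_0. lra.
  - intros N _. unfold zpart. rewrite !Csum_0 by auto. replace (0 - (0 + 0)) with (RtoC 0) by ring. rewrite Cmod_0. lra.
Qed.
Lemma zs_csum n f : (forall i, (i < n)%nat -> exists M, zdom M (f i)) ->
  (exists M, zdom M (fun m => Csum n (fun i => f i m))) /\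
  ZSeries (fun m => Csum n (fun i => f i m)) = Csum n (fun i => ZSeries (f i)).
Proof.
  induction n; intro H.
  - simpl. split; [|apply zs_0]. exists 0%R. intro m. rewrite Cmod_0. lra.
  - destruct IHn as [[M HM] E]. { intros i Hi. apply H. lia. }
    destruct (H n ltac:(lia)) as [M' HM']. simpl. split.
    + exists (M + M')%R. now apply zdom_plus.
    + rewrite <- E. apply (zs_plus M M' _ _ HM HM').
Qed.
Lemma abs_nat_half n m : (Z.abs_nat n <= S (Z.abs_nat m))%nat -> ((/2) ^ Z.abs_nat m <= 2 * (/2) ^ Z.abs_nat n)%R.
Proof.
  intro H. 
  assert (E : forall a b, (a <= b)%nat -> ((/2)^b <= (/2)^a)%R).
  { intros a b Hab. replace b with (a + (b - a))%nat by lia. rewrite pow_add.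
    pose proof (half_pow_pos a). assert ((/2)^(b-a) <= 1)%R.
    { rewrite <- (pow1 (b-a)). apply pow_incr. lra. }
    nra. }
  pose proof (E _ _ H) as E1. simpl in E1. lra.
Qed.
Lemma zpart_S N f : zpart (S N) f = zpart N f + (f (Z.of_nat N) + f (- Z.of_nat (S N))%Z).
Proof. unfold zpart. change (Csum (S N)) with (fun g => Csum N g + g N). cbv beta. ring. Qed.
(** The shift changes a partial sum by two boundary terms, which tend to 0. *)
Lemma zs_shift M f : zdom M f -> ZSeries (fun n => f (n + 1)%Z) = ZSeries f.
Proof.
  intros Hf.
  assert (Hs : zdom (2 * M) (fun n => f (n + 1)%Z)).
  { intro n. eapply Rle_trans; [apply Hf|]. pose proof (abs_nat_half n (n + 1) ltac:(lia)).
    pose proof (zdom_pos _ _ Hf). nra. }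
  apply (zs_unique _ (2 * M) _ (10 * M) 0 Hs). intros N _.
  assert (E : forall N, zpart N (fun n => f (n + 1)%Z) = zpart N f + (f (Z.of_nat N) - f (- Z.of_nat N)%Z)).
  { induction N0.
    - unfold zpart; simpl. ring.
    - rewrite !zpart_S, IHN0.
      replace (Z.of_nat N0 + 1)%Z with (Z.of_nat (S N0)) by lia.
      replace (- Z.of_nat (S N0) + 1)%Z with (- Z.of_nat N0)%Z by lia. ring. }
  rewrite E.
  replace (ZSeries f - (zpart N f + (f (Z.of_nat N) - f (- Z.of_nat N)%Z))) with
    ((ZSeries f - zpart N f) + (f (- Z.of_nat N)%Z + - f (Z.of_nat N))) by ring.
  eapply Rle_trans; [apply Cmod_triangle|].
  pose proof (zs_tail f M N Hf). pose proof (Hf (Z.of_nat N)) as H1. pose proof (Hf (- Z.of_nat N)%Z) as H2.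
  pose proof (Cmod_triangle (f (- Z.of_nat N)%Z) (- f (Z.of_nat N))) as H3. rewrite Cmod_opp in H3.
  replace (Z.abs_nat (- Z.of_nat N)) with N in H2 by lia. rewrite Zabs2Nat.id in H1. lra.
Qed.
Lemma zpart_single N (f : Z -> C) n0 : (forall n, n <> n0 -> f n = 0) -> (Z.abs_nat n0 < N)%nat -> zpart N f = f n0.
Proof.
  intros H HN. unfold zpart. destruct (Z_le_gt_dec 0 n0) as [Hp|Hp].
  - rewrite (Csum_single N _ (Z.to_nat n0)) by (try lia; intros; apply H; lia).
    rewrite (Csum_0 N) by (intros; apply H; lia). rewrite Z2Nat.id by auto. ring.
  - rewrite (Csum_0 N) by (intros; apply H; lia).
    rewrite (Csum_single N _ (Z.to_nat (- n0 - 1))) by (try lia; intros; apply H; lia).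
    replace (- Z.of_nat (S (Z.to_nat (- n0 - 1))))%Z with n0 by lia. ring.
Qed.
Lemma zs_single (f : Z -> C) n0 : (forall n, n <> n0 -> f n = 0) -> ZSeries f = f n0.
Proof.
  intro H.
  apply (zs_unique f (Cmod (f n0) * 2 ^ Z.abs_nat n0)%R _ 0 (S (Z.abs_nat n0))).
  - intro n. destruct (Z.eq_dec n n0) as [->|Hn].
    + right. rewrite Rmult_assoc, <- Rpow_mult_distr. replace (2 * / 2)%R with 1%R by field. rewrite pow1. ring.
    + rewrite H by auto. rewrite Cmod_0. pose proof (half_pow_pos (Z.abs_nat n)). pose proof (Cmod_ge_0 (f n0)).
      pose proof (pow_le 2 (Z.abs_nat n0) ltac:(lra)). apply Rmult_le_pos; [apply Rmult_le_pos|]; lra.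
  - intros N HN. rewrite (zpart_single N f n0) by (auto; lia). replace (f n0 - f n0) with (RtoC 0) by ring. rewrite Cmod_0. lra.
Qed.
Lemma zs_conj M f : zdom M f -> Cconj (ZSeries f) = ZSeries (fun n => Cconj (f n)).
Proof.
  intro Hf. symmetry. apply (zs_unique _ M _ (8 * M) 0).
  - intro n. rewrite Cmod_conj. apply Hf.
  - intros N _. pose proof (zs_tail f M N Hf) as H. unfold zpart in *. rewrite <- !Csum_conj, <- Cplus_conj, <- Cminus_conj, Cmod_conj. exact H.
Qed.
Lemma zpart_Re_incr f N : (forall n, (0 <= Re (f n))%R) -> (Re (f 0%Z) <= Re (zpart (S N) f))%R.
Proof.
  intro H. induction N.
  - unfold zpart; simpl Csum. rewrite !re_plus. pose proof (H 0%Z). pose proof (H (-1)%Z). simpl in *. lra.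
  - eapply Rle_trans; [apply IHN|]. unfold zpart. 
    change (Csum (S (S N))) with (fun f => Csum (S N) f + f (S N)). cbv beta. rewrite !re_plus.
    pose proof (H (Z.of_nat (S N))). pose proof (H (- Z.of_nat (S (S N)))%Z). lra.
Qed.
(** Gives the nonvanishing of the norms of theta functions. *)
Lemma zs_Re_pos M f : zdom M f -> (forall n, (0 <= Re (f n))%R) -> (Re (f 0%Z) <= Re (ZSeries f))%R.
Proof.
  intros Hf H. apply Rminus_le. apply (half_small _ (8 * M) 1). intros [|N] HN; [lia|].
  pose proof (zs_tail f M (S N) Hf) as E. pose proof (re_le_Cmod (ZSeries f - zpart (S N) f)) as E2.
  pose proof (zpart_Re_incr f N H).
  unfold Cminus in E2. rewrite re_plus, re_opp in E2. apply Rabs_le_between in E2.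
  unfold Cminus in E. lra.
Qed.

(** * Continuity, integration and differentiation term by term *)
Lemma ctn_zpart {U : UniformSpace} (f : Z -> U -> C) N (x : U) : (forall i, continuous (f i) x) -> continuous (fun u => zpart N (fun i => f i u)) x.
Proof. intro H. apply ctn_plus; apply (ctn_csum (fun n => f _)); intros; apply H. Qed.

Lemma C_ball_Cmod (z w : C) (e : R) : (Cmod (w - z) < e)%R -> ball (M := C_UniformSpace) z e w.
Proof.
  intro H. split.
  - change (Rabs (fst w - fst z) < e)%R. eapply Rle_lt_trans; [|apply H]. apply (re_le_Cmod (w - z)).
  - change (Rabs (snd w - snd z) < e)%R. eapply Rle_lt_trans; [|apply H]. apply (im_le_Cmod (w - z)).
Qed.
Lemma Cmod_ball_C (z w : C) (e : R) : ball (M := C_UniformSpace) z e w -> (Cmod (w - z) < 2 * e)%R.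
Proof.
  intros [H1 H2]. change (Rabs (fst w - fst z) < e)%R in H1. change (Rabs (snd w - snd z) < e)%R in H2.
  eapply Rle_lt_trans; [apply Cmod_le_sum|]. simpl. unfold Rminus in *. lra.
Qed.
Lemma ctn_eps {U : UniformSpace} (f : U -> C) (x : U) :
  (forall e : R, (0 < e)%R -> locally x (fun u => (Cmod (f u - f x) < e)%R)) -> continuous f x.
Proof.
  intro H. apply filterlim_locally. intros [e He]. eapply filter_imp; [|apply (H e He)].
  intros u Hu. now apply C_ball_Cmod.
Qed.
Lemma ctn_eps_inv {U : UniformSpace} (f : U -> C) (x : U) : continuous f x ->
  (forall e : R, (0 < e)%R -> locally x (fun u => (Cmod (f u - f x) < e)%R)).
Proof.
  intros H e He. assert (He2 : (0 < e / 2)%R) by lra.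
  pose proof (proj1 (filterlim_locally f (f x)) H (mkposreal _ He2)) as K.
  eapply filter_imp; [|apply K]. intros u Hu. apply Cmod_ball_C in Hu. simpl in Hu. lra.
Qed.

(** The tails are uniformly small near [x] by domination, and the partial sums are continuous. *)
Lemma zs_cont {U : UniformSpace} (f : Z -> U -> C) (x : U) M :
  locally x (fun u => zdom M (fun n => f n u)) -> (forall n, continuous (f n) x) ->
  continuous (fun u => ZSeries (fun n => f n u)) x.
Proof.
  intros HM Hf. apply ctn_eps. intros e He.
  assert (Hx : zdom M (fun n => f n x)) by (apply (locally_singleton _ _ HM)).
  pose proof (zdom_pos _ _ Hx) as HMp.
  destruct (pow_lt_1_zero (/ 2) ltac:(rewrite Rabs_right; lra) (e / (32 * M + 1))) as [N HN].
  { apply Rdiv_lt_0_compat; lra. }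
  specialize (HN N (Nat.le_refl _)). rewrite Rabs_right in HN by (left; apply half_pow_pos).
  assert (HN2 : (16 * M * (/ 2) ^ N < e / 2)%R).
  { apply (Rmult_lt_compat_l (32 * M + 1)) in HN; [|lra].
    replace ((32 * M + 1) * (e / (32 * M + 1)))%R with e in HN by (field; lra). pose proof (half_pow_pos N). nra. }
  pose proof (ctn_eps_inv _ _ (ctn_zpart f N x Hf) (e / 2)%R ltac:(lra)) as HP.
  eapply filter_imp; [|apply (filter_and _ _ HM HP)].
  intros u [Hu1 Hu2]. cbv beta in *.
  replace (ZSeries (fun n => f n u) - ZSeries (fun n => f n x)) with
   ((ZSeries (fun n => f n u) - zpart N (fun n => f n u)) + (zpart N (fun n => f n u) - zpart N (fun n => f n x))
     + - (ZSeries (fun n => f n x) - zpart N (fun n => f n x))) by ring.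
  eapply Rle_lt_trans; [apply Cmod_triangle|]. rewrite Cmod_opp.
  pose proof (zs_tail _ M N Hu1). pose proof (zs_tail _ M N Hx).
  match goal with |- (Cmod (?a + ?b) + _ < _)%R => pose proof (Cmod_triangle a b) end. lra.
Qed.

Lemma ccont_csum (f : nat -> R -> C) n : (forall i, ccont (f i)) -> ccont (fun t => Csum n (fun i => f i t)).
Proof. intros H t. apply (ctn_csum f). intro; apply H. Qed.
Lemma cint_csum (f : nat -> R -> C) n a b : (forall i, ccont (f i)) ->
  cint (fun t => Csum n (fun i => f i t)) a b = Csum n (fun i => cint (f i) a b).
Proof.
  intro H. induction n; simpl. rewrite cint_const. ring.
  rewrite cint_plus; auto. now rewrite IHn. now apply ccont_csum.
Qed.
Lemma zs_int (f : Z -> R -> C) a b M : (forall n, ccont (f n)) -> ccont (fun t => ZSeries (fun n => f n t)) ->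
  (forall t, (Rmin a b <= t <= Rmax a b)%R -> zdom M (fun n => f n t)) ->
  zdom (Rabs (b - a) * M) (fun n => cint (f n) a b) /\
  cint (fun t => ZSeries (fun n => f n t)) a b = ZSeries (fun n => cint (f n) a b).
Proof.
  intros Hf HF HM.
  assert (D : zdom (Rabs (b - a) * M) (fun n => cint (f n) a b)).
  { intro n. rewrite Rmult_assoc. apply cint_bound_abs; auto. intros t Ht. now apply HM. }
  split; auto. symmetry.
  apply (zs_unique _ _ _ (Rabs (b - a) * (8 * M)) 0 D). intros N _.
  assert (E : zpart N (fun n => cint (f n) a b) = cint (fun t => zpart N (fun n => f n t)) a b).
  { unfold zpart. rewrite cint_plus, !cint_csum; auto; apply ccont_csum; auto. }
  rewrite E, <- cint_minus; auto. 2:{ intro t. apply ctn_zpart. intro; apply Hf. }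
  rewrite Rmult_assoc. apply cint_bound_abs.
  - apply ccont_minus; auto. intro t. apply ctn_zpart. intro; apply Hf.
  - intros t Ht. now apply zs_tail, HM.
Qed.
(** The series of derivatives is integrated term by term; by the fundamental theorem of calculus
    its integral is the original series, up to a constant. *)
Lemma zs_deriv (f f' : Z -> R -> C) (t0 : R) : (forall n t, cderiv (f n) t (f' n t)) -> (forall n, ccont (f' n)) ->
  (forall r, exists M, forall t, (Rabs (t - t0) <= r)%R -> zdom M (fun n => f n t) /\ zdom M (fun n => f' n t)) ->
  cderiv (fun t => ZSeries (fun n => f n t)) t0 (ZSeries (fun n => f' n t0)).
Proof.
  intros Hd Hc HM.
  assert (HF : ccont (fun t => ZSeries (fun n => f' n t))).
  { intro t. destruct (HM (Rabs (t - t0) + 1)%R) as [M HM'].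
    apply (zs_cont f' t M); [|intro; apply Hc]. exists (mkposreal 1 Rlt_0_1). intros u Hu.
    apply HM'. change (Rabs (u - t) < 1)%R in Hu.
    replace (u - t0)%R with ((t - t0) + (u - t))%R by ring. eapply Rle_trans; [apply Rabs_triang|]. lra. }
  apply (cderiv_ext (fun t => ZSeries (fun n => f n t0) + cint (fun t => ZSeries (fun n => f' n t)) t0 t)).
  - intro t. destruct (HM (Rabs (t - t0))) as [M HM'].
    assert (Hb : forall s, (Rmin t0 t <= s <= Rmax t0 t)%R -> (Rabs (s - t0) <= Rabs (t - t0))%R).
    { intros s Hs. unfold Rmin, Rmax in Hs. destruct (Rle_dec t0 t).
      - rewrite !Rabs_right; lra. - rewrite !Rabs_left1; lra. }
    destruct (zs_int f' t0 t M) as [D E]; auto.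
    { intros s Hs. apply HM'. auto. }
    rewrite E.
    assert (Hz : zdom M (fun n => f n t0)). { apply HM'. rewrite Rminus_eq_0, Rabs_R0. apply Rabs_pos. }
    rewrite <- (zs_plus _ _ _ _ Hz D). apply zs_ext. intro n.
    rewrite (cint_FTC (f n)); auto. ring.
  - eapply cderiv_eq. apply cderiv_plus. apply cderiv_const. apply (cint_deriv _ t0 t0 HF). cbv beta. ring.
Qed.

(** Completing the square: the Gaussian in [n] absorbs any linear exponent together with the factor
    [2 ^ n]. *)
Lemma gauss_dom (A B c : R) : (0 < c)%R -> exists M, (0 < M)%R /\ forall (n : Z) v,
  (v <= A + B * Rabs (IZR n) - c * IZR n ^ 2)%R -> (exp v <= M * (/ 2) ^ Z.abs_nat n)%R.
Proof.
  intro Hc. set (b := (B + ln 2)%R). exists (exp (A + b ^ 2 / (4 * c))). split; [apply exp_pos|].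
  intros n v Hv.
  assert (E : ((/ 2) ^ Z.abs_nat n = exp (- ln 2 * Rabs (IZR n)))%R).
  { rewrite <- abs_IZR, <- Zabs2Nat.id_abs, <- INR_IZR_INZ.
    rewrite <- (exp_ln ((/2) ^ Z.abs_nat n)) by apply half_pow_pos. f_equal.
    rewrite ln_pow by lra. rewrite ln_Rinv by lra. ring. }
  rewrite E, <- exp_plus. destruct (Req_dec v (A + b ^ 2 / (4 * c) + - ln 2 * Rabs (IZR n))) as [->|Hn]; [lra|].
  left. apply exp_increasing.
  assert (Hsq : (IZR n ^ 2 = Rabs (IZR n) ^ 2)%R) by (rewrite RPow_abs, Rabs_pos_eq; auto; apply pow2_ge_0).
  rewrite Hsq in Hv. set (x := Rabs (IZR n)) in *.
  assert (0 <= c * (x - b / (2 * c)) ^ 2)%R. { apply Rmult_le_pos; [lra|apply pow2_ge_0]. }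
  assert (c * (x - b / (2 * c)) ^ 2 = c * x ^ 2 - b * x + b ^ 2 / (4 * c))%R by (field; lra).
  unfold b in *. lra.
Qed.

(** * Smooth functions on the plane and dbar *)

Lemma pair_eta (z : C) : (Re z, Im z) = z.
Proof. destruct z; reflexivity. Qed.

Lemma partials_intro f z a b : cderiv (fun s => f (s, Im z)) (Re z) a -> cderiv (fun s => f (Re z, s)) (Im z) b ->
  ex_partials f z /\ dRe f z = a /\ dIm f z = b.
Proof.
  intros H1 H2. split; [split; [exists a|exists b]; assumption|].
  split; now apply cderiv_CDerive.
Qed.
Lemma partials_dRe f z : ex_partials f z -> cderiv (fun s => f (s, Im z)) (Re z) (dRe f z).
Proof. intros [H _]. now apply CDerive_correct. Qed.
Lemma partials_dIm f z : ex_partials f z -> cderiv (fun s => f (Re z, s)) (Im z) (dIm f z).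
Proof. intros [_ H]. now apply CDerive_correct. Qed.

Lemma Cn_cont p f : Cn p f -> forall z, continuous f z.
Proof. destruct p; simpl; tauto. Qed.
(** The form in which smoothness is proved: each class of explicit series below contains, up to
    simpler terms, the partial derivatives of its members, and one concludes by induction on [p]. *)
Lemma Cn_intro p f fR fI : (forall z, continuous f z) ->
  (forall z, cderiv (fun s => f (s, Im z)) (Re z) (fR z)) -> (forall z, cderiv (fun s => f (Re z, s)) (Im z) (fI z)) ->
  Cn p fR -> Cn p fI -> Cn (S p) f.
Proof.
  intros Hc H1 H2 HR HI.
  assert (E1 : dRe f = fR) by (apply functional_extensionality; intro z; apply (partials_intro f z _ _ (H1 z) (H2 z))).
  assert (E2 : dIm f = fI) by (apply functional_extensionality; intro z; apply (partials_intro f z _ _ (H1 z) (H2 z))).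
  simpl. rewrite E1, E2. repeat split; auto; [exists (fR z)|exists (fI z)]; [apply H1|apply H2].
Qed.
Lemma Cn_weaken p : forall f, Cn (S p) f -> Cn p f.
Proof.
  induction p; intros f H; [exact (Cn_cont _ _ H)|].
  destruct H as (H1 & H2 & H3 & H4). repeat split; auto; apply H2.
Qed.
Lemma Cn_dR p f : Cn (S p) f -> forall z, cderiv (fun s => f (s, Im z)) (Re z) (dRe f z).
Proof. intros (_ & H & _) z. apply partials_dRe, H. Qed.
Lemma Cn_dI p f : Cn (S p) f -> forall z, cderiv (fun s => f (Re z, s)) (Im z) (dIm f z).
Proof. intros (_ & H & _) z. apply partials_dIm, H. Qed.

Lemma Cn_const p : forall c, Cn p (fun _ => c).
Proof.
  induction p; intro c; [intro; apply continuous_const|].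
  apply (Cn_intro p _ (fun _ => 0) (fun _ => 0)); auto; intro; try apply cderiv_const. apply continuous_const.
Qed.
Lemma Cn_plus p : forall f g, Cn p f -> Cn p g -> Cn p (fun z => f z + g z).
Proof.
  induction p; intros f g Hf Hg; [intro z; apply ctn_plus; auto|].
  apply (Cn_intro p _ (fun z => dRe f z + dRe g z) (fun z => dIm f z + dIm g z)).
  - intro z. apply ctn_plus; eapply Cn_cont; eauto.
  - intro z. apply cderiv_plus; eapply Cn_dR; eauto.
  - intro z. apply cderiv_plus; eapply Cn_dI; eauto.
  - apply IHp; [apply Hf|apply Hg].
  - apply IHp; [apply Hf|apply Hg].
Qed.
Lemma cderiv_mult_R f g z a b : cderiv (fun s => f (s, Im z)) (Re z) a -> cderiv (fun s => g (s, Im z)) (Re z) b ->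
  cderiv (fun s => f (s, Im z) * g (s, Im z)) (Re z) (a * g z + f z * b).
Proof. intros H1 H2. pose proof (cderiv_mult _ _ _ _ _ H1 H2) as H. cbv beta in H. now rewrite !pair_eta in H. Qed.
Lemma cderiv_mult_I f g z a b : cderiv (fun s => f (Re z, s)) (Im z) a -> cderiv (fun s => g (Re z, s)) (Im z) b ->
  cderiv (fun s => f (Re z, s) * g (Re z, s)) (Im z) (a * g z + f z * b).
Proof. intros H1 H2. pose proof (cderiv_mult _ _ _ _ _ H1 H2) as H. cbv beta in H. now rewrite !pair_eta in H. Qed.
Lemma Cn_mult p : forall f g, Cn p f -> Cn p g -> Cn p (fun z => f z * g z).
Proof.
  induction p; intros f g Hf Hg; [intro z; apply ctn_mult; auto|].
  apply (Cn_intro p _ (fun z => dRe f z * g z + f z * dRe g z) (fun z => dIm f z * g z + f z * dIm g z)).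
  - intro z. apply ctn_mult; eapply Cn_cont; eauto.
  - intro z. apply cderiv_mult_R; eapply Cn_dR; eauto.
  - intro z. apply cderiv_mult_I; eapply Cn_dI; eauto.
  - apply Cn_plus; apply IHp; try (now apply Cn_weaken); [apply Hf|apply Hg].
  - apply Cn_plus; apply IHp; try (now apply Cn_weaken); [apply Hf|apply Hg].
Qed.
Lemma Cn_scal p c f : Cn p f -> Cn p (fun z => c * f z).
Proof. intro H. apply (Cn_mult p (fun _ => c) f); auto. apply Cn_const. Qed.
Lemma Cn_conj p : forall f, Cn p f -> Cn p (fun z => Cconj (f z)).
Proof.
  induction p; intros f Hf; [intro z; apply ctn_conj; auto|].
  apply (Cn_intro p _ (fun z => Cconj (dRe f z)) (fun z => Cconj (dIm f z))).
  - intro z. apply ctn_conj; eapply Cn_cont; eauto.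
  - intro z. apply (cderiv_conj (fun s => f (s, Im z))); eapply Cn_dR; eauto.
  - intro z. apply (cderiv_conj (fun s => f (Re z, s))); eapply Cn_dI; eauto.
  - apply IHp; apply Hf.
  - apply IHp; apply Hf.
Qed.
Lemma Cn_csum p n (f : nat -> C -> C) : (forall i, Cn p (f i)) -> Cn p (fun z => Csum n (fun i => f i z)).
Proof. intro H. induction n; simpl; [apply Cn_const|now apply Cn_plus]. Qed.
Lemma Cn_Im p : Cn p (fun z => RtoC (Im z)).
Proof.
  destruct p.
  - intro z. apply ctn_RtoC. destruct z as [a b]. apply continuous_snd.
  - apply (Cn_intro p _ (fun _ => 0) (fun _ => 1)); try apply Cn_const.
    + intro z. apply ctn_RtoC. destruct z as [a b]. apply continuous_snd.
    + intro z. exact (cderiv_const (RtoC (Im z)) (Re z)).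
    + intro z. simpl. apply (cderiv_RtoC (fun s => s) (Im z) 1%R). apply (is_derive_id (K:=R_AbsRing)).
Qed.
(** The Gaussian factor that exchanges sections of L(-k,0) with conjugates of sections of L(k,0). *)
Definition gauss (c : R) (z : C) : C := RtoC (exp (- (c * Im z ^ 2))).
Lemma gauss_partials c z : cderiv (fun s => gauss c (s, Im z)) (Re z) 0 /\
   cderiv (fun s => gauss c (Re z, s)) (Im z) (RtoC (- (2 * c)) * (RtoC (Im z) * gauss c z)).
Proof.
  unfold gauss; simpl. split; [exact (cderiv_const (RtoC (exp (- (c * (Im z * (Im z * 1)))))) (Re z))|].
  eapply cderiv_eq; [apply cderiv_RtoC with (a := (- (2 * c) * (Im z * exp (- (c * Im z ^ 2))))%R)|].
  - auto_derive; auto. simpl. ring.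
  - now rewrite !RtoC_mult.
Qed.
Lemma gauss_cont c z : continuous (gauss c) z.
Proof.
  apply ctn_RtoC, ctn_exp, ctn_Ropp, ctn_Rmult; [apply continuous_const|]. simpl.
  assert (continuous Im z) by (destruct z as [a b]; apply continuous_snd).
  apply ctn_Rmult; auto. apply ctn_Rmult; auto. apply continuous_const.
Qed.
#[export] Hint Resolve gauss_cont : cont.
Lemma Cn_gauss p c : Cn p (gauss c).
Proof.
  induction p.
  - intro z. apply gauss_cont.
  - apply (Cn_intro p _ (fun _ => 0) (fun z => RtoC (- (2 * c)) * (RtoC (Im z) * gauss c z))); try apply gauss_partials.
    + intro; apply gauss_cont.
    + apply Cn_const.
    + apply Cn_scal, Cn_mult; auto. apply Cn_Im.
Qed.

Lemma dbar_intro f z a b : cderiv (fun s => f (s, Im z)) (Re z) a -> cderiv (fun s => f (Re z, s)) (Im z) b ->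
  dbar f z = (a + Ci * b) / 2.
Proof. intros H1 H2. unfold dbar. destruct (partials_intro f z a b H1 H2) as (_ & -> & ->). reflexivity. Qed.
Lemma dbar_mult f g z : ex_partials f z -> ex_partials g z ->
  dbar (fun z => f z * g z) z = dbar f z * g z + f z * dbar g z.
Proof.
  intros Hf Hg.
  rewrite (dbar_intro (fun z : C => f z * g z) z _ _ (cderiv_mult_R _ _ _ _ _ (partials_dRe _ _ Hf) (partials_dRe _ _ Hg))
    (cderiv_mult_I _ _ _ _ _ (partials_dIm _ _ Hf) (partials_dIm _ _ Hg))).
  unfold dbar, Cdiv. ring.
Qed.
Lemma dbar_plus f g z : ex_partials f z -> ex_partials g z ->
  dbar (fun z => f z + g z) z = dbar f z + dbar g z.
Proof.
  intros Hf Hg.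
  rewrite (dbar_intro (fun z : C => f z + g z) z _ _ (cderiv_plus _ _ _ _ _ (partials_dRe _ _ Hf) (partials_dRe _ _ Hg))
    (cderiv_plus _ _ _ _ _ (partials_dIm _ _ Hf) (partials_dIm _ _ Hg))).
  unfold dbar, Cdiv. ring.
Qed.
Lemma dbar_scal c f z : ex_partials f z -> dbar (fun z => c * f z) z = c * dbar f z.
Proof.
  intros Hf.
  rewrite (dbar_intro (fun z : C => c * f z) z _ _ (cderiv_scal c _ _ _ (partials_dRe _ _ Hf)) (cderiv_scal c _ _ _ (partials_dIm _ _ Hf))).
  unfold dbar, Cdiv. ring.
Qed.
Lemma ex_partials_scal c f z : ex_partials f z -> ex_partials (fun z => c * f z) z.
Proof.
  intros Hf. apply (partials_intro (fun z : C => c * f z) z _ _ (cderiv_scal c _ _ _ (partials_dRe _ _ Hf)) (cderiv_scal c _ _ _ (partials_dIm _ _ Hf))).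
Qed.
Lemma dbar_csum n (f : nat -> C -> C) z : (forall i, ex_partials (f i) z) ->
  ex_partials (fun z => Csum n (fun i => f i z)) z /\
  dbar (fun z => Csum n (fun i => f i z)) z = Csum n (fun i => dbar (f i) z).
Proof.
  intro H. induction n; simpl.
  - pose proof (partials_intro (fun _ : C => 0) z 0 0 (cderiv_const _ _) (cderiv_const _ _)) as K. split; [apply K|].
    rewrite (dbar_intro (fun _ : C => 0) z 0 0 (cderiv_const _ _) (cderiv_const _ _)). unfold Cdiv; ring.
  - destruct IHn as [H1 H2]. split.
    + apply (partials_intro (fun z : C => Csum n (fun i => f i z) + f n z) z _ _ (cderiv_plus _ _ _ _ _ (partials_dRe _ _ H1) (partials_dRe _ _ (H n)))
       (cderiv_plus _ _ _ _ _ (partials_dIm _ _ H1) (partials_dIm _ _ (H n)))).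
    + rewrite dbar_plus; auto. now rewrite H2.
Qed.

Lemma smooth_partials f : smooth f -> forall z, ex_partials f z.
Proof. intros H z. apply (H 1%nat). Qed.
Lemma smooth_cont f : smooth f -> forall z, continuous f z.
Proof. intros H z. apply (H 0%nat). Qed.
#[export] Hint Resolve smooth_cont : cont.
Lemma smooth_dRe f : smooth f -> smooth (dRe f).
Proof. intros H n. apply (H (S n)). Qed.
Lemma smooth_dIm f : smooth f -> smooth (dIm f).
Proof. intros H n. apply (H (S n)). Qed.
Lemma smooth_mult f g : smooth f -> smooth g -> smooth (fun z => f z * g z).
Proof. intros H1 H2 n. now apply Cn_mult. Qed.
Lemma smooth_plus f g : smooth f -> smooth g -> smooth (fun z => f z + g z).
Proof. intros H1 H2 n. now apply Cn_plus. Qed.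
Lemma smooth_scal c f : smooth f -> smooth (fun z => c * f z).
Proof. intros H1 n. now apply Cn_scal. Qed.
Lemma smooth_conj f : smooth f -> smooth (fun z => Cconj (f z)).
Proof. intros H1 n. now apply Cn_conj. Qed.
Lemma smooth_csum n (f : nat -> C -> C) : (forall i, smooth (f i)) -> smooth (fun z => Csum n (fun i => f i z)).
Proof. intros H p. apply Cn_csum. intro; apply H. Qed.
Lemma smooth_gauss c : smooth (gauss c).
Proof. intro n. apply Cn_gauss. Qed.
Lemma smooth_dbar f : smooth f -> smooth (dbar f).
Proof.
  intros H. assert (E : dbar f = fun z => / 2 * (dRe f z + Ci * dIm f z)).
  { apply functional_extensionality; intro z. unfold dbar, Cdiv. ring. }
  rewrite E. apply smooth_scal, smooth_plus; [now apply smooth_dRe|]. now apply smooth_scal, smooth_dIm.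
Qed.

(** The elementary form of complex differentiability, on which the bisection argument operates. *)
Definition cdiff (f : C -> C) (z l : C) : Prop :=
  forall e, (0 < e)%R -> exists d, (0 < d)%R /\ forall w, (Cmod (w - z) < d)%R ->
    (Cmod (f w - f z - l * (w - z)) <= e * Cmod (w - z))%R.

Lemma cdiff_iff f z l : is_derive (K := C_AbsRing) (V := C_NormedModule) f z l <-> cdiff f z l.
Proof.
  split.
  - intros [_ H] e He. specialize (H z (fun P HP => HP) (mkposreal e He)).
    destruct H as [d Hd]. exists d. split; [apply cond_pos|]. intros w Hw.
    specialize (Hd w Hw).
    replace (f w - f z - l * (w - z)) with (minus (minus (f w) (f z)) (scal (minus w z) l)).
    exact Hd. unfold minus, plus, opp, scal; simpl. unfold mult; simpl. ring.
  - intro H. split; [apply is_linear_scal_l|]. intros x Hx.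
    assert (x = z) as ->. { symmetry. apply (is_filter_lim_locally_unique (V:=AbsRing_NormedModule C_AbsRing) z x Hx). }
    intros [e He]. destruct (H e He) as (d & Hd & Hw). exists (mkposreal d Hd).
    intros w Hb.
    pose proof (Hw w Hb) as K.
    replace (f w - f z - l * (w - z)) with ((f w + - f z) + - ((w + - z) * l)) in K by ring. exact K.
Qed.

(** * Holomorphic functions *)

(** The product rule holds for C as a module over itself, while [entire] refers to the other
    normed-module structure on C; both have the same derivatives. *)
Lemma cdiff_iff_ring f z l : is_derive (K := C_AbsRing) (V := AbsRing_NormedModule C_AbsRing) f z l <-> cdiff f z l.
Proof. rewrite <- cdiff_iff. split; intros [_ H]; (split; [apply is_linear_scal_l|exact H]). Qed.

Lemma entire_cdiff f : entire f <-> exists l, forall z, cdiff f z (l z).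
Proof.
  split.
  - intro H. exists (fun z => epsilon (inhabits (RtoC 0)) (fun l => cdiff f z l)). intro z.
    apply epsilon_spec. destruct (H z) as [l Hl]. exists l. now apply cdiff_iff.
  - intros [l Hl] z. exists (l z). apply cdiff_iff, Hl.
Qed.
Lemma entire_cont f : entire f -> forall z, continuous f z.
Proof.
  intros H z. apply entire_cdiff in H. destruct H as [l Hl]. apply ctn_eps. intros e He.
  destruct (Hl z 1%R ltac:(lra)) as (d & Hd & Hw).
  assert (Hp : (0 < Rmin (d / 2) (e / (2 * (Cmod (l z) + 1))))%R).
  { apply Rmin_pos; [lra|]. apply Rdiv_lt_0_compat; auto. pose proof (Cmod_ge_0 (l z)). lra. }
  assert (Hh : (0 < Rmin (d / 2) (e / (2 * (Cmod (l z) + 1))) / 2)%R) by lra.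
  exists (mkposreal _ Hh). intros w Hb. apply Cmod_ball_C in Hb. simpl in Hb.
  pose proof (Rmin_l (d / 2) (e / (2 * (Cmod (l z) + 1)))).
  pose proof (Rmin_r (d / 2) (e / (2 * (Cmod (l z) + 1)))).
  specialize (Hw w ltac:(lra)). rewrite Rmult_1_l in Hw.
  replace (f w - f z) with ((f w - f z - l z * (w - z)) + l z * (w - z)) by ring.
  eapply Rle_lt_trans; [apply Cmod_triangle|]. rewrite Cmod_mult.
  pose proof (Cmod_ge_0 (l z)).
  assert (E : (Cmod (w - z) < e / (2 * (Cmod (l z) + 1)))%R) by lra.
  apply (Rmult_lt_compat_l (2 * (Cmod (l z) + 1))) in E; [|lra].
  replace (2 * (Cmod (l z) + 1) * (e / (2 * (Cmod (l z) + 1))))%R with e in E by (field; lra). pose proof (Cmod_ge_0 (w - z)). nra.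
Qed.
#[export] Hint Resolve entire_cont : cont.
Lemma entire_mult f g : entire f -> entire g -> entire (fun z => f z * g z).
Proof.
  intros Hf Hg z. destruct (Hf z) as [a Ha]. destruct (Hg z) as [b Hb].
  apply cdiff_iff in Ha. apply cdiff_iff in Hb. apply cdiff_iff_ring in Ha. apply cdiff_iff_ring in Hb.
  exists (plus (mult a (g z)) (mult (f z) b)). apply cdiff_iff, cdiff_iff_ring.
  apply (is_derive_mult (K:=C_AbsRing) f g z a b Ha Hb). intros; apply Cmult_comm.
Qed.
Lemma entire_plus f g : entire f -> entire g -> entire (fun z => f z + g z).
Proof. intros Hf Hg z. apply (ex_derive_plus (K:=C_AbsRing) (V:=C_NormedModule) f g z (Hf z) (Hg z)). Qed.
Lemma entire_const c : entire (fun _ => c).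
Proof. intro z. apply (ex_derive_const (K:=C_AbsRing) (V:=C_NormedModule) c z). Qed.
Lemma entire_csum n (f : nat -> C -> C) : (forall i, entire (f i)) -> entire (fun z => Csum n (fun i => f i z)).
Proof. intro H. induction n; simpl; [apply entire_const|now apply entire_plus]. Qed.

(** Two partial derivatives, one of which is continuous, give total differentiability. *)
Lemma real_differentiable (h hx hy : C -> R) z :
  (forall z, is_derive (fun s => h (s, Im z)) (Re z) (hx z)) ->
  (forall z, is_derive (fun s => h (Re z, s)) (Im z) (hy z)) -> (forall z, continuous hx z) ->
  forall e, (0 < e)%R -> exists d, (0 < d)%R /\ forall w, (Cmod (w - z) < d)%R ->
   (Rabs (h w - h z - (hx z * Re (w - z) + hy z * Im (w - z))) <= e * Cmod (w - z))%R.
Proof.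
  intros Hx Hy Hc e He.
  assert (F : filterdiff (fun u : R * R => h (fst u, snd u)) (locally (Re z, Im z)) (fun u : R * R => (fst u * hx z + snd u * hy z)%R)).
  { eapply filterdiff_ext_lin.
    - apply (is_derive_filterdiff (fun a b => h (a, b)) (Re z) (Im z) (fun a b => hx (a, b)) (hy z)).
      + apply filter_forall. intros [a b]. apply (Hx (a, b)).
      + apply Hy.
      + apply (continuous_ext hx); [intros [a b]; reflexivity|]. apply Hc.
    - intros [a b]. simpl. destruct z; reflexivity. }
  apply (filterdiff_differentiable_pt_lim (fun a b => h (a, b))) in F.
  destruct (F (mkposreal e He)) as [d Hd]. exists d. split; [apply cond_pos|].
  intros w Hw.
  assert (H1 : (Rabs (Re w - Re z) <= Cmod (w - z))%R) by apply (re_le_Cmod (w - z)).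
  assert (H2 : (Rabs (Im w - Im z) <= Cmod (w - z))%R) by apply (im_le_Cmod (w - z)).
  specialize (Hd (Re w) (Im w) ltac:(lra) ltac:(lra)). simpl in Hd. rewrite !pair_eta in Hd.
  eapply Rle_trans; [exact Hd|]. apply Rmult_le_compat_l; [lra|]. now apply Rmax_lub.
Qed.
(** [dbar f = 0] says that the real differential of [f] is multiplication by [dRe f]. *)
Lemma CR_entire f : Cn 1 f -> (forall z, dbar f z = 0) -> entire f.
Proof.
  intros Hf Hd.
  assert (HI : forall z, dIm f z = Ci * dRe f z).
  { intro z. pose proof (Hd z) as E. unfold dbar in E.
    assert (E2 : dRe f z + Ci * dIm f z = 0).
    { replace (dRe f z + Ci * dIm f z) with (2 * ((dRe f z + Ci * dIm f z) / 2)) by (field; intro K; injection K; lra). rewrite E. ring. }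
    replace (dIm f z) with (- Ci * (dRe f z + Ci * dIm f z) + Ci * dRe f z).
    rewrite E2; ring. replace (- Ci * (dRe f z + Ci * dIm f z) + Ci * dRe f z) with (- (Ci * Ci) * dIm f z) by ring.
    replace (Ci * Ci) with (RtoC (-1)) by (apply C_ext; simpl; ring). apply C_ext; simpl; ring. }
  assert (HR : forall z, continuous (dRe f) z) by (apply Hf).
  apply entire_cdiff. exists (dRe f). intros z e He.
  destruct (real_differentiable (fun z => Re (f z)) (fun z => Re (dRe f z)) (fun z => Re (dIm f z)) z) with (e := (e / 2)%R) as (d1 & Hd1 & K1); try lra.
  { intro w. exact (proj1 (proj1 (cderiv_iff _ _ _) (Cn_dR 0 f Hf w))). }
  { intro w. exact (proj1 (proj1 (cderiv_iff _ _ _) (Cn_dI 0 f Hf w))). }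
  { cont. }
  destruct (real_differentiable (fun z => Im (f z)) (fun z => Im (dRe f z)) (fun z => Im (dIm f z)) z) with (e := (e / 2)%R) as (d2 & Hd2 & K2); try lra.
  { intro w. exact (proj2 (proj1 (cderiv_iff _ _ _) (Cn_dR 0 f Hf w))). }
  { intro w. exact (proj2 (proj1 (cderiv_iff _ _ _) (Cn_dI 0 f Hf w))). }
  { cont. }
  exists (Rmin d1 d2). split; [now apply Rmin_pos|]. intros w Hw.
  pose proof (Rmin_l d1 d2). pose proof (Rmin_r d1 d2).
  specialize (K1 w ltac:(lra)). specialize (K2 w ltac:(lra)).
  eapply Rle_trans; [apply Cmod_le_sum|].
  replace (e * Cmod (w - z))%R with (e / 2 * Cmod (w - z) + e / 2 * Cmod (w - z))%R by field.
  rewrite HI in K1, K2. rewrite !re_mult in K1. rewrite !im_mult in K2.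
  apply Rplus_le_compat.
  - eapply Rle_trans; [|exact K1]. right. f_equal. unfold Cminus. rewrite !re_plus, !re_opp, re_mult, !re_plus, !re_opp, !im_plus, !im_opp. change (Re Ci) with 0%R. change (Im Ci) with 1%R. ring.
  - eapply Rle_trans; [|exact K2]. right. f_equal. unfold Cminus. rewrite !im_plus, !im_opp, im_mult, !im_plus, !im_opp, !re_plus, !re_opp. change (Re Ci) with 0%R. change (Im Ci) with 1%R. ring.
Qed.

(** * Goursat and the Fourier coefficients of entire functions *)
(** The integral of [f] along the boundary of [a, b] x [c, d]. *)
Definition rect_int (f : C -> C) (a b c d : R) : C :=
  cint (fun r => f (r, c)) a b - cint (fun r => f (r, d)) a b
  + Ci * (cint (fun y => f (b, y)) c d - cint (fun y => f (a, y)) c d).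

Lemma hslice_ccont (f : C -> C) y : (forall z, continuous f z) -> ccont (fun r => f (r, y)).
Proof. intros H t. now apply ctn_slice. Qed.
Lemma vslice_ccont (f : C -> C) r : (forall z, continuous f z) -> ccont (fun y => f (r, y)).
Proof. intros H t. now apply ctn_vslice. Qed.

(** An affine function has a polynomial primitive, here evaluated side by side. *)
Lemma rect_int_affine A B a b c d : rect_int (fun w => A + B * w) a b c d = 0.
Proof.
  assert (H : forall y, cint (fun r : R => A + B * ((r, y) : C)) a b
     = A * RtoC (b - a) + B * (RtoC ((b ^ 2 - a ^ 2) / 2) + Ci * RtoC (y * (b - a)))).
  { intro y. rewrite (cint_FTC (fun r => A * RtoC r + B * (RtoC (r ^ 2 / 2) + Ci * RtoC (y * r)))).
    - apply C_ext; simpl; field.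
    - intro t. eapply cderiv_eq.
      + apply cderiv_plus; apply cderiv_scal; [|apply cderiv_plus; [|apply cderiv_scal]]; apply cderiv_RtoC; auto_derive; auto.
      + apply C_ext; simpl; field.
    - apply (hslice_ccont (fun w => A + B * w)). intro z. apply ctn_plus; [apply continuous_const|].
      apply ctn_mult; [apply continuous_const|apply continuous_id]. }
  assert (V : forall x, cint (fun y : R => A + B * ((x, y) : C)) c d
     = A * RtoC (d - c) + B * (RtoC (x * (d - c)) + Ci * RtoC ((d ^ 2 - c ^ 2) / 2))).
  { intro x. rewrite (cint_FTC (fun r => A * RtoC r + B * (RtoC (x * r) + Ci * RtoC (r ^ 2 / 2)))).
    - apply C_ext; simpl; field.
    - intro t. eapply cderiv_eq.
      + apply cderiv_plus; apply cderiv_scal; [|apply cderiv_plus; [|apply cderiv_scal]]; apply cderiv_RtoC; auto_derive; auto.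
      + apply C_ext; simpl; field.
    - apply (vslice_ccont (fun w => A + B * w)). intro z. apply ctn_plus; [apply continuous_const|].
      apply ctn_mult; [apply continuous_const|apply continuous_id]. }
  unfold rect_int. rewrite !H, !V. apply C_ext; simpl; field.
Qed.
Lemma rect_int_minus f g a b c d : (forall z, continuous f z) -> (forall z, continuous g z) ->
  rect_int (fun w => f w - g w) a b c d = rect_int f a b c d - rect_int g a b c d.
Proof.
  intros Hf Hg. unfold rect_int.
  rewrite !(cint_minus (fun r => f (r, _)) (fun r => g (r, _))) by cont.
  rewrite !(cint_minus (fun y => f (_, y)) (fun y => g (_, y))) by cont. ring.
Qed.
Lemma rect_int_bound f a b c d M : (forall z, continuous f z) -> (a <= b)%R -> (c <= d)%R ->
  (forall z, (a <= Re z <= b)%R -> (c <= Im z <= d)%R -> (Cmod (f z) <= M)%R) ->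
  (Cmod (rect_int f a b c d) <= 2 * ((b - a) + (d - c)) * M)%R.
Proof.
  intros Hf Hab Hcd HM. unfold rect_int.
  assert (H1 : forall y, (c <= y <= d)%R -> (Cmod (cint (fun r => f (r, y)) a b) <= (b - a) * M)%R).
  { intros y Hy. apply cint_bound; auto. now apply hslice_ccont. }
  assert (H2 : forall x, (a <= x <= b)%R -> (Cmod (cint (fun y => f (x, y)) c d) <= (d - c) * M)%R).
  { intros y Hy. apply cint_bound; auto. now apply vslice_ccont. }
  eapply Rle_trans; [apply Cmod_triangle|]. rewrite Cmod_mult, Cmod_Ci, Rmult_1_l.
  eapply Rle_trans; [apply Rplus_le_compat; apply Cmod_triangle|]. rewrite !Cmod_opp.
  pose proof (H1 c ltac:(lra)). pose proof (H1 d ltac:(lra)).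
  pose proof (H2 a ltac:(lra)). pose proof (H2 b ltac:(lra)). lra.
Qed.
Lemma rect_int_split f a b c d e m : (forall z, continuous f z) ->
  rect_int f a b c d = (rect_int f a e c m + rect_int f e b c m) + (rect_int f a e m d + rect_int f e b m d).
Proof.
  intro Hf. unfold rect_int.
  rewrite <- !(cint_chasles (fun r => f (r, _)) a e b) by cont.
  rewrite <- !(cint_chasles (fun y => f (_, y)) c m d) by cont. ring.
Qed.
(** One bisection step: among the four quarters of a rectangle, one carries at least a quarter of
    the boundary integral. *)
Definition quarter (f : C -> C) (p q : R) (z : R * R) : R * R :=
  let J x y := Cmod (rect_int f x (x + p / 2) y (y + q / 2)) in
  let K := Cmod (rect_int f (fst z) (fst z + p) (snd z) (snd z + q)) in
  if Rle_dec (K / 4) (J (fst z) (snd z)) then z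
  else if Rle_dec (K / 4) (J (fst z + p / 2)%R (snd z)) then ((fst z + p / 2)%R, snd z)
  else if Rle_dec (K / 4) (J (fst z) (snd z + q / 2)%R) then (fst z, (snd z + q / 2)%R)
  else ((fst z + p / 2)%R, (snd z + q / 2)%R).
Lemma quarter_spec f p q z : (forall z, continuous f z) ->
  let z' := quarter f p q z in
  (Cmod (rect_int f (fst z) (fst z + p) (snd z) (snd z + q)) / 4 <= Cmod (rect_int f (fst z') (fst z' + p / 2) (snd z') (snd z' + q / 2)))%R
  /\ (fst z' = fst z \/ fst z' = fst z + p / 2)%R /\ (snd z' = snd z \/ snd z' = snd z + q / 2)%R.
Proof.
  intros Hf. unfold quarter. cbv zeta.
  match goal with |- context [Rle_dec ?u ?v] => destruct (Rle_dec u v) as [H1|H1] end; [simpl; auto|].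
  match goal with |- context [Rle_dec ?u ?v] => destruct (Rle_dec u v) as [H2|H2] end; [simpl; auto|].
  match goal with |- context [Rle_dec ?u ?v] => destruct (Rle_dec u v) as [H3|H3] end; [simpl; auto|]. simpl. split; auto.
  rewrite (rect_int_split f (fst z) (fst z + p) (snd z) (snd z + q) (fst z + p / 2) (snd z + q / 2)) in * by auto.
  replace (fst z + p)%R with (fst z + p / 2 + p / 2)%R in * by field.
  replace (snd z + q)%R with (snd z + q / 2 + q / 2)%R in * by field.
  match goal with |- (Cmod ((?a + ?b) + (?c + ?d)) / 4 <= _)%R =>
    pose proof (Cmod_triangle (a + b) (c + d)); pose proof (Cmod_triangle a b); pose proof (Cmod_triangle c d) end.
  lra.
Qed.
Fixpoint corner (f : C -> C) (a c p q : R) (n : nat) : R * R :=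
  match n with O => (a, c) | S m => quarter f (p * (/ 2) ^ m) (q * (/ 2) ^ m) (corner f a c p q m) end.

(** The corners increase and stay below every right end, so their supremum lies in all the
    intervals. *)
Lemma nested_point (a : nat -> R) (p : R) : (0 <= p)%R -> (forall n, a (S n) = a n \/ a (S n) = a n + p * (/ 2) ^ n / 2)%R ->
  exists A, forall n, (a n <= A <= a n + p * (/ 2) ^ n)%R.
Proof.
  intros Hp H.
  assert (Hi : forall n m, (a n <= a (n + m)%nat /\ a (n + m)%nat + p * (/ 2) ^ (n + m) <= a n + p * (/ 2) ^ n)%R).
  { intros n m. induction m; [rewrite Nat.add_0_r; lra|]. rewrite Nat.add_succ_r. simpl.
    pose proof (half_pow_pos (n + m)). destruct (H (n + m)%nat) as [E|E]; rewrite E; nra. }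
  assert (Hle : forall n m, (a n <= a m + p * (/ 2) ^ m)%R).
  { intros n m. destruct (Nat.le_gt_cases n m) as [L|L].
    - pose proof (Hi n (m - n)%nat) as K. replace (n + (m - n))%nat with m in K by lia.
      pose proof (half_pow_pos m). nra.
    - pose proof (Hi m (n - m)%nat) as K. replace (m + (n - m))%nat with n in K by lia.
      pose proof (half_pow_pos n). nra. }
  destruct (completeness (fun x => exists n, x = a n)) as [A [HA1 HA2]].
  - exists (a 0%nat + p * (/ 2) ^ 0)%R. intros x [n ->]. apply Hle.
  - exists (a 0%nat). now exists 0%nat.
  - exists A. intro n. split; [apply HA1; now exists n|]. apply HA2. intros x [m ->]. apply Hle.
Qed.

(** After [n] bisections the remaining rectangle carries at least [4 ^ (- n)] of the integral.
    There [f] is affine, with vanishing integral, up to an error [e] times the diameter; perimeter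
    times error is at most a constant times [e * 4 ^ (- n)]. *)
Lemma goursat f a b c d : entire f -> (a <= b)%R -> (c <= d)%R -> rect_int f a b c d = 0.
Proof.
  intros Hf Hab Hcd.
  pose proof (entire_cont f Hf) as Hc.
  apply entire_cdiff in Hf. destruct Hf as [l Hl].
  set (p := (b - a)%R). set (q := (d - c)%R). set (z := corner f a c p q).
  assert (Hs : forall n, (Cmod (rect_int f a b c d) * (/ 4) ^ n <=
    Cmod (rect_int f (fst (z n)) (fst (z n) + p * (/ 2) ^ n) (snd (z n)) (snd (z n) + q * (/ 2) ^ n)))%R).
  { induction n.
    - simpl. rewrite !Rmult_1_r. unfold p, q. right.
      replace (a + (b - a))%R with b by ring. replace (c + (d - c))%R with d by ring. reflexivity.
    - destruct (quarter_spec f (p * (/ 2) ^ n) (q * (/ 2) ^ n) (z n) Hc) as [E _].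
      change (quarter f (p * (/ 2) ^ n) (q * (/ 2) ^ n) (z n)) with (z (S n)) in E.
      replace (p * (/ 2) ^ S n)%R with (p * (/ 2) ^ n / 2)%R by (simpl; field).
      replace (q * (/ 2) ^ S n)%R with (q * (/ 2) ^ n / 2)%R by (simpl; field).
      eapply Rle_trans; [|exact E]. simpl. lra. }
  destruct (nested_point (fun n => fst (z n)) p) as [A HA]; [unfold p; lra| |].
  { intro n. destruct (quarter_spec f (p * (/ 2) ^ n) (q * (/ 2) ^ n) (z n) Hc) as (_ & E & _). exact E. }
  destruct (nested_point (fun n => snd (z n)) q) as [B HB]; [unfold q; lra| |].
  { intro n. destruct (quarter_spec f (p * (/ 2) ^ n) (q * (/ 2) ^ n) (z n) Hc) as (_ & _ & E). exact E. }
  set (z0 := (A, B) : C). set (L := (p + q)%R).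
  assert (HL : (0 <= L)%R) by (unfold L, p, q; lra).
  assert (Hsmall : forall e, (0 < e)%R -> (Cmod (rect_int f a b c d) <= 2 * L ^ 2 * e)%R).
  { intros e He. destruct (Hl z0 e He) as (dl & Hdl & Hw).
    destruct (pow_lt_1_zero (/ 2) ltac:(rewrite Rabs_right; lra) (dl / (L + 1))) as [n Hn].
    { apply Rdiv_lt_0_compat; lra. }
    specialize (Hn n (Nat.le_refl _)). rewrite Rabs_right in Hn by (left; apply half_pow_pos).
    pose proof (half_pow_pos n) as Hpos.
    assert (HLn : (L * (/ 2) ^ n < dl)%R).
    { apply (Rmult_lt_compat_l (L + 1)) in Hn; [|lra].
      replace ((L + 1) * (dl / (L + 1)))%R with dl in Hn by (field; lra). nra. }
    specialize (Hs n). specialize (HA n). specialize (HB n). cbv beta in HA, HB.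
    set (x := fst (z n)) in *. set (y := snd (z n)) in *. set (h := ((/ 2) ^ n)%R) in *.
    assert (E : rect_int f x (x + p * h) y (y + q * h) = rect_int (fun w => f w - ((f z0 - l z0 * z0) + l z0 * w)) x (x + p * h) y (y + q * h)).
    { rewrite rect_int_minus, rect_int_affine; auto; [ring|]. intro w. apply ctn_plus; [apply continuous_const|].
      apply ctn_mult; [apply continuous_const|apply continuous_id]. }
    rewrite E in Hs.
    assert (Hph : (0 <= p * h)%R) by (apply Rmult_le_pos; unfold p; lra).
    assert (Hqh : (0 <= q * h)%R) by (apply Rmult_le_pos; unfold q; lra).
    assert (Hb : (Cmod (rect_int (fun w => f w - ((f z0 - l z0 * z0) + l z0 * w))%C x (x + p * h) y (y + q * h)) <=
      2 * ((x + p * h - x) + (y + q * h - y)) * (e * (L * h)))%R).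
    { apply rect_int_bound; try lra.
      - cont.
      - intros w H1 H2.
        assert (Hd : (Cmod (w - z0) <= L * h)%R).
        { eapply Rle_trans; [apply Cmod_le_sum|]. unfold Cminus. rewrite re_plus, im_plus, re_opp, im_opp. unfold z0; simpl.
          replace (L * h)%R with (p * h + q * h)%R by (unfold L; ring).
          apply Rplus_le_compat; apply Rabs_le; simpl in *; lra. }
        replace (f w - (f z0 - l z0 * z0 + l z0 * w))%C with (f w - f z0 - l z0 * (w - z0))%C by ring.
        eapply Rle_trans; [apply Hw; lra|]. apply Rmult_le_compat_l; lra. }
    assert (E4 : ((/ 4) ^ n = h * h)%R). { unfold h. rewrite <- Rpow_mult_distr. f_equal. field. }
    rewrite E4 in Hs.
    assert (Hf1 : (Cmod (rect_int f a b c d) * (h * h) <= 2 * L ^ 2 * e * (h * h))%R).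
    { eapply Rle_trans; [exact Hs|]. eapply Rle_trans; [exact Hb|]. right. unfold L. ring. }
    apply (Rmult_le_reg_r (h * h)); [nra|]. exact Hf1. }
  apply Cmod_eq_0. apply Rle_antisym; [|apply Cmod_ge_0].
  apply le_epsilon. intros e He. rewrite Rplus_0_l.
  assert (H0 : (0 < e / (2 * L ^ 2 + 1))%R). { apply Rdiv_lt_0_compat; auto. pose proof (pow2_ge_0 L). lra. }
  eapply Rle_trans; [apply (Hsmall _ H0)|].
  assert (E : ((2 * L ^ 2 + 1) * (e / (2 * L ^ 2 + 1)) = e)%R) by (field; pose proof (pow2_ge_0 L); lra). lra.
Qed.

(** In the boundary integral over a period strip the vertical sides cancel. *)
Lemma periodic_integral_const f y1 y2 : entire f -> (forall z, f (z + 1) = f z) ->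
  cint (fun r => f (r, y1)) 0 1 = cint (fun r => f (r, y2)) 0 1.
Proof.
  intros Hf Hp.
  assert (K : forall c d, (c <= d)%R -> cint (fun r => f (r, c)) 0 1 = cint (fun r => f (r, d)) 0 1).
  { intros c d Hcd. pose proof (goursat f 0 1 c d Hf ltac:(lra) Hcd) as E. unfold rect_int in E.
    rewrite (cint_ext (fun y => f (1%R, y)) (fun y => f (0%R, y))) in E.
    - replace (cint (fun r => f (r, c)) 0 1) with (cint (fun r => f (r, c)) 0 1 - cint (fun r => f (r, d)) 0 1 +
       Ci * (cint (fun y => f (0%R, y)) c d - cint (fun y => f (0%R, y)) c d) + cint (fun r => f (r, d)) 0 1) by ring.
      rewrite E. ring.
    - intro t. rewrite <- (Hp (0%R, t)). f_equal. apply C_ext; simpl; ring. }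
  destruct (Rle_lt_dec y1 y2); [auto|symmetry; apply K; lra].
Qed.

(** * Fourier coefficients on horizontal lines *)

Definition em (m : Z) (z : C) : C := cexp (2 * PI * Ci * IZR m * z).
(** The Fourier coefficient on the line [Im z = y] with respect to the holomorphic exponential [em
    m], which makes it constant in [y] for entire [f]. *)
Definition fcoef (m : Z) (f : C -> C) (y : R) : C := cint (fun r => f (r, y) * em (- m) (r, y)) 0 1.

Lemma em_add m n z : em m z * em n z = em (m + n) z.
Proof. unfold em. rewrite <- cexp_plus, plus_IZR, RtoC_plus. f_equal. ring. Qed.
Lemma em_0 z : em 0 z = 1.
Proof. unfold em. rewrite <- cexp_0. f_equal. ring. Qed.
Lemma em_plus m z w : em m (z + w) = em m z * em m w.
Proof. unfold em. rewrite <- cexp_plus. f_equal. ring. Qed.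
Lemma em_1 m : em m 1 = 1.
Proof. unfold em. rewrite Cmult_1_r. apply cexp_2PI_Z. Qed.
Lemma em_periodic m z : em m (z + 1) = em m z.
Proof. rewrite em_plus, em_1. ring. Qed.
Lemma Cmod_em m z : Cmod (em m z) = exp (- (2 * PI * IZR m * Im z)).
Proof. unfold em. rewrite Cmod_cexp. f_equal. destruct z; simpl. ring. Qed.
Lemma em_cont m z : continuous (em m) z.
Proof. apply ctn_cexp, ctn_mult; [apply continuous_const|apply continuous_id]. Qed.
#[export] Hint Resolve em_cont : cont.
Definition c2pi (m : Z) : C := 2 * PI * Ci * IZR m.
Lemma em_dR m z : cderiv (fun s => em m (s, Im z)) (Re z) (c2pi m * em m z).
Proof.
  pose proof (cderiv_cexp (fun s : R => 2 * PI * Ci * IZR m * (s, Im z)) (Re z) (c2pi m)) as H.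
  cbv beta in H. rewrite pair_eta in H. apply H.
  apply (cderiv_ext (fun s => c2pi m * (RtoC s + Ci * RtoC (Im z)))).
  - intro s. unfold c2pi. f_equal. apply C_ext; simpl; ring.
  - eapply cderiv_eq; [apply cderiv_scal, cderiv_plus; [apply cderiv_RtoC, (is_derive_id (K:=R_AbsRing))|apply cderiv_const]|].
    change (RtoC one) with (RtoC 1). ring.
Qed.
Lemma em_dI m z : cderiv (fun s => em m (Re z, s)) (Im z) (Ci * c2pi m * em m z).
Proof.
  pose proof (cderiv_cexp (fun s : R => 2 * PI * Ci * IZR m * (Re z, s)) (Im z) (Ci * c2pi m)) as H.
  cbv beta in H. rewrite pair_eta in H. apply H.
  apply (cderiv_ext (fun s => c2pi m * (RtoC (Re z) + Ci * RtoC s))).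
  - intro s. unfold c2pi. f_equal. apply C_ext; simpl; ring.
  - eapply cderiv_eq; [apply cderiv_scal, cderiv_plus; [apply cderiv_const|apply cderiv_scal, cderiv_RtoC, (is_derive_id (K:=R_AbsRing))]|].
    change (RtoC one) with (RtoC 1). ring.
Qed.
Lemma Cn_em p m : Cn p (em m).
Proof.
  induction p; [intro z; apply em_cont|].
  apply (Cn_intro p _ (fun z => c2pi m * em m z) (fun z => Ci * c2pi m * em m z)).
  - apply em_cont. - apply em_dR. - apply em_dI.
  - now apply Cn_scal.
  - now apply Cn_scal.
Qed.
Lemma half_CiCi (a : C) : (a + Ci * (Ci * a)) / 2 = 0.
Proof. unfold Cdiv. replace (a + Ci * (Ci * a)) with (a + (Ci * Ci) * a) by ring. replace (Ci * Ci) with (- (1)) by (apply C_ext; simpl; ring). ring. Qed.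
Lemma dbar_em m z : dbar (em m) z = 0.
Proof. rewrite (dbar_intro _ _ _ _ (em_dR m z) (em_dI m z)). rewrite <- Cmult_assoc. apply half_CiCi. Qed.
Lemma entire_em m : entire (em m).
Proof. apply CR_entire; [apply Cn_em|apply dbar_em]. Qed.

Lemma c2pi_neq_0 m : m <> 0%Z -> c2pi m <> 0.
Proof.
  intros Hm E. apply (f_equal Im) in E. unfold c2pi in E. simpl in E.
  assert (E2 : (2 * PI * IZR m = 0)%R) by lra.
  pose proof PI_RGT_0. apply Rmult_integral in E2. destruct E2; [lra|]. apply (eq_IZR m 0) in H0. auto.
Qed.
Lemma em_slice m y : ccont (fun r => em m (r, y)).
Proof. apply hslice_ccont, em_cont. Qed.
Lemma cint_em m y : cint (fun r => em m (r, y)) 0 1 = if Z.eqb m 0 then 1 else 0.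
Proof.
  destruct (Z.eqb_spec m 0) as [->|Hm].
  - rewrite (cint_ext _ (fun _ => 1)) by (intro; apply em_0). rewrite cint_const. apply C_ext; simpl; ring.
  - pose proof (c2pi_neq_0 m Hm) as H0.
    rewrite (cint_FTC (fun r => / c2pi m * em m (r, y))).
    + replace ((1%R, y) : C) with ((0%R, y) + 1) by (apply C_ext; simpl; ring). rewrite em_periodic. ring.
    + intro t. eapply cderiv_eq; [apply cderiv_scal, (em_dR m (t, y))|]. rewrite Cmult_assoc, Cinv_l by auto. ring.
    + cont.
Qed.

Lemma fcoef_integrand_cont m f y : (forall z, continuous f z) -> ccont (fun r => f (r, y) * em (- m) (r, y)).
Proof. intro H. apply ccont_mult; [now apply hslice_ccont|apply em_slice]. Qed.
Lemma fcoef_lin m (c : C) f g y : (forall z, continuous f z) -> (forall z, continuous g z) ->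
  fcoef m (fun z => c * f z + g z) y = c * fcoef m f y + fcoef m g y.
Proof.
  intros Hf Hg. unfold fcoef.
  pose proof (fcoef_integrand_cont m f y Hf) as Kf. pose proof (fcoef_integrand_cont m g y Hg) as Kg.
  set (F := fun r => f (r, y) * em (- m) (r, y)) in *. set (G := fun r => g (r, y) * em (- m) (r, y)) in *.
  rewrite (cint_ext _ (fun t => c * F t + G t)) by (intro; unfold F, G; ring).
  rewrite (cint_plus (fun t => c * F t) G), (cint_scal c F); auto. apply ccont_mult; auto. apply ccont_const.
Qed.
Lemma fcoef_ext m f g y : (forall z, f z = g z) -> fcoef m f y = fcoef m g y.
Proof. intro H. apply cint_ext. intro. now rewrite H. Qed.
Lemma fcoef_scal m (c : C) f y : (forall z, continuous f z) -> fcoef m (fun z => c * f z) y = c * fcoef m f y.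
Proof.
  intros Hf. unfold fcoef. rewrite <- cint_scal by cont.
  apply cint_ext. intro t. ring.
Qed.
Lemma fcoef_csum m n (f : nat -> C -> C) y : (forall i z, continuous (f i) z) ->
  fcoef m (fun z => Csum n (fun i => f i z)) y = Csum n (fun i => fcoef m (f i) y).
Proof.
  intros Hf. unfold fcoef. rewrite <- cint_csum by cont.
  apply cint_ext. intro t. rewrite Cmult_comm, <- Csum_scal. apply Csum_ext. intros; ring.
Qed.
Lemma fcoef_cont m f : (forall z, continuous f z) -> ccont (fcoef m f).
Proof.
  intro H. apply (cint_param_cont (fun z => f z * em (- m) z) 0 1 ltac:(lra)).
  intro z. apply ctn_mult; auto. apply em_cont.
Qed.
#[export] Hint Resolve fcoef_cont : cont.
Lemma fcoef_entire_const m f y1 y2 : entire f -> (forall z, f (z + 1) = f z) -> fcoef m f y1 = fcoef m f y2.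
Proof.
  intros Hf Hp. apply (periodic_integral_const (fun z => f z * em (- m) z)).
  - apply entire_mult; auto. apply entire_em.
  - intro z. now rewrite Hp, em_periodic.
Qed.

(** * Uniqueness of Fourier coefficients *)
(** The factor [b + cos (2 pi t)] is a combination of [em 0], [em 1] and [em (-1)], so multiplying
    by it preserves the orthogonality to all exponentials. *)
Lemma annihilate_pow (g : R -> C) (b : C) (n : nat) : ccont g ->
  (forall m, cint (fun t => g t * em m (t, 0%R)) 0 1 = 0) ->
  forall m, cint (fun t => g t * (b + / 2 * (em 1 (t, 0%R) + em (-1) (t, 0%R))) ^ n * em m (t, 0%R)) 0 1 = 0.
Proof.
  intros Hg H. assert (E0 : forall z m, continuous (em m) z) by cont.
  induction n; intro m.
  - rewrite <- (H m). apply cint_ext. intro t. simpl. ring.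
  - set (K := fun t : R => b + / 2 * (em 1 (t, 0%R) + em (-1) (t, 0%R))) in *.
    assert (HK : ccont K).
    { apply ccont_plus; [apply ccont_const|]. apply ccont_mult; [apply ccont_const|].
      apply ccont_plus; apply em_slice. }
    assert (HKn : ccont (fun t => K t ^ n)).
    { clear - HK. induction n; simpl; [apply ccont_const|]. now apply ccont_mult. }
    assert (HG : forall m, ccont (fun t => g t * K t ^ n * em m (t, 0%R))).
    { cont. }
    set (A := fun j t => g t * K t ^ n * em j (t, 0%R)) in *.
    assert (HS : forall c j, ccont (fun t => c * A j t)) by (intros; apply ccont_mult; [apply ccont_const|apply HG]).
    rewrite (cint_ext _ (fun t => b * A m t + (/ 2 * A (1 + m)%Z t + / 2 * A (-1 + m)%Z t))).
    + rewrite (cint_plus (fun t => b * A m t) (fun t => / 2 * A (1 + m)%Z t + / 2 * A (-1 + m)%Z t)) by (auto using ccont_plus).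
      rewrite (cint_plus (fun t => / 2 * A (1 + m)%Z t) (fun t => / 2 * A (-1 + m)%Z t)) by auto.
      rewrite !(cint_scal _ (A _)) by apply HG. unfold A. rewrite !IHn. ring.
    + intro t. unfold A, K. rewrite <- (em_add 1 m), <- (em_add (-1) m), Cpow_S.
      generalize ((b + / 2 * (em 1 (t, 0%R) + em (-1) (t, 0%R))) ^ n). intro v. ring.
Qed.
Lemma em_real m (x : R) : em m (x, 0%R) = RtoC (cos (2 * PI * IZR m * x)) + Ci * RtoC (sin (2 * PI * IZR m * x)).
Proof.
  unfold em. replace (2 * PI * Ci * IZR m * (x, 0%R)) with ((0, 2 * PI * IZR m * x)%R : C) by (apply C_ext; simpl; ring).
  unfold cexp; simpl Re; simpl Im. rewrite exp_0. ring.
Qed.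
Lemma em_kernel (x : R) : / 2 * (em 1 (x, 0%R) + em (-1) (x, 0%R)) = RtoC (cos (2 * PI * x)).
Proof.
  rewrite !em_real. replace (2 * PI * IZR (-1) * x)%R with (- (2 * PI * x))%R by (simpl; ring).
  replace (2 * PI * IZR 1 * x)%R with (2 * PI * x)%R by (simpl; ring).
  rewrite cos_neg, sin_neg, RtoC_opp. field.
Qed.

Lemma cos_2PI_decr u v : (0 <= u)%R -> (u <= v)%R -> (v <= / 2)%R -> (cos (2 * PI * v) <= cos (2 * PI * u))%R.
Proof.
  intros H1 H2 H3. pose proof PI_RGT_0 as Hpi.
  assert (K1 : (0 <= PI * u)%R) by (apply Rmult_le_pos; lra).
  assert (K2 : (PI * u <= PI * v)%R) by (apply Rmult_le_compat_l; lra).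
  assert (K3 : (PI * v <= PI * / 2)%R) by (apply Rmult_le_compat_l; lra).
  apply cos_decr_1; lra.
Qed.
(** With [b = 1 - cos (2 pi d)] the kernel [b + cos (2 pi t)] is at least 1 for [|t| <= d], exceeds
    [1 + kap] for [|t| <= d / 2], and is at most 1 in absolute value elsewhere in the period. Where
    it is large [phi] is positive, and by the Bernoulli inequality the central part of the integral
    grows at least linearly in [n], while the rest is bounded below. *)
Lemma peaked_kernel (phi : R -> R) : (forall t, continuous phi t) -> (0 < phi 0)%R ->
  exists b n, (0 < RInt (fun t => phi t * (b + cos (2 * PI * t)) ^ n) (- / 2) (/ 2))%R.
Proof.
  intros Hc H0.
  assert (He : (0 < phi 0 / 2)%R) by lra.
  destruct (proj1 (filterlim_locally phi (phi 0)) (Hc 0%R) (mkposreal _ He)) as [d0 Hd0].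
  set (d := Rmin (d0 / 2) (/ 4)).
  assert (Hdp : (0 < d)%R) by (apply Rmin_pos; [destruct d0; simpl; lra|lra]).
  assert (Hd4 : (d <= / 4)%R) by apply Rmin_r.
  assert (Hphi : forall t, (Rabs t <= d)%R -> (phi 0 / 2 < phi t)%R).
  { intros t Ht. assert (Hb : ball 0%R d0 t).
    { change (Rabs (t - 0) < d0)%R. rewrite Rminus_0_r. eapply Rle_lt_trans; [exact Ht|].
      unfold d. pose proof (Rmin_l (d0 / 2) (/ 4)). pose proof (cond_pos d0). lra. }
    apply Hd0 in Hb. change (Rabs (phi t - phi 0) < phi 0 / 2)%R in Hb. apply Rabs_def2 in Hb. lra. }
  destruct (continuity_ab_maj (fun t => Rabs (phi t)) (- / 2) (/ 2) ltac:(lra)) as [xm [Hxm _]].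
  { intros c _. apply continuity_pt_filterlim. apply (continuous_comp phi Rabs c (Hc c)). apply continuous_Rabs. }
  set (P := Rabs (phi xm)) in *.
  set (b := (1 - cos (2 * PI * d))%R).
  set (kap := (cos (PI * d) - cos (2 * PI * d))%R).
  pose proof PI_RGT_0 as Hpi.
  assert (Hk : (0 < kap)%R).
  { unfold kap. apply Rlt_0_minus. assert (0 < PI * d)%R by (apply Rmult_lt_0_compat; lra).
    assert (PI * d <= PI * / 4)%R by (apply Rmult_le_compat_l; lra). apply cos_decreasing_1; lra. }
  assert (Hcos : forall t, cos (2 * PI * t) = cos (2 * PI * Rabs t)).
  { intro t. unfold Rabs. destruct (Rcase_abs t); auto. rewrite <- cos_neg. f_equal. ring. }
  assert (Kin : forall t, (Rabs t <= d)%R -> (1 <= b + cos (2 * PI * t))%R).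
  { intros t Ht. unfold b. rewrite (Hcos t). pose proof (Rabs_pos t).
    assert (cos (2 * PI * d) <= cos (2 * PI * Rabs t))%R; [|lra]. apply cos_2PI_decr; lra. }
  assert (Kin2 : forall t, (Rabs t <= d / 2)%R -> (1 + kap <= b + cos (2 * PI * t))%R).
  { intros t Ht. unfold b, kap. rewrite (Hcos t). pose proof (Rabs_pos t).
    assert (cos (PI * d) <= cos (2 * PI * Rabs t))%R; [|lra]. replace (PI * d)%R with (2 * PI * (d / 2))%R by field. apply cos_2PI_decr; lra. }
  assert (Kout : forall t, (d <= Rabs t <= / 2)%R -> (Rabs (b + cos (2 * PI * t)) <= 1)%R).
  { intros t Ht. unfold b. rewrite (Hcos t).
    assert (cos (2 * PI * Rabs t) <= cos (2 * PI * d))%R by (apply cos_2PI_decr; lra).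
    assert (0 <= cos (2 * PI * d))%R by (assert (0 < PI * d)%R by (apply Rmult_lt_0_compat; lra);
      assert (PI * d <= PI * / 4)%R by (apply Rmult_le_compat_l; lra); apply cos_ge_0; lra).
    pose proof (COS_bound (2 * PI * Rabs t)). pose proof (COS_bound (2 * PI * d)). apply Rabs_le. lra. }
  exists b.
  (* [P] bounds [|phi|]; the central interval has length [d], the rest of the period less than 1. *)
  destruct (INR_unbounded (P / (phi 0 / 2 * d * kap))) as [n Hn]. exists n.
  set (F := fun t => (phi t * (b + cos (2 * PI * t)) ^ n)%R).
  assert (HF : forall t, continuous F t).
  { intro t. apply ctn_Rmult; auto. apply (ex_derive_continuous (fun t => ((b + cos (2 * PI * t)) ^ n)%R)).
    auto_derive; auto. }
  assert (Hout : forall t, (Rabs t <= / 2)%R -> (- P <= F t)%R).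
  { intros t Ht. unfold F. destruct (Rle_lt_dec (Rabs t) d) as [L|L].
    - specialize (Hphi t L). specialize (Kin t L).
      assert (0 <= (b + cos (2 * PI * t)) ^ n)%R by (apply pow_le; lra).
      assert (0 <= P)%R by apply Rabs_pos. nra.
    - assert (HA : (Rabs (phi t * (b + cos (2 * PI * t)) ^ n) <= P)%R).
      { rewrite Rabs_mult, <- RPow_abs. 
        assert (Rabs (b + cos (2 * PI * t)) ^ n <= 1)%R.
        { rewrite <- (pow1 n). apply pow_incr. split; [apply Rabs_pos|apply Kout; lra]. }
        assert (Rabs (phi t) <= P)%R. { apply Hxm. apply Rabs_le_between in Ht. lra. }
        pose proof (Rabs_pos (phi t)). assert (0 <= Rabs (b + cos (2 * PI * t)) ^ n)%R by (apply pow_le, Rabs_pos). nra. }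
      apply Rabs_le_between in HA. lra. }
  assert (Hin : forall t, (Rabs t <= d / 2)%R -> (phi 0 / 2 * (1 + INR n * kap) <= F t)%R).
  { intros t Ht. unfold F. specialize (Kin2 t Ht). specialize (Hphi t ltac:(lra)).
    assert (1 + INR n * kap <= (b + cos (2 * PI * t)) ^ n)%R.
    { eapply Rle_trans; [apply Rle_pow_lin; lra|]. apply pow_incr. lra. }
    pose proof (pos_INR n). assert (0 <= INR n * kap)%R by nra. nra. }
  assert (Hlow : forall u v m, (u <= v)%R -> (forall t, (u < t < v)%R -> (m <= F t)%R) -> (m * (v - u) <= RInt F u v)%R).
  { intros u v m Huv Hm.
    replace (m * (v - u))%R with (RInt (fun _ => m) u v).
    2:{ rewrite RInt_const. unfold scal; simpl; unfold mult; simpl; ring. }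
    apply RInt_le; auto; [apply (ex_RInt_const (V:=R_NormedModule))|now apply rcont_ex]. }
  rewrite <- (RInt_Chasles F (- / 2) (d / 2) (/ 2)) by (now apply rcont_ex).
  rewrite <- (RInt_Chasles F (- / 2) (- (d / 2)) (d / 2)) by (now apply rcont_ex).
  pose proof (Hlow (- / 2) (- (d / 2)) (- P) ltac:(lra) ltac:(intros; apply Hout, Rabs_le; lra))%R as L1.
  pose proof (Hlow (d / 2) (/ 2) (- P) ltac:(lra) ltac:(intros; apply Hout, Rabs_le; lra))%R as L3.
  pose proof (Hlow (- (d / 2)) (d / 2) (phi 0 / 2 * (1 + INR n * kap)) ltac:(lra) ltac:(intros; apply Hin, Rabs_le; lra))%R as L2.
  unfold plus; simpl.
  assert (HP : (0 <= P)%R) by apply Rabs_pos.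
  assert (Hx : (0 < phi 0 / 2 * d * kap)%R) by (repeat apply Rmult_lt_0_compat; lra).
  apply (Rmult_lt_compat_r (phi 0 / 2 * d * kap)) in Hn; auto.
  unfold Rdiv at 1 in Hn. rewrite Rmult_assoc, Rinv_l, Rmult_1_r in Hn by lra.
  assert (0 < phi 0 / 2 * d)%R by nra.
  assert (0 <= P * d)%R by nra. nra.
Qed.

(** If [g 0] were nonzero, the real part of [conj (g 0) * g] would be positive at 0 and yet
    orthogonal to all powers of the peaked kernel. *)
Lemma fourier_unique_0 (g : R -> C) : ccont g -> (forall t, g (t + 1)%R = g t) ->
  (forall m, cint (fun t => g t * em m (t, 0%R)) 0 1 = 0) -> g 0%R = 0.
Proof.
  intros Hg Hp H.
  destruct (Ceq_dec (g 0%R) 0) as [|Hn]; auto. exfalso.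
  set (phi := fun t => Re (Cconj (g 0%R) * g t)).
  assert (Hgc : ccont (fun t => Cconj (g 0%R) * g t)) by cont.
  assert (Hphi : forall t, continuous phi t). { intro t. apply ctn_Re, Hgc. }
  destruct (peaked_kernel phi Hphi) as (b & n & Hbn).
  { unfold phi. rewrite Cmult_comm, <- Cmod2_conj. simpl. apply Cmod_gt_0 in Hn. nra. }
  pose proof (annihilate_pow g b n Hg H 0%Z) as E.
  set (G := fun t => (g t * (b + / 2 * (em 1 (t, 0%R) + em (-1) (t, 0%R))) ^ n)) in *.
  assert (HK : ccont (fun t => b + / 2 * (em 1 (t, 0%R) + em (-1) (t, 0%R)))).
  { cont. }
  assert (HG : ccont G).
  { apply ccont_mult; auto. clear - HK. induction n; simpl; [apply ccont_const|]. now apply ccont_mult. }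
  assert (E1 : cint G 0 1 = 0).
  { rewrite <- E. apply cint_ext. intro t. unfold G. rewrite em_0. ring. }
  assert (HGp : forall t, G (t + 1)%R = G t).
  { intro t. unfold G. rewrite Hp. replace ((t + 1)%R, 0%R) with (((t, 0%R) : C) + 1) by (apply C_ext; simpl; ring).
    now rewrite !em_periodic. }
  rewrite <- (cint_periodic G (- / 2)) in E1; auto. rewrite cint_shift in E1; auto.
  replace (0 + - / 2)%R with (- / 2)%R in E1 by ring. replace (1 + - / 2)%R with (/ 2)%R in E1 by field.
  assert (E2 : cint (fun t => Cconj (g 0%R) * G t) (- / 2) (/ 2) = 0) by (rewrite cint_scal, E1; auto; ring).
  assert (E3 : RInt (fun t => Re (Cconj (g 0%R) * G t)) (- / 2) (/ 2) = 0%R).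
  { apply (f_equal Re) in E2. rewrite cint_parts in E2 by cont. exact E2. }
  rewrite (RInt_ext _ (fun t => phi t * (b + cos (2 * PI * t)) ^ n)%R) in E3; [lra|].
  intros t _. unfold G, phi. rewrite em_kernel, <- RtoC_plus, <- RtoC_pow, <- re_scal_r. apply (f_equal Re). ring.
Qed.
Lemma fourier_unique (g : R -> C) : ccont g -> (forall t, g (t + 1)%R = g t) ->
  (forall m, cint (fun t => g t * em m (t, 0%R)) 0 1 = 0) -> forall t, g t = 0.
Proof.
  intros Hg Hp H t0.
  rewrite <- (Rplus_0_l t0). apply (fourier_unique_0 (fun t => g (t + t0)%R)).
  - cont.
  - intro t. replace (t + 1 + t0)%R with (t + t0 + 1)%R by ring. apply Hp.
  - intro m.
    rewrite (cint_ext _ (fun t => em m (RtoC (- t0)) * (g (t + t0)%R * em m ((t + t0)%R, 0%R)))).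
    + rewrite cint_scal.
      * rewrite (cint_periodic (fun t => g t * em m (t, 0%R))), H; [ring| |].
        -- cont.
        -- intro t. rewrite Hp. f_equal. rewrite <- (em_periodic m (t, 0%R)). f_equal. apply C_ext; simpl; ring.
      * cont.
    + intro t. replace (em m (t, 0%R)) with (em m (((t + t0)%R, 0%R) + RtoC (- t0))).
      rewrite em_plus. ring. f_equal. apply C_ext; simpl; ring.
Qed.
Lemma fcoef_unique (f : C -> C) y : (forall z, continuous f z) -> (forall z, f (z + 1) = f z) ->
  (forall m, fcoef m f y = 0) -> forall x, f (x, y) = 0.
Proof.
  intros Hc Hp H. apply (fourier_unique (fun x => f (x, y))).
  - cont.
  - intro t. rewrite <- (Hp (t, y)). f_equal. apply C_ext; simpl; ring.
  - intro m. rewrite (cint_ext _ (fun t => em m (0%R, - y)%R * (f (t, y) * em (- - m) (t, y)))).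
    + rewrite cint_scal by cont. fold (fcoef (- m) f y). rewrite H. ring.
    + intro t. rewrite Z.opp_involutive. replace (em m (t, 0%R)) with (em m ((0, - y)%R + (t, y))).
      rewrite em_plus. ring. f_equal. apply C_ext; simpl; ring.
Qed.

(** * Fourier series with rapidly decreasing coefficients *)

(** Decay faster than every exponential in [n]; it ensures convergence on all of C and survives
    differentiation. *)
Definition rapid (a : Z -> C) : Prop :=
  forall B : R, exists M, zdom M (fun n => a n * RtoC (exp (B * Rabs (IZR n)))).
Definition fser (k j : Z) (a : Z -> C) (z : C) : C := ZSeries (fun n => a n * em (k * n + j) z).

Lemma exp_le x y : (x <= y)%R -> (exp x <= exp y)%R.
Proof. intros [H| ->]; [left; now apply exp_increasing|right; auto]. Qed.
Lemma rapid_gauss a A B c : (0 < c)%R ->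
  (forall n, (Cmod (a n) <= exp (A + B * Rabs (IZR n) - c * IZR n ^ 2))%R) -> rapid a.
Proof.
  intros Hc H B'. destruct (gauss_dom A (B + B') c Hc) as (M & HM & K). exists M. intro n.
  rewrite Cmod_mult, Cmod_R, (Rabs_right (exp _)) by (left; apply exp_pos).
  eapply Rle_trans; [apply Rmult_le_compat_r; [left; apply exp_pos|apply H]|].
  rewrite <- exp_plus. apply K. lra.
Qed.
Lemma rapid_mult a c A B : rapid a -> (forall n, (Cmod (c n) <= exp (A + B * Rabs (IZR n)))%R) ->
  rapid (fun n => c n * a n).
Proof.
  intros Ha Hc B'. destruct (Ha (B + B')%R) as [M HM]. exists (exp A * M)%R. intro n.
  pose proof (HM n) as K. cbv beta in K. rewrite !Cmod_mult, !Cmod_R, !(Rabs_right (exp _)) in * by (left; apply exp_pos).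
  rewrite Rmult_plus_distr_r, exp_plus in K. pose proof (Hc n) as L. rewrite exp_plus in L.
  pose proof (Cmod_ge_0 (a n)). pose proof (exp_pos (B' * Rabs (IZR n))). pose proof (exp_pos A).
  assert (Cmod (c n) * Cmod (a n) * exp (B' * Rabs (IZR n)) <=
    exp A * exp (B * Rabs (IZR n)) * Cmod (a n) * exp (B' * Rabs (IZR n)))%R.
  { apply Rmult_le_compat_r; [lra|]. now apply Rmult_le_compat_r. }
  assert (exp A * (Cmod (a n) * (exp (B * Rabs (IZR n)) * exp (B' * Rabs (IZR n)))) <= exp A * (M * (/ 2) ^ Z.abs_nat n))%R.
  { apply Rmult_le_compat_l; lra. }
  lra.
Qed.
Lemma Rabs_freq k j n : (Rabs (IZR (k * n + j)) <= Rabs (IZR j) + Rabs (IZR k) * Rabs (IZR n))%R.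
Proof.
  rewrite plus_IZR, mult_IZR, <- Rabs_mult. eapply Rle_trans; [apply Rabs_triang|]. lra.
Qed.
Lemma em_bound k j n z r : (Rabs (Im z) <= r)%R ->
  (Cmod (em (k * n + j) z) <= exp (2 * PI * r * Rabs (IZR j) + 2 * PI * r * Rabs (IZR k) * Rabs (IZR n)))%R.
Proof.
  intro H. rewrite Cmod_em. apply exp_le.
  pose proof (Rabs_freq k j n) as F. pose proof PI_RGT_0. pose proof (Rabs_pos (IZR (k * n + j))). pose proof (Rabs_pos (Im z)).
  assert (E : (- (2 * PI * IZR (k * n + j) * Im z) <= 2 * PI * (Rabs (IZR (k * n + j)) * Rabs (Im z)))%R).
  { rewrite <- Rabs_mult. pose proof (Rle_abs (- (IZR (k * n + j) * Im z))) as K. rewrite Rabs_Ropp in K. nra. }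
  eapply Rle_trans; [exact E|].
  replace (2 * PI * r * Rabs (IZR j) + 2 * PI * r * Rabs (IZR k) * Rabs (IZR n))%R
   with (2 * PI * ((Rabs (IZR j) + Rabs (IZR k) * Rabs (IZR n)) * r))%R by ring.
  apply Rmult_le_compat_l; [lra|]. apply Rmult_le_compat; lra.
Qed.
Lemma c2pi_bound k j n : (Cmod (c2pi (k * n + j)) <= exp (2 * PI * Rabs (IZR j) + 2 * PI * Rabs (IZR k) * Rabs (IZR n)))%R.
Proof.
  unfold c2pi. rewrite !Cmod_mult, Cmod_Ci, !Cmod_R, (Rabs_right 2), (Rabs_right PI) by (pose proof PI_RGT_0; lra).
  pose proof PI_RGT_0. pose proof (Rabs_freq k j n).
  assert (2 * PI * 1 * Rabs (IZR (k * n + j)) <= 2 * PI * Rabs (IZR j) + 2 * PI * Rabs (IZR k) * Rabs (IZR n))%R.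
  { replace (2 * PI * Rabs (IZR j) + 2 * PI * Rabs (IZR k) * Rabs (IZR n))%R with (2 * PI * (Rabs (IZR j) + Rabs (IZR k) * Rabs (IZR n)))%R by ring.
    rewrite Rmult_1_r. apply Rmult_le_compat_l; lra. }
  eapply Rle_trans; [eassumption|]. 
  match goal with |- (?x <= exp ?x)%R => pose proof (exp_ineq1_le x); lra end.
Qed.

Lemma fser_dom k j a r : rapid a -> exists M, forall z, (Rabs (Im z) <= r)%R -> zdom M (fun n => a n * em (k * n + j) z).
Proof.
  intro Ha. destruct (Ha (2 * PI * r * Rabs (IZR k))%R) as [M HM].
  exists (exp (2 * PI * r * Rabs (IZR j)) * M)%R. intros z Hz n. rewrite Cmod_mult.
  pose proof (HM n) as K. cbv beta in K. rewrite Cmod_mult, Cmod_R, Rabs_right in K by (left; apply exp_pos).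
  eapply Rle_trans; [apply Rmult_le_compat_l; [apply Cmod_ge_0|apply (em_bound k j n z r Hz)]|].
  rewrite exp_plus. pose proof (exp_pos (2 * PI * r * Rabs (IZR j))).
  rewrite (Rmult_assoc (exp _) M). 
  replace (Cmod (a n) * (exp (2 * PI * r * Rabs (IZR j)) * exp (2 * PI * r * Rabs (IZR k) * Rabs (IZR n))))%R
   with (exp (2 * PI * r * Rabs (IZR j)) * (Cmod (a n) * exp (2 * PI * r * Rabs (IZR k) * Rabs (IZR n))))%R by ring.
  apply Rmult_le_compat_l; lra.
Qed.
Lemma fser_dom1 k j a z : rapid a -> exists M, zdom M (fun n => a n * em (k * n + j) z).
Proof. intro Ha. destruct (fser_dom k j a (Rabs (Im z)) Ha) as [M HM]. exists M. apply HM. lra. Qed.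

Lemma Im_ball (z w : C) e : ball (M := C_UniformSpace) z e w -> (Rabs (Im w) <= Rabs (Im z) + e)%R.
Proof.
  intros [_ H]. change (Rabs (snd w - snd z) < e)%R in H.
  replace (Im w) with (Im z + (snd w - snd z))%R by (destruct w, z; simpl; ring).
  eapply Rle_trans; [apply Rabs_triang|]. lra.
Qed.
Lemma fser_cont k j a z : rapid a -> continuous (fser k j a) z.
Proof.
  intro Ha. destruct (fser_dom k j a (Rabs (Im z) + 1) Ha) as [M HM].
  apply (zs_cont (fun n z => a n * em (k * n + j) z) z M).
  - exists (mkposreal 1 Rlt_0_1). intros w Hw. apply HM. now apply (Im_ball z w 1).
  - intro n. apply ctn_mult; [apply continuous_const|apply em_cont].
Qed.
#[export] Hint Resolve fser_cont : cont.
(** The coefficients of the termwise derivative. *)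
Definition dcoef (k j : Z) (a : Z -> C) (n : Z) : C := c2pi (k * n + j) * a n.
Lemma rapid_dcoef k j a : rapid a -> rapid (dcoef k j a).
Proof. intro H. apply (rapid_mult a _ _ _ H (c2pi_bound k j)). Qed.

Lemma fser_dR k j a z : rapid a -> cderiv (fun s => fser k j a (s, Im z)) (Re z) (fser k j (dcoef k j a) z).
Proof.
  intro Ha. unfold fser.
  replace (ZSeries (fun n => dcoef k j a n * em (k * n + j) z)) with
    (ZSeries (fun n => dcoef k j a n * em (k * n + j) (Re z, Im z))) by now rewrite pair_eta.
  apply (zs_deriv (fun n s => a n * em (k * n + j) (s, Im z)) (fun n s => dcoef k j a n * em (k * n + j) (s, Im z))).
  - intros n t. eapply cderiv_eq; [apply cderiv_scal, (em_dR _ (t, Im z))|]. unfold dcoef. simpl Im. ring.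
  - intro n. apply ccont_mult; [apply ccont_const|apply em_slice].
  - intro r. destruct (fser_dom k j a (Rabs (Im z)) Ha) as [M1 H1].
    destruct (fser_dom k j (dcoef k j a) (Rabs (Im z)) (rapid_dcoef k j a Ha)) as [M2 H2].
    exists (Rmax M1 M2). intros t _. split; [eapply zdom_le; [apply Rmax_l|apply H1]|eapply zdom_le; [apply Rmax_r|apply H2]]; simpl; lra.
Qed.
Lemma fser_dI k j a z : rapid a -> cderiv (fun s => fser k j a (Re z, s)) (Im z) (Ci * fser k j (dcoef k j a) z).
Proof.
  intro Ha. pose proof (rapid_dcoef k j a Ha) as Ha'. unfold fser.
  destruct (fser_dom1 k j _ z Ha') as [M0 H0]. rewrite <- (zs_scal M0) by exact H0.
  replace (ZSeries (fun n => Ci * (dcoef k j a n * em (k * n + j) z))) with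
    (ZSeries (fun n => Ci * (dcoef k j a n * em (k * n + j) (Re z, Im z)))) by now rewrite pair_eta.
  apply (zs_deriv (fun n s => a n * em (k * n + j) (Re z, s)) (fun n s => Ci * (dcoef k j a n * em (k * n + j) (Re z, s)))).
  - intros n t. eapply cderiv_eq; [apply cderiv_scal, (em_dI _ (Re z, t))|]. unfold dcoef. simpl Re. ring.
  - intros n. apply ccont_mult; [apply ccont_const|]. apply ccont_mult; [apply ccont_const|apply vslice_ccont, em_cont].
  - intro r. destruct (fser_dom k j a (Rabs (Im z) + r) Ha) as [M1 H1].
    destruct (fser_dom k j (dcoef k j a) (Rabs (Im z) + r) Ha') as [M2 H2].
    exists (Rmax M1 M2). intros t Ht.
    assert (Ht2 : (Rabs t <= Rabs (Im z) + r)%R).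
    { replace t with (Im z + (t - Im z))%R by ring. eapply Rle_trans; [apply Rabs_triang|]. lra. }
    split; [eapply zdom_le; [apply Rmax_l|apply H1; exact Ht2]|].
    apply (zdom_le M2); [apply Rmax_r|]. intro n. rewrite Cmod_mult, Cmod_Ci, Rmult_1_l. apply H2. exact Ht2.
Qed.
(** Series with rapidly decreasing coefficients are closed under both partial derivatives. *)
Lemma Cn_fser p k j : forall a, rapid a -> Cn p (fser k j a).
Proof.
  induction p; intros a Ha; [intro z; now apply fser_cont|].
  apply (Cn_intro p _ (fser k j (dcoef k j a)) (fun z => Ci * fser k j (dcoef k j a) z)).
  - intro; now apply fser_cont. - intro; now apply fser_dR. - intro; now apply fser_dI.
  - apply IHp; now apply rapid_dcoef.
  - apply Cn_scal, IHp; now apply rapid_dcoef.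
Qed.
Lemma smooth_fser k j a : rapid a -> smooth (fser k j a).
Proof. intros H p. now apply Cn_fser. Qed.
Lemma dbar_fser k j a z : rapid a -> dbar (fser k j a) z = 0.
Proof.
  intro Ha. rewrite (dbar_intro _ _ _ _ (fser_dR k j a z Ha) (fser_dI k j a z Ha)).
  unfold Cdiv. replace (fser k j (dcoef k j a) z + Ci * (Ci * fser k j (dcoef k j a) z)) with (fser k j (dcoef k j a) z + (Ci * Ci) * fser k j (dcoef k j a) z) by ring.
  replace (Ci * Ci) with (- (1)) by (apply C_ext; simpl; ring). ring.
Qed.
Lemma entire_fser k j a : rapid a -> entire (fser k j a).
Proof. intro H. apply CR_entire; [now apply Cn_fser|]. intro; now apply dbar_fser. Qed.
Lemma fser_periodic k j a z : fser k j a (z + 1) = fser k j a z.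
Proof. apply zs_ext. intro n. now rewrite em_periodic. Qed.

Lemma fcoef_fser m k j a y : rapid a ->
  fcoef m (fser k j a) y = ZSeries (fun n => a n * (if Z.eqb (k * n + j - m) 0 then 1 else 0)).
Proof.
  intro Ha. unfold fcoef, fser.
  destruct (fser_dom k j a (Rabs y) Ha) as [M HM].
  pose proof (Cmod_ge_0 (em (- m) (0%R, y))) as H0.
  assert (Hm : forall t, Cmod (em (- m) (t, y)) = Cmod (em (- m) (0%R, y))) by (intro; rewrite !Cmod_em; reflexivity).
  assert (Hd : forall t, zdom (M * Cmod (em (- m) (0%R, y))) (fun n => a n * em (k * n + j - m) (t, y))).
  { intros t n. replace (k * n + j - m)%Z with ((k * n + j) + - m)%Z by ring. rewrite <- em_add, Cmult_assoc, Cmod_mult, Hm.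
    pose proof (HM (t, y) ltac:(simpl; lra) n). cbv beta in H.
    replace (M * Cmod (em (- m) (0%R, y)) * (/ 2) ^ Z.abs_nat n)%R with (M * (/ 2) ^ Z.abs_nat n * Cmod (em (- m) (0%R, y)))%R by ring.
    now apply Rmult_le_compat_r. }
  assert (E : forall t, ZSeries (fun n => a n * em (k * n + j) (t, y)) * em (- m) (t, y) = ZSeries (fun n => a n * em (k * n + j - m) (t, y))).
  { intro t. rewrite Cmult_comm, <- (zs_scal M) by (apply HM; simpl; lra). apply zs_ext. intro n.
    replace (k * n + j - m)%Z with (- m + (k * n + j))%Z by ring. rewrite <- (em_add (- m) (k * n + j)). ring. }
  rewrite (cint_ext _ _ _ _ E).
  assert (Hc : ccont (fun t => ZSeries (fun n => a n * em (k * n + j - m) (t, y)))).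
  { apply (ccont_ext _ _ E). apply ccont_mult; [|apply em_slice].
    apply (hslice_ccont (fser k j a)). intro; now apply fser_cont. }
  destruct (zs_int (fun n t => a n * em (k * n + j - m) (t, y)) 0 1 _ (fun n => ccont_mult _ _ (ccont_const _) (em_slice _ y)) Hc (fun t _ => Hd t)) as [_ E2].
  rewrite E2. apply zs_ext. intro n. rewrite cint_scal by apply em_slice. now rewrite cint_em.
Qed.
Lemma fcoef_fser_in n0 k j a y : k <> 0%Z -> rapid a -> fcoef (k * n0 + j) (fser k j a) y = a n0.
Proof.
  intros Hk Ha. rewrite fcoef_fser by auto. rewrite (zs_single (fun n => a n * (if Z.eqb (k * n + j - (k * n0 + j)) 0 then 1 else 0)) n0).
  - replace (k * n0 + j - (k * n0 + j))%Z with 0%Z by ring. simpl. ring.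
  - intros n Hn. replace (k * n + j - (k * n0 + j))%Z with (k * (n - n0))%Z by ring.
    destruct (Z.eqb_spec (k * (n - n0)) 0) as [E|E]; [|ring]. apply Z.mul_eq_0 in E. lia.
Qed.
Lemma fcoef_fser_out m k j a y : (forall n, k * n + j <> m)%Z -> rapid a -> fcoef m (fser k j a) y = 0.
Proof.
  intros Hm Ha. rewrite fcoef_fser by auto. transitivity (ZSeries (fun _ => 0)); [|apply zs_0]. apply zs_ext. intro n.
  destruct (Z.eqb_spec (k * n + j - m) 0) as [E|E]; [|ring]. specialize (Hm n). lia.
Qed.

(** * The Gaussian integral *)

Definition gauss_int (x : R) : R := RInt (fun v => exp (- v ^ 2)) 0 x.
Lemma gcont c t : continuous (fun v : R => exp (- (c * v ^ 2))) t.
Proof. apply (ex_derive_continuous (fun v => exp (- (c * v ^ 2)))). auto_derive; auto. Qed.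
Lemma gcont1 t : continuous (fun v : R => exp (- v ^ 2)) t.
Proof. apply (ex_derive_continuous (fun v => exp (- v ^ 2))). auto_derive; auto. Qed.
#[export] Hint Resolve gcont gcont1 : cont.
Lemma gauss_int_deriv x : is_derive gauss_int x (exp (- x ^ 2))%R.
Proof.
  apply (is_derive_RInt (fun v => exp (- v ^ 2)) gauss_int 0 x); [|apply gcont1].
  apply filter_forall. intro y. apply (RInt_correct (V:=R_CompleteNormedModule)). apply rcont_ex, gcont1.
Qed.
(** The companion of [gauss_int] in the classical evaluation of the Gaussian integral: the
    derivatives of the two terms in [gauss_int_square] cancel. *)
Definition laplace (x : R) : R := RInt (fun v => exp (- (x ^ 2 * (1 + v ^ 2))) / (1 + v ^ 2))%R 0 1.
(** Differentiate under the integral sign and substitute [v = x r]. *)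
Lemma laplace_deriv x : is_derive laplace x (- 2 * exp (- x ^ 2) * gauss_int x)%R.
Proof.
  set (F := fun z : C => (exp (- (Im z ^ 2 * (1 + Re z ^ 2))) / (1 + Re z ^ 2))%R).
  set (F' := fun z : C => (- 2 * exp (- Im z ^ 2) * (Im z * exp (- (Im z * Re z) ^ 2)))%R).
  assert (HRe : forall z : C_UniformSpace, continuous Re z) by (intros [a b]; apply continuous_fst).
  assert (HIm : forall z : C_UniformSpace, continuous Im z) by (intros [a b]; apply continuous_snd).
  assert (HRe2 : forall z : C_UniformSpace, continuous (fun z : C => (Re z ^ 2)%R) z).
  { intro z. apply (ctn_Rfun (fun t => (t ^ 2)%R)); auto. intro t; auto_derive; auto. }
  assert (HIm2 : forall z : C_UniformSpace, continuous (fun z : C => (Im z ^ 2)%R) z).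
  { intro z. apply (ctn_Rfun (fun t => (t ^ 2)%R)); auto. intro t; auto_derive; auto. }
  assert (E : is_derive (fun y => RInt (fun r => F (r, y)) 0 1) x (RInt (fun r => F' (r, x)) 0 1)).
  { apply rint_param_deriv; [lra| | |].
    - intro z. unfold F, Rdiv. apply ctn_Rmult.
      + apply ctn_exp, ctn_Ropp, ctn_Rmult; auto. apply ctn_Rplus; auto. apply continuous_const.
      + apply (ctn_Rfun (fun t => (/ (1 + t ^ 2))%R)); auto. intro t; auto_derive.
        pose proof (pow2_ge_0 t). simpl in *. lra.
    - intro z. unfold F'. apply ctn_Rmult; [apply ctn_Rmult; [apply continuous_const|]|].
      + apply ctn_exp, ctn_Ropp; auto.
      + apply ctn_Rmult; auto. apply ctn_exp, ctn_Ropp.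
        apply (ctn_Rfun (fun t => (t ^ 2)%R)). intro t; auto_derive; auto. now apply ctn_Rmult.
    - intros [r y]. unfold F, F'; simpl. auto_derive; [nra|].
      replace (- (y * r * (y * r * 1)))%R with (- (y ^ 2 * r ^ 2))%R by ring.
      replace (- (y * (y * 1) * (1 + r * (r * 1))))%R with (- y ^ 2 + - (y ^ 2 * r ^ 2))%R by ring.
      rewrite exp_plus. simpl. field. nra. }
  eapply is_derive_eq; [exact E|].
  unfold F'; cbn [Re Im fst snd].
  rewrite rscal.
  2:{ intro t. apply (ex_derive_continuous (fun r => (x * exp (- (x * r) ^ 2)))%R). auto_derive; auto. }
  f_equal.
  unfold gauss_int. pose proof (RInt_comp_lin (V:=R_CompleteNormedModule) (fun v => exp (- v ^ 2)) x 0 0 1) as K.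
  rewrite Rmult_0_r, Rmult_1_r, !Rplus_0_r in K. rewrite <- K by (apply rcont_ex, gcont1).
  apply RInt_ext. intros t _. unfold scal; simpl; unfold mult; simpl. rewrite Rplus_0_r. reflexivity.
Qed.
(** The left-hand side is constant, and at 0 it is the integral of [/ (1 + v ^ 2)], that is, [atan
    1]. *)
Lemma gauss_int_square x : (gauss_int x ^ 2 + laplace x = PI / 4)%R.
Proof.
  set (F := fun x => (gauss_int x ^ 2 + laplace x)%R).
  assert (HF : forall y, is_derive F y 0%R).
  { intro y. unfold F. eapply is_derive_eq.
    - apply (is_derive_plus (V:=R_NormedModule) (fun x => (gauss_int x ^ 2)%R) laplace).
      + apply (is_derive_pow gauss_int 2 y _ (gauss_int_deriv y)).
      + apply laplace_deriv.
    - unfold plus; simpl. ring. }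
  assert (E : F x = F 0%R).
  { destruct (MVT_gen F 0 x (fun _ => 0%R)) as (c & _ & Hc).
    - intros; apply HF.
    - intros; apply continuity_pt_filterlim. apply (ex_derive_continuous F). eexists; apply HF.
    - lra. }
  change (gauss_int x ^ 2 + laplace x)%R with (F x). rewrite E. unfold F, gauss_int, laplace.
  rewrite RInt_point.
  rewrite (RInt_ext _ (fun v => / (1 + v ^ 2))%R).
  2:{ intros v _. rewrite pow_i by lia. rewrite Rmult_0_l, Ropp_0, exp_0. match goal with |- @eq _ ?p ?q => change (@eq R p q) end. unfold Rdiv. ring. }
  rewrite (is_RInt_unique (V:=R_CompleteNormedModule) _ 0 1 (atan 1 - atan 0)%R).
  - rewrite atan_0, atan_1. unfold zero; simpl. lra.
  - apply (is_RInt_derive atan).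
    + intros v _. eapply is_derive_eq; [apply is_derive_atan|]. unfold Rsqr. f_equal; ring.
    + intros v _. apply (ex_derive_continuous (fun v => / (1 + v ^ 2))%R). auto_derive. nra.
Qed.
Lemma gauss_int_pos x : (0 <= x)%R -> (0 <= gauss_int x)%R.
Proof. intro H. apply RInt_ge_0; auto. apply rcont_ex, gcont1. intros; left; apply exp_pos. Qed.
(** In [gauss_int_square] the term [laplace x] lies between 0 and [exp (- x ^ 2)]. *)
Lemma gauss_int_tail x : (0 <= x)%R -> (Rabs (gauss_int x - sqrt PI / 2) <= 2 / sqrt PI * exp (- x ^ 2))%R.
Proof.
  intro H. pose proof (gauss_int_square x) as E. pose proof (gauss_int_pos x H) as Hp. pose proof PI_RGT_0 as Hpi.
  assert (Hs : (0 < sqrt PI)%R) by (now apply sqrt_lt_R0). pose proof (sqrt_sqrt PI ltac:(lra)) as Hss.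
  assert (Hc : forall t, continuous (fun v => exp (- (x ^ 2 * (1 + v ^ 2))) / (1 + v ^ 2))%R t).
  { intro t. apply (ex_derive_continuous (fun v => exp (- (x ^ 2 * (1 + v ^ 2))) / (1 + v ^ 2))%R). auto_derive. nra. }
  assert (HJ0 : (0 <= laplace x)%R).
  { apply RInt_ge_0; [lra|now apply rcont_ex|]. intros v _. left. apply Rdiv_lt_0_compat; [apply exp_pos|nra]. }
  assert (HJ1 : (laplace x <= exp (- x ^ 2))%R).
  { replace (exp (- x ^ 2)) with (RInt (fun _ => exp (- x ^ 2)) 0 1).
    2:{ rewrite RInt_const. unfold scal; simpl; unfold mult; simpl; ring. }
    apply RInt_le; [lra|now apply rcont_ex|apply (ex_RInt_const (V:=R_NormedModule))|]. intros v _.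
    pose proof (exp_pos (- (x ^ 2 * (1 + v ^ 2)))).
    assert (exp (- (x ^ 2 * (1 + v ^ 2))) <= exp (- x ^ 2))%R by (apply exp_le; nra).
    apply (Rmult_le_reg_r (1 + v ^ 2)); [nra|]. unfold Rdiv. rewrite Rmult_assoc, Rinv_l, Rmult_1_r by nra. nra. }
  assert (Hle : (gauss_int x <= sqrt PI / 2)%R).
  { apply Rsqr_incr_0_var; [unfold Rsqr|lra]. nra. }
  rewrite Rabs_left1 by lra.
  assert (HH : ((sqrt PI / 2 - gauss_int x) * (sqrt PI / 2) <= exp (- x ^ 2))%R) by nra.
  apply (Rmult_le_reg_r (sqrt PI / 2)); [lra|].
  replace (2 / sqrt PI * exp (- x ^ 2) * (sqrt PI / 2))%R with (exp (- x ^ 2)) by (field; lra). lra.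
Qed.

(** The odd primitive of the Gaussian [exp (- c v ^ 2)]; its limits at infinity are [ghalf c] and
    [- ghalf c]. *)
Definition gprim (c y : R) : R := RInt (fun v => exp (- (c * v ^ 2))) 0 y.
Definition ghalf (c : R) : R := (sqrt (PI / c) / 2)%R.
Lemma gprim_deriv c x : is_derive (gprim c) x (exp (- (c * x ^ 2))).
Proof.
  apply (is_derive_RInt (fun v => exp (- (c * v ^ 2))) (gprim c) 0 x); [|apply gcont].
  apply filter_forall. intro y. apply (RInt_correct (V:=R_CompleteNormedModule)). apply rcont_ex, gcont.
Qed.
Lemma gprim_odd c y : gprim c (- y) = (- gprim c y)%R.
Proof.
  unfold gprim. pose proof (RInt_comp_lin (V:=R_CompleteNormedModule) (fun v => exp (- (c * v ^ 2))) (-1) 0 0 y) as K.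
  replace (-1 * 0 + 0)%R with 0%R in K by ring. replace (-1 * y + 0)%R with (- y)%R in K by ring.
  rewrite <- K by (apply rcont_ex, gcont).
  rewrite <- (RInt_opp (V:=R_CompleteNormedModule)) by (apply rcont_ex, gcont). apply RInt_ext. intros t _.
  unfold scal, opp; simpl; unfold mult; simpl. replace (c * ((-1 * t + 0) * ((-1 * t + 0) * 1)))%R with (c * (t * (t * 1)))%R by ring. ring.
Qed.
Lemma gprim_gauss_int c y : (0 < c)%R -> gprim c y = (gauss_int (sqrt c * y) / sqrt c)%R.
Proof.
  intro Hc. assert (Hs : (0 < sqrt c)%R) by now apply sqrt_lt_R0.
  unfold gauss_int. pose proof (RInt_comp_lin (V:=R_CompleteNormedModule) (fun v => exp (- v ^ 2)) (sqrt c) 0 0 y) as K.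
  rewrite Rmult_0_r, !Rplus_0_r in K. rewrite <- K by (apply rcont_ex, gcont1).
  rewrite (RInt_ext _ (fun t => sqrt c * exp (- (c * t ^ 2)))%R).
  - rewrite rscal by apply gcont. change (gprim c y = (sqrt c * gprim c y / sqrt c)%R). generalize (gprim c y). intro G. field. lra.
  - intros t _. unfold scal; simpl; unfold mult; simpl. rewrite Rplus_0_r.
    replace (sqrt c * t * (sqrt c * t * 1))%R with (sqrt c * sqrt c * (t * (t * 1)))%R by ring. now rewrite sqrt_sqrt by lra.
Qed.
Lemma gprim_tail c : (0 < c)%R -> exists K, (0 < K)%R /\
  forall y, (0 <= y)%R -> (Rabs (gprim c y - ghalf c) <= K * exp (- (c * y ^ 2)))%R.
Proof.
  intro Hc. assert (Hs : (0 < sqrt c)%R) by now apply sqrt_lt_R0. pose proof PI_RGT_0 as Hpi.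
  assert (Hs2 : (0 < sqrt PI)%R) by now apply sqrt_lt_R0.
  exists (2 / sqrt PI / sqrt c)%R. split; [repeat apply Rdiv_lt_0_compat; lra|]. intros y Hy.
  rewrite gprim_gauss_int by auto. unfold ghalf. rewrite sqrt_div by lra.
  replace (gauss_int (sqrt c * y) / sqrt c - sqrt PI / sqrt c / 2)%R with (/ sqrt c * (gauss_int (sqrt c * y) - sqrt PI / 2))%R by (field; lra).
  rewrite Rabs_mult, (Rabs_right (/ sqrt c)) by (left; now apply Rinv_0_lt_compat).
  pose proof (gauss_int_tail (sqrt c * y) ltac:(nra)) as E.
  replace ((sqrt c * y) ^ 2)%R with (c * y ^ 2)%R in E.
  2:{ rewrite Rpow_mult_distr. now rewrite pow2_sqrt by lra. }
  replace (2 / sqrt PI / sqrt c * exp (- (c * y ^ 2)))%R with (/ sqrt c * (2 / sqrt PI * exp (- (c * y ^ 2))))%R by (field; lra).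
  apply Rmult_le_compat_l; auto. left; now apply Rinv_0_lt_compat.
Qed.

(** * Series of Gaussians and of their primitives *)

(** The Gaussians are [exp (- gauss_par t k * (s + n + j / k) ^ 2)] in the variable [s = Im z / t]. *)
Definition gauss_par (t : R) (k : Z) : R := (2 * PI * t * IZR k)%R.
Definition qshift (k j n : Z) : R := (IZR n + IZR j / IZR k)%R.
(** The limit of [gprim] at the end of the line towards which [s + n + j / k] goes, the integer [N]
    separating the two ends. *)
Definition step (t : R) (k N n : Z) : R := if (N <=? n)%Z then ghalf (gauss_par t k) else (- ghalf (gauss_par t k))%R.
(** A primitive of the Gaussian of index [n] whose constant of integration makes it small for large
    [n] of either sign. *)
Definition tail_prim (t : R) (k j N n : Z) (s : R) : R := (gprim (gauss_par t k) (s + qshift k j n) - step t k N n)%R.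
(** The growth of the inverses of theta coefficients; the Gaussians decay twice as fast. *)
Definition growth (t : R) (k : Z) (b : Z -> C) : Prop :=
  exists A B, forall n, (Cmod (b n) <= exp (A + B * Rabs (IZR n) + PI * t * IZR k * IZR n ^ 2))%R.
Definition gauss_term (t : R) (k j : Z) (b : Z -> C) (n : Z) (z : C) : C :=
  b n * em (- k * n + - j) z * RtoC (exp (- (gauss_par t k * (Im z / t + qshift k j n) ^ 2))).
Definition prim_term (t : R) (k j N : Z) (b : Z -> C) (n : Z) (z : C) : C :=
  b n * em (- k * n + - j) z * RtoC (tail_prim t k j N n (Im z / t)).
Definition gauss_series (t : R) (k j : Z) (b : Z -> C) (z : C) : C := ZSeries (fun n => gauss_term t k j b n z).
Definition prim_series (t : R) (k j N : Z) (b : Z -> C) (z : C) : C := ZSeries (fun n => prim_term t k j N b n z).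

Lemma gauss_par_pos t k : (0 < t)%R -> (0 < k)%Z -> (0 < gauss_par t k)%R.
Proof. intros Ht Hk. apply (IZR_lt 0) in Hk. pose proof PI_RGT_0. unfold gauss_par. apply Rmult_lt_0_compat; [apply Rmult_lt_0_compat|]; lra. Qed.
Lemma abs_prod_le (x y r : R) : (Rabs x <= r)%R -> (- (Rabs y * r) <= y * x <= Rabs y * r)%R.
Proof.
  intro H. assert (K : (Rabs (y * x) <= Rabs y * r)%R).
  { rewrite Rabs_mult. apply Rmult_le_compat_l; [apply Rabs_pos|auto]. }
  apply Rabs_le_between in K. lra.
Qed.

Lemma gauss_term_dom t k j b r : (0 < t)%R -> (0 < k)%Z -> growth t k b ->
  exists M, forall z, (Rabs (Im z) <= r)%R -> zdom M (fun n => gauss_term t k j b n z).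
Proof.
  intros Ht Hk (A & B & Hb). assert (Hc := gauss_par_pos t k Ht Hk).
  assert (Hk' := IZR_lt 0 k Hk).
  set (x0 := (r / t + Rabs (IZR j / IZR k))%R).
  destruct (gauss_dom (A + 2 * PI * r * Rabs (IZR (- j))) (B + 2 * PI * r * Rabs (IZR (- k)) + gauss_par t k * 2 * x0) (gauss_par t k / 2) ltac:(lra)) as (M & HM & G).
  exists M. intros z Hz n. unfold gauss_term. rewrite !Cmod_mult, Cmod_R, (Rabs_right (exp _)) by (left; apply exp_pos).
  pose proof (em_bound (- k) (- j) n z r Hz) as E. pose proof (Hb n) as Hbn.
  set (x := (Im z / t + IZR j / IZR k)%R).
  assert (Hx : (Rabs x <= x0)%R).
  { unfold x, x0. eapply Rle_trans; [apply Rabs_triang|]. apply Rplus_le_compat_r.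
    unfold Rdiv. rewrite Rabs_mult, (Rabs_right (/ t)) by (left; now apply Rinv_0_lt_compat).
    apply Rmult_le_compat_r; [left; now apply Rinv_0_lt_compat|auto]. }
  pose proof (abs_prod_le x (IZR n) x0 Hx) as Hnx.
  eapply Rle_trans; [apply Rmult_le_compat_r; [left; apply exp_pos|apply Rmult_le_compat; [apply Cmod_ge_0|apply Cmod_ge_0|exact Hbn|exact E]]|].
  rewrite <- !exp_plus. apply G. unfold qshift.
  replace (Im z / t + (IZR n + IZR j / IZR k))%R with (IZR n + x)%R by (unfold x; ring).
  replace (PI * t * IZR k)%R with (gauss_par t k / 2)%R by (unfold gauss_par; field).
  replace (gauss_par t k * (IZR n + x) ^ 2)%R with (gauss_par t k * IZR n ^ 2 + gauss_par t k * (2 * (IZR n * x) + x ^ 2))%R by ring.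
  assert (gauss_par t k * (2 * (IZR n * x) + x ^ 2) >= - (gauss_par t k * 2 * x0 * Rabs (IZR n)))%R.
  { pose proof (pow2_ge_0 x). assert (2 * (IZR n * x) + x ^ 2 >= - (2 * x0 * Rabs (IZR n)))%R by lra.
    replace (- (gauss_par t k * 2 * x0 * Rabs (IZR n)))%R with (gauss_par t k * - (2 * x0 * Rabs (IZR n)))%R by ring.
    apply Rmult_ge_compat_l; lra. }
  lra.
Qed.

(** Where [n] and [N] select the end of the line on which [s + n + j / k] lies, this is the
    Gaussian tail. In the remaining cases [s + n + j / k] is bounded by [X], and the constant [K1]
    compensates. *)
Lemma tail_prim_bound t k j N r : (0 < t)%R -> (0 < k)%Z -> exists K, (0 < K)%R /\
  forall n s, (Rabs s <= r)%R -> (Rabs (tail_prim t k j N n s) <= K * exp (- (gauss_par t k * (s + qshift k j n) ^ 2)))%R.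
Proof.
  intros Ht Hk. assert (Hc := gauss_par_pos t k Ht Hk). set (c := gauss_par t k) in *.
  destruct (gprim_tail c Hc) as (K0 & HK0 & HT).
  assert (Hh : (0 <= ghalf c)%R). { unfold ghalf. pose proof (sqrt_pos (PI / c)). lra. }
  assert (Hpos : forall y, (0 <= y)%R -> (Rabs (gprim c y) <= ghalf c + K0)%R).
  { intros y Hy. specialize (HT y Hy). assert (exp (- (c * y ^ 2)) <= 1)%R.
    { rewrite <- exp_0. apply exp_le. pose proof (pow2_ge_0 y). nra. }
    replace (gprim c y) with ((gprim c y - ghalf c) + ghalf c)%R by ring.
    eapply Rle_trans; [apply Rabs_triang|]. rewrite (Rabs_right (ghalf c)) by lra. nra. }
  assert (Hbd : forall y, (Rabs (gprim c y) <= ghalf c + K0)%R).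
  { intro y. destruct (Rle_lt_dec 0 y) as [L|L]; auto.
    replace y with (- - y)%R by ring. rewrite gprim_odd, Rabs_Ropp. apply Hpos. lra. }
  set (X := (Rabs r + Rabs (IZR N) + 1 + Rabs (IZR j / IZR k))%R).
  (* Chosen so that [K1 * exp (- (c * X ^ 2))] bounds [gprim] minus either limit. *)
  set (K1 := ((2 * ghalf c + K0) * exp (c * X ^ 2))%R).
  assert (HX : (0 <= X)%R).
  { unfold X. pose proof (Rabs_pos r). pose proof (Rabs_pos (IZR N)). pose proof (Rabs_pos (IZR j / IZR k)). lra. }
  assert (HK1 : (0 < K1)%R). { apply Rmult_lt_0_compat; [lra|apply exp_pos]. }
  exists (K0 + K1)%R. split; [lra|]. intros n s Hs.
  assert (Hwrong : forall y, (Rabs y <= X)%R -> (2 * ghalf c + K0 <= (K0 + K1) * exp (- (c * y ^ 2)))%R).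
  { intros y Hy. assert (E : (exp (- (c * X ^ 2)) <= exp (- (c * y ^ 2)))%R).
    { apply exp_le, Ropp_le_contravar, Rmult_le_compat_l; [lra|].
      replace (y ^ 2)%R with (Rabs y ^ 2)%R by (rewrite RPow_abs; apply Rabs_pos_eq, pow2_ge_0). apply pow_incr. split; [apply Rabs_pos|auto]. }
    assert (K1 * exp (- (c * X ^ 2)) = 2 * ghalf c + K0)%R.
    { unfold K1. rewrite Rmult_assoc, <- exp_plus. replace (c * X ^ 2 + - (c * X ^ 2))%R with 0%R by ring. rewrite exp_0. ring. }
    pose proof (exp_pos (- (c * y ^ 2))). nra. }
  assert (Hgood : forall y, (K0 * exp (- (c * y ^ 2)) <= (K0 + K1) * exp (- (c * y ^ 2)))%R).
  { intro y. pose proof (exp_pos (- (c * y ^ 2))). nra. }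
  assert (Hr : (Rabs s <= Rabs r)%R). { eapply Rle_trans; [exact Hs|apply Rle_abs]. }
  apply Rabs_le_between in Hr. 
  assert (HN1 : (- Rabs (IZR N) <= IZR N <= Rabs (IZR N))%R) by (apply Rabs_le_between; lra).
  assert (Hj1 : (- Rabs (IZR j / IZR k) <= IZR j / IZR k <= Rabs (IZR j / IZR k))%R) by (apply Rabs_le_between; lra).
  unfold tail_prim, step. fold c. destruct (Z.leb_spec N n) as [L|L].
  - apply IZR_le in L. destruct (Rle_lt_dec 0 (s + qshift k j n)) as [P|P].
    + eapply Rle_trans; [apply HT; exact P|apply Hgood].
    + eapply Rle_trans; [|apply Hwrong].
      * eapply Rle_trans; [apply Rabs_triang|]. rewrite Rabs_Ropp, (Rabs_right (ghalf c)) by lra. pose proof (Hbd (s + qshift k j n)%R). lra.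
      * unfold qshift in *. apply Rabs_le. unfold X in *. lra.
  - assert (L' : (n <= N - 1)%Z) by lia. apply IZR_le in L'. rewrite minus_IZR in L'. destruct (Rle_lt_dec (s + qshift k j n) 0) as [P|P].
    + replace (gprim c (s + qshift k j n)) with (- gprim c (- (s + qshift k j n)))%R by (rewrite gprim_odd; ring).
      replace (- gprim c (- (s + qshift k j n)) - - ghalf c)%R with (- (gprim c (- (s + qshift k j n)) - ghalf c))%R by ring.
      rewrite Rabs_Ropp. eapply Rle_trans; [apply HT; lra|].
      replace ((- (s + qshift k j n)) ^ 2)%R with ((s + qshift k j n) ^ 2)%R by ring. apply Hgood.
    + eapply Rle_trans; [|apply Hwrong].
      * eapply Rle_trans; [apply Rabs_triang|]. rewrite Ropp_involutive, (Rabs_right (ghalf c)) by lra. pose proof (Hbd (s + qshift k j n)%R). lra.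
      * unfold qshift in *. apply Rabs_le. unfold X in *. lra.
Qed.

Lemma prim_term_dom t k j N b r : (0 < t)%R -> (0 < k)%Z -> growth t k b ->
  exists M, forall z, (Rabs (Im z) <= r)%R -> zdom M (fun n => prim_term t k j N b n z).
Proof.
  intros Ht Hk Hb. destruct (gauss_term_dom t k j b r Ht Hk Hb) as [M HM].
  destruct (tail_prim_bound t k j N (r / t) Ht Hk) as (K & HK & HG).
  exists (K * M)%R. intros z Hz n. specialize (HM z Hz n). cbv beta in HM.
  assert (Hs : (Rabs (Im z / t) <= r / t)%R).
  { unfold Rdiv. rewrite Rabs_mult, (Rabs_right (/ t)) by (left; now apply Rinv_0_lt_compat).
    apply Rmult_le_compat_r; [left; now apply Rinv_0_lt_compat|auto]. }
  specialize (HG n _ Hs). unfold prim_term, gauss_term in *. rewrite !Cmod_mult, !Cmod_R, (Rabs_right (exp _)) in * by (left; apply exp_pos).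
  pose proof (Cmod_ge_0 (b n)). pose proof (Cmod_ge_0 (em (- k * n + - j) z)).
  assert (0 <= Cmod (b n) * Cmod (em (- k * n + - j) z))%R by now apply Rmult_le_pos.
  eapply Rle_trans; [apply Rmult_le_compat_l; [assumption|exact HG]|].
  rewrite (Rmult_assoc K M). eapply Rle_trans; [|apply Rmult_le_compat_l; [left; exact HK|exact HM]]. right. ring.
Qed.

Lemma Im_over_cont (t : R) (z : C_UniformSpace) : continuous (fun z : C => (Im z / t)%R) z.
Proof. apply ctn_Rmult; [destruct z as [a b]; apply continuous_snd|apply continuous_const]. Qed.
Lemma prim_term_cont t k j N b n z : continuous (prim_term t k j N b n) z.
Proof.
  apply ctn_mult; [apply ctn_mult; [apply continuous_const|apply em_cont]|]. apply ctn_RtoC.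
  apply (ctn_Rfun (tail_prim t k j N n)); [|apply Im_over_cont].
  intro s. unfold tail_prim. auto_derive. eexists; apply gprim_deriv.
Qed.
Lemma gauss_term_cont t k j b n z : continuous (gauss_term t k j b n) z.
Proof.
  apply ctn_mult; [apply ctn_mult; [apply continuous_const|apply em_cont]|]. apply ctn_RtoC.
  apply (ctn_Rfun (fun s => exp (- (gauss_par t k * (s + qshift k j n) ^ 2)))); [|apply Im_over_cont].
  intro s. auto_derive. auto.
Qed.
#[export] Hint Resolve prim_term_cont gauss_term_cont : cont.
Lemma prim_series_cont t k j N b z : (0 < t)%R -> (0 < k)%Z -> growth t k b -> continuous (prim_series t k j N b) z.
Proof.
  intros Ht Hk Hb. destruct (prim_term_dom t k j N b (Rabs (Im z) + 1) Ht Hk Hb) as [M HM].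
  apply (zs_cont (prim_term t k j N b) z M).
  - exists (mkposreal 1 Rlt_0_1). intros w Hw. apply HM. now apply (Im_ball z w 1).
  - cont.
Qed.

(** The coefficients of the derivative, the frequencies being [- (k n + j)]. *)
Definition dcoef_neg (k j : Z) (b : Z -> C) (n : Z) : C := c2pi (- k * n + - j) * b n.
Lemma growth_dcoef_neg t k j b : growth t k b -> growth t k (dcoef_neg k j b).
Proof.
  intros (A & B & Hb). exists (A + 2 * PI * Rabs (IZR (- j)))%R, (B + 2 * PI * Rabs (IZR (- k)))%R.
  intro n. unfold dcoef_neg. rewrite Cmod_mult.
  eapply Rle_trans; [apply Rmult_le_compat; [apply Cmod_ge_0|apply Cmod_ge_0|apply c2pi_bound|apply Hb]|].
  rewrite <- exp_plus. apply exp_le. right. ring.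
Qed.

Lemma prim_series_dR t k j N b z : (0 < t)%R -> (0 < k)%Z -> growth t k b ->
  cderiv (fun s => prim_series t k j N b (s, Im z)) (Re z) (prim_series t k j N (dcoef_neg k j b) z).
Proof.
  intros Ht Hk Hb. pose proof (growth_dcoef_neg t k j b Hb) as Hb'.
  replace (prim_series t k j N (dcoef_neg k j b) z) with (prim_series t k j N (dcoef_neg k j b) (Re z, Im z)) by now rewrite pair_eta.
  apply (zs_deriv (fun n s => prim_term t k j N b n (s, Im z)) (fun n s => prim_term t k j N (dcoef_neg k j b) n (s, Im z))).
  - intros n x. unfold prim_term. simpl Im.
    apply (cderiv_ext (fun s => (b n * RtoC (tail_prim t k j N n (Im z / t))) * em (- k * n + - j) (s, Im z))).
    { intro; ring. }
    eapply cderiv_eq; [apply cderiv_scal, (em_dR _ (x, Im z))|]. unfold dcoef_neg. simpl Im. ring.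
  - cont.
  - intro r. destruct (prim_term_dom t k j N b (Rabs (Im z)) Ht Hk Hb) as [M1 H1].
    destruct (prim_term_dom t k j N (dcoef_neg k j b) (Rabs (Im z)) Ht Hk Hb') as [M2 H2].
    exists (Rmax M1 M2). intros x _. split; [eapply zdom_le; [apply Rmax_l|apply H1]|eapply zdom_le; [apply Rmax_r|apply H2]]; simpl; lra.
Qed.
(** The derivative in [Im z] acts on the exponentials, and on the primitives, where it restores the
    Gaussians. *)
Lemma prim_series_dI t k j N b z : (0 < t)%R -> (0 < k)%Z -> growth t k b ->
  cderiv (fun s => prim_series t k j N b (Re z, s)) (Im z) (Ci * prim_series t k j N (dcoef_neg k j b) z + RtoC (/ t) * gauss_series t k j b z).
Proof.
  intros Ht Hk Hb. pose proof (growth_dcoef_neg t k j b Hb) as Hb'.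
  destruct (prim_term_dom t k j N (dcoef_neg k j b) (Rabs (Im z)) Ht Hk Hb') as [M1 H1].
  destruct (gauss_term_dom t k j b (Rabs (Im z)) Ht Hk Hb) as [M2 H2].
  assert (E : Ci * prim_series t k j N (dcoef_neg k j b) z + RtoC (/ t) * gauss_series t k j b z =
    ZSeries (fun n => Ci * prim_term t k j N (dcoef_neg k j b) n (Re z, Im z) + RtoC (/ t) * gauss_term t k j b n (Re z, Im z))).
  { rewrite pair_eta. specialize (H1 z ltac:(lra)). specialize (H2 z ltac:(lra)).
    rewrite (zs_plus _ _ _ _ (zdom_scal _ Ci _ H1) (zdom_scal _ (RtoC (/ t)) _ H2)).
    now rewrite (zs_scal _ _ _ H1), (zs_scal _ _ _ H2). }
  rewrite E.
  apply (zs_deriv (fun n s => prim_term t k j N b n (Re z, s)) (fun n s => Ci * prim_term t k j N (dcoef_neg k j b) n (Re z, s) + RtoC (/ t) * gauss_term t k j b n (Re z, s))).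
  - intros n x. unfold prim_term, gauss_term. simpl Im.
    apply (cderiv_ext (fun s => b n * (em (- k * n + - j) (Re z, s) * RtoC (tail_prim t k j N n (s / t))))).
    { intro; ring. }
    eapply cderiv_eq.
    + apply cderiv_scal, cderiv_mult; [apply (em_dI _ (Re z, x))|].
      apply (cderiv_RtoC (fun s => tail_prim t k j N n (s / t)) x (/ t * exp (- (gauss_par t k * (x / t + qshift k j n) ^ 2)))%R).
      unfold tail_prim. eapply is_derive_eq.
      * apply (is_derive_minus (V:=R_NormedModule) (fun s => gprim (gauss_par t k) (s / t + qshift k j n)) (fun _ => step t k N n)); [|apply (is_derive_const (V:=R_NormedModule))].
        apply (is_derive_comp (gprim (gauss_par t k)) (fun s => (s / t + qshift k j n)%R) x (exp (- (gauss_par t k * (x / t + qshift k j n) ^ 2))) (/ t)%R); [apply gprim_deriv|]. auto_derive; auto. field. lra.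
      * unfold minus, plus, opp, scal, zero; simpl; unfold mult; simpl. ring.
    + unfold dcoef_neg. simpl Re. rewrite RtoC_mult. ring.
  - cont.
  - intro r. destruct (prim_term_dom t k j N b (Rabs (Im z) + r) Ht Hk Hb) as [M1' H1'].
    destruct (prim_term_dom t k j N (dcoef_neg k j b) (Rabs (Im z) + r) Ht Hk Hb') as [M2' H2'].
    destruct (gauss_term_dom t k j b (Rabs (Im z) + r) Ht Hk Hb) as [M3' H3'].
    exists (Rmax M1' (Cmod Ci * M2' + Cmod (RtoC (/ t)) * M3')). intros x Hx.
    assert (Ht2 : (Rabs x <= Rabs (Im z) + r)%R).
    { replace x with (Im z + (x - Im z))%R by ring. eapply Rle_trans; [apply Rabs_triang|]. lra. }
    split; [eapply zdom_le; [apply Rmax_l|apply H1'; exact Ht2]|].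
    eapply zdom_le; [apply Rmax_r|]. apply zdom_plus; apply zdom_scal; [apply H2'|apply H3']; exact Ht2.
Qed.

(** Completing the square in the Gaussian turns the series of Gaussians into the conjugate of a
    holomorphic series, with these coefficients. *)
Definition conj_coef (t : R) (k j : Z) (b : Z -> C) (n : Z) : C :=
  Cconj (b n) * RtoC (exp (- (gauss_par t k * qshift k j n ^ 2))).
Lemma conj_coef_rapid t k j b : (0 < t)%R -> (0 < k)%Z -> growth t k b -> rapid (conj_coef t k j b).
Proof.
  intros Ht Hk (A & B & Hb). assert (Hc := gauss_par_pos t k Ht Hk).
  apply (rapid_gauss _ A (B + 2 * gauss_par t k * Rabs (IZR j / IZR k)) (gauss_par t k / 2)); [lra|].
  intro n. unfold conj_coef. rewrite Cmod_mult, Cmod_conj, Cmod_R, Rabs_right by (left; apply exp_pos).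
  eapply Rle_trans; [apply Rmult_le_compat_r; [left; apply exp_pos|apply Hb]|].
  rewrite <- exp_plus. apply exp_le. unfold qshift. set (x := (IZR j / IZR k)%R).
  pose proof (abs_prod_le x (IZR n) (Rabs x) (Rle_refl _)) as Hnx. pose proof (pow2_ge_0 x).
  replace (PI * t * IZR k)%R with (gauss_par t k / 2)%R by (unfold gauss_par; field).
  assert (gauss_par t k * (2 * (IZR n * x) + x ^ 2) >= gauss_par t k * - (2 * Rabs x * Rabs (IZR n)))%R by (apply Rmult_ge_compat_l; lra).
  replace (gauss_par t k * (IZR n + x) ^ 2)%R with (gauss_par t k * IZR n ^ 2 + gauss_par t k * (2 * (IZR n * x) + x ^ 2))%R by ring.
  lra.
Qed.
Lemma gauss_term_conj t k j b n z : (0 < t)%R -> (0 < k)%Z ->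
  gauss_term t k j b n z = gauss (gauss_par t k / t ^ 2) z * Cconj (conj_coef t k j b n * em (k * n + j) z).
Proof.
  intros Ht Hk. assert (Hk' := IZR_lt 0 k Hk). unfold gauss_term, conj_coef, gauss, em.
  rewrite !Cmult_conj, Cconj_conj, cexp_conj.
  replace (Cconj (RtoC (exp (- (gauss_par t k * qshift k j n ^ 2))))) with (RtoC (exp (- (gauss_par t k * qshift k j n ^ 2)))) by (apply C_ext; simpl; ring).
  rewrite <- !cexp_R.
  match goal with |- b n * ?u * ?v = ?w * (b n * ?x * ?y) => replace (b n * u * v) with (b n * (u * v)) by ring; replace (w * (b n * x * y)) with (b n * (w * x * y)) by ring end.
  rewrite <- !cexp_plus. apply (f_equal (fun w => b n * cexp w)).
  replace (IZR (- k * n + - j)) with (- (IZR k * qshift k j n))%R by (unfold qshift; rewrite plus_IZR, mult_IZR, !opp_IZR; field; lra).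
  replace (IZR (k * n + j)) with (IZR k * qshift k j n)%R by (unfold qshift; rewrite plus_IZR, mult_IZR; field; lra).
  destruct z as [x y]. unfold gauss_par. apply C_ext; simpl; field; lra.
Qed.
Lemma gauss_series_conj t k j b z : (0 < t)%R -> (0 < k)%Z -> growth t k b ->
  gauss_series t k j b z = gauss (gauss_par t k / t ^ 2) z * Cconj (fser k j (conj_coef t k j b) z).
Proof.
  intros Ht Hk Hb. destruct (fser_dom1 k j _ z (conj_coef_rapid t k j b Ht Hk Hb)) as [M HM].
  unfold fser. rewrite (zs_conj M) by exact HM. rewrite <- (zs_scal M).
  2:{ intro n. rewrite Cmod_conj. apply HM. }
  apply zs_ext. intro n. now apply gauss_term_conj.
Qed.
Lemma smooth_gauss_series t k j b : (0 < t)%R -> (0 < k)%Z -> growth t k b -> smooth (gauss_series t k j b).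
Proof.
  intros Ht Hk Hb.
  assert (E : gauss_series t k j b = fun z => gauss (gauss_par t k / t ^ 2) z * Cconj (fser k j (conj_coef t k j b) z)).
  { apply functional_extensionality. intro z. now apply gauss_series_conj. }
  rewrite E. apply smooth_mult; [apply smooth_gauss|]. apply smooth_conj, smooth_fser. now apply conj_coef_rapid.
Qed.
(** The derivatives of a series of primitives are series of the same kind plus series of Gaussians. *)
Lemma Cn_prim_series p t k j N : (0 < t)%R -> (0 < k)%Z -> forall b, growth t k b -> Cn p (prim_series t k j N b).
Proof.
  intros Ht Hk. induction p; intros b Hb; [intro z; now apply prim_series_cont|].
  apply (Cn_intro p _ (prim_series t k j N (dcoef_neg k j b)) (fun z => Ci * prim_series t k j N (dcoef_neg k j b) z + RtoC (/ t) * gauss_series t k j b z)).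
  - intro; now apply prim_series_cont. - intro; now apply prim_series_dR. - intro; now apply prim_series_dI.
  - apply IHp; now apply growth_dcoef_neg.
  - apply Cn_plus; apply Cn_scal; [apply IHp; now apply growth_dcoef_neg|]. now apply smooth_gauss_series.
Qed.
Lemma smooth_prim_series t k j N b : (0 < t)%R -> (0 < k)%Z -> growth t k b -> smooth (prim_series t k j N b).
Proof. intros ? ? ? p. now apply Cn_prim_series. Qed.
(** The exponentials are holomorphic, so only the derivatives of the primitives contribute. *)
Lemma dbar_prim_series t k j N b z : (0 < t)%R -> (0 < k)%Z -> growth t k b ->
  dbar (prim_series t k j N b) z = Ci / (2 * t) * gauss_series t k j b z.
Proof.
  intros Ht Hk Hb. rewrite (dbar_intro _ _ _ _ (prim_series_dR t k j N b z Ht Hk Hb) (prim_series_dI t k j N b z Ht Hk Hb)).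
  set (X := prim_series _ _ _ _ _ _). rewrite RtoC_inv by lra.
  replace (X + Ci * (Ci * X + / t * gauss_series t k j b z)) with (X + (Ci * Ci) * X + Ci / t * gauss_series t k j b z) by (unfold Cdiv; ring).
  replace (Ci * Ci) with (- (1)) by (apply C_ext; simpl; ring). field. intro K; injection K; lra.
Qed.

(** * Theta functions and sections of L(k,u) *)

Lemma RtoC_neq_0 (x : R) : x <> 0%R -> RtoC x <> 0.
Proof. intros H E. apply RtoC_inj in E. auto. Qed.

(** The Fourier coefficient at frequency [m] of the theta functions of L(k,u); the basis elements
    select the residue classes of [m] modulo [k]. *)
Definition theta_coef (tau : C) (k : Z) (u : C) (m : Z) : C :=
  cexp (PI * Ci * tau * IZR m * IZR m / IZR k + 2 * PI * Ci * IZR m * u / IZR k).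

Lemma theta_coef_neq_0 tau k u m : theta_coef tau k u m <> 0.
Proof. apply cexp_neq_0. Qed.
(** The recursion equivalent to the quasi-periodicity of the theta functions. *)
Lemma theta_coef_shift tau k u m : (0 < k)%Z ->
  theta_coef tau k u (m + k) = theta_coef tau k u m * cexp (PI * Ci * IZR k * tau + 2 * PI * Ci * (u + IZR m * tau)).
Proof.
  intro Hk. apply (IZR_lt 0) in Hk. unfold theta_coef. rewrite <- cexp_plus. f_equal. rewrite plus_IZR, RtoC_plus. field.
  apply RtoC_neq_0. lra.
Qed.
Definition theta_coefs (tau : C) (k : Z) (u : C) (j n : Z) : C := theta_coef tau k u (k * n + j).
Lemma theta_coefs_rapid tau k u j : (0 < Im tau)%R -> (0 < k)%Z -> rapid (theta_coefs tau k u j).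
Proof.
  intros Ht Hk. assert (Hk' := IZR_lt 0 k Hk). pose proof PI_RGT_0 as Hpi.
  set (K := (PI * Im tau * IZR k)%R).
  assert (HK : (0 < K)%R) by (apply Rmult_lt_0_compat; [apply Rmult_lt_0_compat|]; lra).
  set (b := (2 * PI * Im tau * IZR j + 2 * PI * Im u)%R).
  set (A := (- (PI * Im tau * IZR j ^ 2 / IZR k) - 2 * PI * (IZR j / IZR k) * Im u)%R).
  apply (rapid_gauss _ A (Rabs b) K HK). intro n. unfold theta_coefs, theta_coef. rewrite Cmod_cexp. apply exp_le.
  assert (E : Re (PI * Ci * tau * IZR (k * n + j) * IZR (k * n + j) / IZR k + 2 * PI * Ci * IZR (k * n + j) * u / IZR k)
    = (A + - (IZR n * b) - K * IZR n ^ 2)%R).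
  { rewrite plus_IZR, mult_IZR. destruct tau as [t1 t2], u as [u1 u2]. unfold A, b, K. unfold Cdiv. rewrite <- RtoC_inv by lra.
    cbn [Re Im fst snd Cplus Cmult RtoC Ci]. field. lra. }
  rewrite E. pose proof (abs_prod_le b (IZR n) (Rabs b) (Rle_refl _)). lra.
Qed.
Lemma basis_fser tau k u a x : (0 < k)%nat ->
  basis_H0 tau k u a x = fser (Z.of_nat k) (Z.of_nat a) (theta_coefs tau (Z.of_nat k) u (Z.of_nat a)) x.
Proof.
  intro Hk. unfold basis_H0, theta, fser. apply zs_ext. intro n. unfold theta_coefs, theta_coef, em. rewrite <- cexp_plus.
  cbv zeta. rewrite !INR_IZR_INZ. assert (Hk' : (0 < IZR (Z.of_nat k))%R) by (apply IZR_lt; lia).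
  assert (IZR (Z.of_nat k) <> 0%C :> C) by (apply RtoC_neq_0; lra).
  f_equal. rewrite plus_IZR, mult_IZR, !RtoC_plus, RtoC_mult, RtoC_div by lra. field. auto.
Qed.
Lemma basis_eq tau k u a : (0 < k)%nat ->
  basis_H0 tau k u a = fser (Z.of_nat k) (Z.of_nat a) (theta_coefs tau (Z.of_nat k) u (Z.of_nat a)).
Proof. intro Hk. apply functional_extensionality. intro x. now apply basis_fser. Qed.
Lemma basis_smooth tau k u a : (0 < Im tau)%R -> (0 < k)%nat -> smooth (basis_H0 tau k u a).
Proof. intros Ht Hk. rewrite basis_eq by auto. apply smooth_fser, theta_coefs_rapid; auto. lia. Qed.
Lemma basis_cont tau k u a z : (0 < Im tau)%R -> (0 < k)%nat -> continuous (basis_H0 tau k u a) z.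
Proof. intros. now apply smooth_cont, basis_smooth. Qed.
#[export] Hint Resolve basis_cont : cont.
Lemma basis_dbar tau k u a z : (0 < Im tau)%R -> (0 < k)%nat -> dbar (basis_H0 tau k u a) z = 0.
Proof. intros Ht Hk. rewrite basis_eq by auto. apply dbar_fser, theta_coefs_rapid; auto. lia. Qed.
Lemma basis_entire tau k u a : (0 < Im tau)%R -> (0 < k)%nat -> entire (basis_H0 tau k u a).
Proof. intros Ht Hk. rewrite basis_eq by auto. apply entire_fser, theta_coefs_rapid; auto. lia. Qed.

(** The factor by which translation by [tau] multiplies the sections of L(k,u). *)
Definition mult_tau (tau : C) (k : Z) (u x : C) : C :=
  cexp (- (PI * Ci * IZR k * tau) - 2 * PI * Ci * (IZR k * x + u)).
Lemma mult_tau_em tau k u x : mult_tau tau k u x = cexp (- (PI * Ci * IZR k * tau) - 2 * PI * Ci * u) * em (- k) x.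
Proof. unfold mult_tau, em. rewrite <- cexp_plus. f_equal. rewrite opp_IZR, RtoC_opp. ring. Qed.

Lemma basis_qp tau k u a : (0 < Im tau)%R -> (0 < k)%nat -> quasi_periodic tau (Z.of_nat k) u (basis_H0 tau k u a).
Proof.
  intros Ht Hk x. rewrite basis_eq by auto. split; [apply fser_periodic|].
  fold (mult_tau tau (Z.of_nat k) u x). set (kz := Z.of_nat k). set (j := Z.of_nat a).
  assert (Hkz : (0 < kz)%Z) by (unfold kz; lia).
  destruct (fser_dom1 kz j _ x (theta_coefs_rapid tau kz u j Ht Hkz)) as [M HM].
  unfold fser. rewrite <- (zs_shift M (fun n => theta_coefs tau kz u j n * em (kz * n + j) x)) by exact HM.
  assert (HM' : exists M', zdom M' (fun n => theta_coefs tau kz u j (n + 1) * em (kz * (n + 1) + j) x)).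
  { exists (2 * M)%R. intro n. eapply Rle_trans; [apply (HM (n + 1)%Z)|]. pose proof (abs_nat_half n (n + 1) ltac:(lia)).
    pose proof (zdom_pos _ _ HM). nra. }
  destruct HM' as [M' HM'].
  rewrite <- (zs_scal M') by exact HM'. apply zs_ext. intro n.
  rewrite mult_tau_em, em_plus. unfold theta_coefs.
  replace (kz * (n + 1) + j)%Z with ((kz * n + j) + kz)%Z by ring. set (m := (kz * n + j)%Z).
  rewrite theta_coef_shift by auto. rewrite <- em_add.
  assert (E1 : cexp (PI * Ci * IZR kz * tau + 2 * PI * Ci * (u + IZR m * tau)) * cexp (- (PI * Ci * IZR kz * tau) - 2 * PI * Ci * u) = em m tau).
  { unfold em. rewrite <- cexp_plus. f_equal. ring. }
  assert (E2 : em (- kz) x * em kz x = 1) by (rewrite em_add; replace (- kz + kz)%Z with 0%Z by ring; apply em_0).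
  rewrite <- E1.
  match goal with |- ?a * (?b * (?c * ?d)) = _ => transitivity (a * b * c * d * (em (- kz) x * em kz x)); [rewrite E2; ring|ring] end.
Qed.
Lemma basis_H0_H0 tau k u a : (0 < Im tau)%R -> (0 < k)%nat -> H0 tau (Z.of_nat k) u (basis_H0 tau k u a).
Proof. intros. split; [now apply basis_entire|now apply basis_qp]. Qed.

Lemma fcoef_basis_eq tau k u a m y : (0 < Im tau)%R -> (0 < k)%nat -> (a < k)%nat ->
  fcoef m (basis_H0 tau k u a) y = if Z.eqb (m mod Z.of_nat k) (Z.of_nat a) then theta_coef tau (Z.of_nat k) u m else 0.
Proof.
  intros Ht Hk Ha. rewrite basis_eq by auto.
  assert (HR : rapid (theta_coefs tau (Z.of_nat k) u (Z.of_nat a))) by (apply theta_coefs_rapid; auto; lia).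
  destruct (Z.eqb_spec (m mod Z.of_nat k) (Z.of_nat a)) as [E|E].
  - assert (Em : m = (Z.of_nat k * (m / Z.of_nat k) + Z.of_nat a)%Z) by (rewrite <- E; apply Z.div_mod; lia).
    rewrite Em at 1. rewrite fcoef_fser_in by (auto; lia). unfold theta_coefs. now rewrite <- Em.
  - apply fcoef_fser_out; auto. intros n Hn. apply E. rewrite <- Hn, Z.add_comm, Z.mul_comm, Z.mod_add by lia. apply Z.mod_small. lia.
Qed.

Lemma plus_tau (tau : C) r y : ((r, y) : C) + tau = ((r + Re tau)%R, (y + Im tau)%R).
Proof. destruct tau; apply C_ext; simpl; ring. Qed.
(** The multiplier contains [em (- k)], which moves the frequency by [k]. *)
Lemma fcoef_qp tau k u f m y : (forall z, continuous f z) -> quasi_periodic tau k u f ->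
  fcoef m f (y + Im tau) = cexp (- (PI * Ci * IZR k * tau) - 2 * PI * Ci * (u + IZR m * tau)) * fcoef (m + k) f y.
Proof.
  intros Hc Hq. unfold fcoef.
  rewrite <- (cint_periodic (fun r => f (r, (y + Im tau)%R) * em (- m) (r, (y + Im tau)%R)) (Re tau)).
  - rewrite <- cint_scal by cont. apply cint_ext. intro r.
    rewrite <- plus_tau. rewrite (proj2 (Hq (r, y))). fold (mult_tau tau k u (r, y)). rewrite mult_tau_em, em_plus.
    replace (- (m + k))%Z with (- m + - k)%Z by ring. rewrite <- em_add.
    replace (cexp (- (PI * Ci * IZR k * tau) - 2 * PI * Ci * (u + IZR m * tau))) with
      (cexp (- (PI * Ci * IZR k * tau) - 2 * PI * Ci * u) * em (- m) tau).
    + ring.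
    + unfold em. rewrite <- cexp_plus. f_equal. rewrite opp_IZR, RtoC_opp. ring.
  - cont.
  - intro r. replace ((r + 1)%R, (y + Im tau)%R) with (((r, (y + Im tau)%R) : C) + 1) by (apply C_ext; simpl; ring).
    now rewrite (proj1 (Hq _)), em_periodic.
Qed.

(** The Fourier coefficients of an entire section do not depend on the line, so that
    quasi-periodicity relates those of index [m] and [m + k]; if [k] consecutive ones vanish, all
    do. *)
Lemma H0_zero tau k u f : (0 < k)%Z -> H0 tau k u f ->
  (forall a, (0 <= a < k)%Z -> fcoef a f 0 = 0) -> forall x, f x = 0.
Proof.
  intros Hk [He Hq] H0.
  assert (Hc := entire_cont f He). assert (Hp : forall z, f (z + 1) = f z) by (intro; apply Hq).
  assert (HY : forall m y, fcoef m f y = fcoef m f 0) by (intros; now apply fcoef_entire_const).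
  assert (Hs : forall m, fcoef m f 0 = 0 <-> fcoef (m + k) f 0 = 0).
  { intro m. pose proof (fcoef_qp tau k u f m 0 Hc Hq) as E. rewrite HY in E. split; intro Z0.
    - rewrite Z0 in E. symmetry in E. apply Ceq_minus. replace (fcoef (m + k) f 0 - 0) with (fcoef (m + k) f 0) by ring.
      set (e := cexp _) in E. assert (e <> 0) by apply cexp_neq_0.
      replace (fcoef (m + k) f 0) with (/ e * (e * fcoef (m + k) f 0)) by (field; auto). rewrite E. ring.
    - rewrite Z0 in E. rewrite E. ring. }
  assert (Hn : forall (n : nat) m, fcoef m f 0 = 0 <-> fcoef (m + Z.of_nat n * k) f 0 = 0).
  { induction n; intro m; [now replace (m + Z.of_nat 0 * k)%Z with m by ring|].
    rewrite (IHn m), (Hs (m + Z.of_nat n * k)%Z). replace (m + Z.of_nat n * k + k)%Z with (m + Z.of_nat (S n) * k)%Z by lia. reflexivity. }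
  assert (Hall : forall m, fcoef m f 0 = 0).
  { intro m. pose proof (Z.div_mod m k ltac:(lia)) as Em. pose proof (Z.mod_pos_bound m k Hk) as Hb.
    destruct (Z_le_gt_dec 0 (m / k)) as [L|L].
    - replace m with (m mod k + Z.of_nat (Z.to_nat (m / k)) * k)%Z by (rewrite Z2Nat.id by auto; lia).
      apply Hn, H0; auto.
    - apply (Hn (Z.to_nat (- (m / k))) m). rewrite Z2Nat.id by lia. replace (m + - (m / k) * k)%Z with (m mod k)%Z by lia.
      apply H0; auto. }
  intros [x y]. apply (fcoef_unique f y); auto. intro m. now rewrite HY.
Qed.
Lemma qp_plus tau k u f g c : quasi_periodic tau k u f -> quasi_periodic tau k u g -> quasi_periodic tau k u (fun z => f z + c * g z).
Proof.
  intros Hf Hg x. destruct (Hf x) as [F1 F2]. destruct (Hg x) as [G1 G2]. split; [now rewrite F1, G1|].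
  rewrite F2, G2. ring.
Qed.
Lemma qp_csum tau k u n (f : nat -> C -> C) : (forall i, quasi_periodic tau k u (f i)) -> quasi_periodic tau k u (fun z => Csum n (fun i => f i z)).
Proof.
  intros H x. induction n; simpl; [split; ring|]. destruct IHn as [I1 I2]. destruct (H n x) as [F1 F2].
  split; [now rewrite I1, F1|]. rewrite I2, F2. ring.
Qed.
Lemma qp_scal tau k u f c : quasi_periodic tau k u f -> quasi_periodic tau k u (fun z => c * f z).
Proof. intros Hf x. destruct (Hf x) as [F1 F2]. split; [now rewrite F1|]. rewrite F2. ring. Qed.
Lemma entire_scal c f : entire f -> entire (fun z => c * f z).
Proof. intro H. apply (entire_mult (fun _ => c) f); auto. apply entire_const. Qed.
Lemma H0_csum tau k u n (c : nat -> C) (f : nat -> C -> C) : (forall i, H0 tau k u (f i)) -> H0 tau k u (fun z => Csum n (fun i => c i * f i z)).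
Proof.
  intro H. split.
  - apply (entire_csum n (fun i z => c i * f i z)). intro i. apply entire_scal, H.
  - apply (qp_csum tau k u n (fun i z => c i * f i z)). intro i. apply qp_scal, H.
Qed.
Lemma H0_cont tau k u f : H0 tau k u f -> forall z, continuous f z.
Proof. intros [H _]. now apply entire_cont. Qed.

(** Among the basis elements, only the one of index [a] has a coefficient at frequency [a]. *)
Definition coord_H0 (tau : C) (k : nat) (u : C) (f : C -> C) (a : nat) : C :=
  fcoef (Z.of_nat a) f 0 / theta_coef tau (Z.of_nat k) u (Z.of_nat a).
Lemma fcoef_comb tau k u m y B : (0 < Im tau)%R -> (0 < k)%nat ->
  fcoef m (fun x => Csum k (fun a => B a * basis_H0 tau k u a x)) y
  = B (Z.to_nat (m mod Z.of_nat k)) * theta_coef tau (Z.of_nat k) u m.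
Proof.
  intros Ht Hk. pose proof (Z.mod_pos_bound m (Z.of_nat k) ltac:(lia)) as Hb.
  rewrite (fcoef_csum m k (fun a x => B a * basis_H0 tau k u a x)).
  2:{ cont. }
  rewrite (Csum_ext _ _ (fun a => B a * fcoef m (basis_H0 tau k u a) y)).
  2:{ intros i Hi. apply fcoef_scal. intro; now apply basis_cont. }
  rewrite (Csum_single k (fun a => B a * fcoef m (basis_H0 tau k u a) y) (Z.to_nat (m mod Z.of_nat k))).
  2: lia.
  2:{ intros i Hi Hne. rewrite fcoef_basis_eq by auto.
      destruct (Z.eqb_spec (m mod Z.of_nat k) (Z.of_nat i)) as [E|E]; [exfalso; apply Hne; lia|ring]. }
  rewrite fcoef_basis_eq by (auto; lia). rewrite Z2Nat.id by lia. now rewrite Z.eqb_refl.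
Qed.
Lemma H0_span tau k u f : (0 < Im tau)%R -> (0 < k)%nat -> H0 tau (Z.of_nat k) u f ->
  forall x, f x = Csum k (fun a => coord_H0 tau k u f a * basis_H0 tau k u a x).
Proof.
  intros Ht Hk Hf.
  assert (HS := H0_csum tau (Z.of_nat k) u k (coord_H0 tau k u f) _ (fun i => basis_H0_H0 tau k u i Ht Hk)).
  set (g := fun z => Csum k (fun a => coord_H0 tau k u f a * basis_H0 tau k u a z)) in *.
  assert (HD : H0 tau (Z.of_nat k) u (fun z => f z + (- (1)) * g z)).
  { split; [apply entire_plus; [apply Hf|apply entire_scal, HS]|apply qp_plus; [apply Hf|apply HS]]. }
  intro x. pose proof (H0_zero tau (Z.of_nat k) u _ ltac:(lia) HD) as E.
  assert (E2 : f x + (- (1)) * g x = 0).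
  { apply E. intros a Ha.
    rewrite (fcoef_ext _ _ (fun z => (- (1)) * g z + f z)) by (intro; ring).
    rewrite fcoef_lin by (apply (H0_cont _ _ _ _ HS) || apply (H0_cont _ _ _ _ Hf)).
    unfold g. rewrite fcoef_comb by auto. rewrite Z.mod_small by auto. unfold coord_H0. rewrite Z2Nat.id by lia.
    field. apply theta_coef_neq_0. }
  replace (f x) with ((f x + (- (1)) * g x) + g x) by ring. rewrite E2. unfold g. ring.
Qed.

Definition zeta (tau u : C) (m : Z) : C := cexp (2 * PI * Ci * (IZR m * tau + u)).
(** A value [zeta_m = 1] would exhibit [u] as a lattice point. *)
Lemma zeta_neq_1 tau u m : ~ in_lattice tau u -> 1 - zeta tau u m <> 0.
Proof.
  intros Hu E. apply Hu. assert (E1 : zeta tau u m = 1) by (replace (zeta tau u m) with (1 - (1 - zeta tau u m)) by ring; rewrite E; ring).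
  destruct (cexp_eq_1 _ E1) as [n Hn]. exists n, (- m)%Z. rewrite opp_IZR, RtoC_opp.
  assert (Hp : 2 * PI * Ci <> 0). { intro K. apply (f_equal Im) in K. simpl in K. pose proof PI_RGT_0. lra. }
  assert (E2 : IZR m * tau + u = IZR n).
  { revert Hn Hp. generalize (2 * PI * Ci). intros p Hn Hp.
    replace (IZR m * tau + u) with (/ p * (p * (IZR m * tau + u))) by (field; auto). rewrite Hn. field. auto. }
  rewrite <- E2. ring.
Qed.
(** Quasi-periodicity multiplies the Fourier coefficient of index [m] by [zeta_m], which is not 1. *)
Lemma H00_zero tau u f : ~ in_lattice tau u -> H0 tau 0 u f -> forall x, f x = 0.
Proof.
  intros Hu [He Hq]. assert (Hc := entire_cont f He). assert (Hp : forall z, f (z + 1) = f z) by (intro; apply Hq).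
  intros [x y]. apply (fcoef_unique f y); auto. intro m.
  pose proof (fcoef_qp tau 0 u f m y Hc Hq) as E. rewrite Z.add_0_r in E.
  rewrite (fcoef_entire_const m f (y + Im tau) y) in E by auto.
  pose proof (zeta_neq_1 tau u m Hu) as Hz.
  assert (E1 : zeta tau u m * fcoef m f y = fcoef m f y).
  { rewrite E at 1. rewrite Cmult_assoc. unfold zeta. rewrite <- cexp_plus.
    replace (2 * PI * Ci * (IZR m * tau + u) + (- (PI * Ci * 0 * tau) - 2 * PI * Ci * (u + IZR m * tau))) with (RtoC 0) by ring.
    rewrite cexp_0. ring. }
  replace (fcoef m f y) with (/ (1 - zeta tau u m) * (fcoef m f y - zeta tau u m * fcoef m f y)) by (field; auto).
  rewrite E1. ring.
Qed.

(** * The hermitian product with theta functions *)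

(** Go from the origin to the point along the segment, in [n] steps short enough for the function
    to vary by less than 1 in each. *)
Lemma bounded_rectangle (F : C -> R) (T : R) : (0 <= T)%R -> (forall z, continuous F z) ->
  exists K, forall z, (0 <= Re z <= 1)%R -> (0 <= Im z <= T)%R -> (Rabs (F z) <= K)%R.
Proof.
  intros HT HF.
  destruct (uniform_continuity_2d (fun x y => F (x, y)) 0 1 0 T) with (mkposreal 1 Rlt_0_1) as [d Hd].
  { intros x y _ _. apply (cont2_pt F (x, y)), HF. }
  simpl in Hd. destruct (INR_unbounded ((1 + T) / d)) as [n Hn].
  assert (Hdp := cond_pos d).
  assert (Hn0 : (0 < INR n)%R). { eapply Rle_lt_trans; [|exact Hn]. apply Rdiv_le_0_compat; lra. }
  apply (Rmult_lt_compat_r d) in Hn; [|lra]. replace ((1 + T) / d * d)%R with (1 + T)%R in Hn by (field; lra).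
  exists (Rabs (F (0, 0)%R) + INR n)%R. intros [x y] Hx Hy; simpl in Hx, Hy.
  assert (H : forall i : nat, (i <= n)%nat -> (Rabs (F (x * (INR i / INR n), y * (INR i / INR n))%R) <= Rabs (F (0, 0)%R) + INR i)%R).
  { induction i; intro Hi.
    - simpl. replace (x * (0 / INR n))%R with 0%R by (field; lra). replace (y * (0 / INR n))%R with 0%R by (field; lra). lra.
    - specialize (IHi ltac:(lia)).
      assert (Hb : forall j : nat, (j <= n)%nat -> (0 <= INR j / INR n <= 1)%R).
      { intros j Hj. apply le_INR in Hj. pose proof (pos_INR j). split; [apply Rdiv_le_0_compat; lra|].
        apply (Rmult_le_reg_r (INR n)); auto. unfold Rdiv. rewrite Rmult_assoc, Rinv_l by lra. lra. }
      pose proof (Hb i ltac:(lia)) as B1. pose proof (Hb (S i) Hi) as B2.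
      assert (E : (INR (S i) / INR n - INR i / INR n = / INR n)%R) by (rewrite S_INR; field; lra).
      assert (Hin : (0 < / INR n)%R) by now apply Rinv_0_lt_compat.
      assert (Hsm : forall v, (0 <= v <= 1 + T)%R -> (Rabs (v * (INR (S i) / INR n) - v * (INR i / INR n)) < d)%R).
      { intros v Hv. rewrite <- Rmult_minus_distr_l, E, Rabs_right by nra.
        apply (Rmult_lt_reg_r (INR n)); auto. rewrite Rmult_assoc, Rinv_l by lra. lra. }
      assert (G : (Rabs (F (x * (INR (S i) / INR n), y * (INR (S i) / INR n))%R - F (x * (INR i / INR n), y * (INR i / INR n))%R) < 1)%R).
      { apply Hd; try (split; nra); apply Hsm; lra. }
      rewrite S_INR at 3. 
      match goal with |- (Rabs ?u <= _)%R => match type of G with (Rabs (u - ?v) < _)%R => replace u with ((u - v) + v)%R by ring end end.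
      eapply Rle_trans; [apply Rabs_triang|]. lra. }
  specialize (H n (Nat.le_refl _)). replace (INR n / INR n)%R with 1%R in H by (field; lra). rewrite !Rmult_1_r in H. exact H.
Qed.
Lemma bounded_rectangle_C (f : C -> C) (T : R) : (0 <= T)%R -> (forall z, continuous f z) ->
  exists K, (0 <= K)%R /\ forall z, (0 <= Re z <= 1)%R -> (0 <= Im z <= T)%R -> (Cmod (f z) <= K)%R.
Proof.
  intros HT Hf. destruct (bounded_rectangle (fun z => Cmod (f z)) T HT ltac:(cont)) as [K HK].
  assert (HK' : forall z, (0 <= Re z <= 1)%R -> (0 <= Im z <= T)%R -> (Cmod (f z) <= K)%R).
  { intros z Hx Hy. rewrite <- (Rabs_pos_eq (Cmod (f z))) by apply Cmod_ge_0. now apply HK. }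
  exists K. split; auto. eapply Rle_trans; [apply Cmod_ge_0|apply (HK' 0); simpl; lra].
Qed.
Lemma lattice_reduce (tau : C) (P : C -> Prop) : (0 < Im tau)%R ->
  (forall z, P (z + 1) <-> P z) -> (forall z, P (z + tau) <-> P z) ->
  (forall z, (0 <= Re z <= 1)%R -> (0 <= Im z <= Im tau)%R -> P z) -> forall z, P z.
Proof.
  intros Ht H1 H2 H z.
  assert (K : forall (w : C) (Q : C -> Prop), (forall z, Q (z + w) <-> Q z) -> forall (n : Z) z, Q (z + IZR n * w) <-> Q z).
  { intros w Q HQ.
    assert (Kn : forall (n : nat) z, Q (z + INR n * w) <-> Q z).
    { induction n; intro y. - simpl. replace (y + 0 * w) with y by ring. reflexivity.
      - rewrite S_INR, RtoC_plus. replace (y + (INR n + 1) * w) with ((y + INR n * w) + w) by ring. now rewrite HQ, IHn. }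
    intros n y. destruct (Z_le_gt_dec 0 n) as [L|L].
    - rewrite <- (Z2Nat.id n L), <- INR_IZR_INZ. apply Kn.
    - rewrite <- (Kn (Z.to_nat (- n)) (y + IZR n * w)). rewrite INR_IZR_INZ, Z2Nat.id, opp_IZR, RtoC_opp by lia.
      replace (y + IZR n * w + - IZR n * w) with y by ring. reflexivity. }
  destruct (archimed (Im z / Im tau)) as [A1 A2]. set (n := up (Im z / Im tau)) in *.
  set (z1 := z + IZR (1 - n) * tau).
  assert (E1 : (0 <= Im z1 <= Im tau)%R).
  { unfold z1. rewrite im_plus, im_scal_l, minus_IZR.
    assert (Ez : (Im z = Im z / Im tau * Im tau)%R) by (field; lra). set (q := (Im z / Im tau)%R) in *. rewrite Ez. split; nra. }
  destruct (archimed (Re z1)) as [B1 B2]. set (m := up (Re z1)) in *.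
  assert (HP : P (z1 + IZR (1 - m) * 1)).
  { apply H.
    - rewrite re_plus, re_scal_l, minus_IZR. change (Re 1) with 1%R. lra.
    - rewrite im_plus, im_scal_l. change (Im 1) with 0%R. rewrite Rmult_0_r, Rplus_0_r. exact E1. }
  rewrite (K 1 P H1) in HP. unfold z1 in HP. now rewrite (K tau P H2) in HP.
Qed.

(** The metric of L(l,w) has weight [exp (- wexp tau l w x_2)]. *)
Definition wexp (tau : C) (l : Z) (w : C) (s : R) : R := (2 * PI * Im tau * (IZR l * s ^ 2 + 2 * s * coord2 tau w))%R.
Lemma wexp_cont tau l w s : continuous (wexp tau l w) s.
Proof. unfold wexp. cont. Qed.
#[export] Hint Resolve wexp_cont : cont.
Lemma Cmod_mult_tau tau l w z : (0 < Im tau)%R ->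
  Cmod (mult_tau tau l w z) = exp (wexp tau l w (Im z / Im tau + 1) / 2 - wexp tau l w (Im z / Im tau) / 2).
Proof.
  intro Ht. unfold mult_tau. rewrite Cmod_cexp. f_equal. unfold wexp, coord2. destruct tau, z, w; simpl in *. field. lra.
Qed.
(** The modulus times the square root of the metric weight is doubly periodic. *)
Lemma section_bound tau l w f : (0 < Im tau)%R -> (forall z, continuous f z) -> quasi_periodic tau l w f ->
  exists K, (0 <= K)%R /\ forall z, (Cmod (f z) <= K * exp (wexp tau l w (Im z / Im tau) / 2))%R.
Proof.
  intros Ht Hf Hq.
  set (Phi := fun z => (Cmod (f z) * exp (- (wexp tau l w (Im z / Im tau) / 2)))%R).
  assert (HPhi : forall z, continuous Phi z).
  { intro z. apply ctn_Rmult.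
    - apply (continuous_comp f Cmod z (Hf z)). apply (continuous_ext (norm (V := C_R_NormedModule))); [apply norm_C|].
      apply (filterlim_norm (V := C_R_NormedModule)).
    - apply (ctn_Rfun (fun s => exp (- (wexp tau l w s / 2)))); [|apply Im_over_cont]. intro s. unfold wexp. auto_derive. auto. }
  destruct (bounded_rectangle Phi (Im tau) ltac:(lra) HPhi) as [K HK].
  assert (HB : forall z, (Rabs (Phi z) <= K)%R).
  { apply (lattice_reduce tau); auto.
    - intro z. unfold Phi. rewrite (proj1 (Hq z)). replace (Im (z + 1)) with (Im z) by (destruct z; simpl; ring). reflexivity.
    - intro z. unfold Phi. rewrite (proj2 (Hq z)). fold (mult_tau tau l w z). rewrite Cmod_mult, Cmod_mult_tau by auto.
      replace (Im (z + tau) / Im tau)%R with (Im z / Im tau + 1)%R by (rewrite im_plus; field; lra).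
      set (a := (wexp tau l w (Im z / Im tau + 1) / 2)%R). set (b := (wexp tau l w (Im z / Im tau) / 2)%R).
      replace (exp (a - b) * Cmod (f z) * exp (- a))%R with (Cmod (f z) * (exp (a - b) * exp (- a)))%R by ring.
      rewrite <- exp_plus. replace (a - b + - a)%R with (- b)%R by ring. reflexivity. }
  exists K. split; [eapply Rle_trans; [apply Rabs_pos|apply (HB (RtoC 0))]|].
  intro z. specialize (HB z). unfold Phi in HB. rewrite Rabs_right in HB.
  2:{ apply Rle_ge, Rmult_le_pos; [apply Cmod_ge_0|left; apply exp_pos]. }
  set (b := (wexp tau l w (Im z / Im tau) / 2)%R) in *.
  apply (Rmult_le_compat_r (exp b)) in HB; [|left; apply exp_pos].
  rewrite Rmult_assoc, <- exp_plus in HB. replace (- b + b)%R with 0%R in HB by ring. rewrite exp_0, Rmult_1_r in HB. exact HB.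
Qed.

(** The hermitian product with the first coordinate taken along the real axis; by periodicity the
    shear [x_2 * Re tau] does not matter, see [herm_wint]. *)
Definition wint (tau : C) (l : Z) (w : C) (F : C -> C) : C :=
  cint (fun s => cint (fun r => F (r, (Im tau * s)%R)) 0 1 * RtoC (exp (- wexp tau l w s))) 0 1.
Lemma herm_wint tau l w f g : (forall z, continuous f z) -> (forall z, continuous g z) ->
  (forall z, f (z + 1) = f z) -> (forall z, g (z + 1) = g z) ->
  herm tau l w f g = wint tau l w (fun z => f z * Cconj (g z)).
Proof.
  intros Hf Hg Hpf Hpg. unfold herm, wint. apply cint_ext. intro s.
  set (F := fun z => f z * Cconj (g z)). set (W := exp _).
  assert (HF : forall z, continuous F z) by (intro; apply ctn_mult; auto; now apply ctn_conj).
  assert (HpF : forall z, F (z + 1) = F z) by (intro; unfold F; now rewrite Hpf, Hpg).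
  transitivity (cint (fun r => W * F ((r + Re tau * s)%R, (Im tau * s)%R)) 0 1).
  { apply cint_ext. intro r. replace (RtoC r + tau * RtoC s) with ((r + Re tau * s)%R, (Im tau * s)%R) by (destruct tau; apply C_ext; simpl; ring).
    unfold F. ring. }
  assert (Hc : ccont (fun r => F (r, (Im tau * s)%R))) by cont.
  rewrite (cint_scal W (fun r => F ((r + Re tau * s)%R, (Im tau * s)%R))).
  2:{ cont. }
  rewrite (cint_periodic (fun r => F (r, (Im tau * s)%R)) (Re tau * s)); auto.
  - apply Cmult_comm.
  - intro r. rewrite <- (HpF (r, (Im tau * s)%R)). f_equal. apply C_ext; simpl; ring.
Qed.
Lemma wint_integrand tau l w F : (forall z, continuous F z) ->
  ccont (fun s => cint (fun r => F (r, (Im tau * s)%R)) 0 1 * RtoC (exp (- wexp tau l w s))).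
Proof.
  intro HF. apply ccont_mult.
  - intro s. apply (continuous_comp (fun s => (Im tau * s)%R) (fun y => cint (fun r => F (r, y)) 0 1)).
    + cont.
    + apply (cint_param_cont F 0 1); auto. lra.
  - intro s. apply ctn_RtoC. apply (ex_derive_continuous (fun s => exp (- wexp tau l w s))). unfold wexp. auto_derive. auto.
Qed.
Lemma wint_lin tau l w c F G : (forall z, continuous F z) -> (forall z, continuous G z) ->
  wint tau l w (fun z => c * F z + G z) = c * wint tau l w F + wint tau l w G.
Proof.
  intros HF HG. unfold wint.
  pose proof (wint_integrand tau l w F HF) as KF. pose proof (wint_integrand tau l w G HG) as KG.
  set (A := fun s => cint (fun r => F (r, (Im tau * s)%R)) 0 1 * RtoC (exp (- wexp tau l w s))) in *.
  set (B := fun s => cint (fun r => G (r, (Im tau * s)%R)) 0 1 * RtoC (exp (- wexp tau l w s))) in *.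
  transitivity (cint (fun s => c * A s + B s) 0 1).
  - apply cint_ext. intro s. unfold A, B.
    rewrite (cint_plus (fun r => c * F (r, (Im tau * s)%R)) (fun r => G (r, (Im tau * s)%R))).
    + rewrite (cint_scal c (fun r => F (r, (Im tau * s)%R))) by cont. ring.
    + cont.
    + cont.
  - rewrite (cint_plus (fun s => c * A s) B), (cint_scal c A); auto. apply ccont_mult; [apply ccont_const|exact KF].
Qed.
Lemma wint_0 tau l w : wint tau l w (fun _ => 0) = 0.
Proof.
  unfold wint. rewrite (cint_ext _ (fun _ => 0)); [rewrite cint_const; ring|]. intro s. rewrite cint_const. ring.
Qed.
Lemma wint_ext tau l w F G : (forall z, F z = G z) -> wint tau l w F = wint tau l w G.
Proof. intro H. f_equal. now apply functional_extensionality. Qed.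
Lemma wint_csum tau l w n (c : nat -> C) (F : nat -> C -> C) : (forall i z, continuous (F i) z) ->
  wint tau l w (fun z => Csum n (fun i => c i * F i z)) = Csum n (fun i => c i * wint tau l w (F i)).
Proof.
  intro H. induction n; simpl; [apply wint_0|].
  rewrite <- IHn. rewrite (wint_ext _ _ _ _ (fun z => c n * F n z + Csum n (fun i => c i * F i z))) by (intro; ring).
  rewrite wint_lin; auto; [ring|]. intro z. apply (ctn_csum (fun i z => c i * F i z)). intro i. apply ctn_mult; auto. apply continuous_const.
Qed.

(** The metric weight seen by the theta terms of frequency [d] after completing the square. *)
Definition gauss_weight (tau : C) (l : Z) (w : C) (d : Z) (x : R) : C := RtoC (exp (- wexp tau l w (x + IZR d / IZR l))).
Lemma gauss_weight_cont tau l w d x : continuous (gauss_weight tau l w d) x.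
Proof. apply ctn_RtoC, (ex_derive_continuous (fun x => exp (- wexp tau l w (x + IZR d / IZR l)))). unfold wexp. auto_derive. auto. Qed.
#[export] Hint Resolve gauss_weight_cont : cont.
(** Completing the square: conjugation turns [em m] into [em (- m)], and the missing real factors
    recombine into the inverse coefficient and a translate of the weight. *)
Lemma conj_theta_term tau l w m r s : (0 < Im tau)%R -> (0 < l)%Z ->
  Cconj (theta_coef tau l w m * em m (r, (Im tau * s)%R)) * RtoC (exp (- wexp tau l w s))
  = em (- m) (r, (Im tau * s)%R) / theta_coef tau l w m * RtoC (exp (- wexp tau l w (s + IZR m / IZR l))).
Proof.
  intros Ht Hl. assert (Hl' := IZR_lt 0 l Hl). unfold Cdiv, theta_coef, em. rewrite <- cexp_opp, <- !cexp_R, <- cexp_plus, cexp_conj, <- !cexp_plus.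
  f_equal. rewrite opp_IZR. unfold wexp, coord2, Cdiv. rewrite <- RtoC_inv by lra. destruct tau as [t1 t2], w as [w1 w2]. simpl in Ht.
  apply C_ext; simpl; field; lra.
Qed.
(** Divided by the theta coefficients, the Fourier coefficients at frequencies [d + l n] are
    translates of one function of [y]. *)
Lemma fcoef_qp_iter tau l w f m n y : (0 < l)%Z -> (forall z, continuous f z) -> quasi_periodic tau l w f ->
  fcoef (l * n + m) f y / theta_coef tau l w (l * n + m) = fcoef m f (y + Im tau * IZR n) / theta_coef tau l w m.
Proof.
  intros Hl Hf Hq.
  assert (H1 : forall m y, fcoef (m + l) f y / theta_coef tau l w (m + l) = fcoef m f (y + Im tau) / theta_coef tau l w m).
  { intros j x. rewrite (fcoef_qp tau l w f j x Hf Hq), theta_coef_shift by auto.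
    replace (- (PI * Ci * IZR l * tau) - 2 * PI * Ci * (w + IZR j * tau)) with (- (PI * Ci * IZR l * tau + 2 * PI * Ci * (w + IZR j * tau))) by ring.
    rewrite cexp_opp. field. split; [apply cexp_neq_0|apply theta_coef_neq_0]. }
  assert (Hn : forall (n : nat) m y, fcoef (l * Z.of_nat n + m) f y / theta_coef tau l w (l * Z.of_nat n + m) = fcoef m f (y + Im tau * INR n) / theta_coef tau l w m).
  { induction n0; intros j x.
    - simpl. rewrite Z.mul_0_r, Z.add_0_l, Rmult_0_r, Rplus_0_r. reflexivity.
    - replace (l * Z.of_nat (S n0) + j)%Z with ((l * Z.of_nat n0 + j) + l)%Z by lia. rewrite H1, IHn0. rewrite S_INR.
      replace (x + Im tau + Im tau * INR n0)%R with (x + Im tau * (INR n0 + 1))%R by ring. reflexivity. }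
  destruct (Z_le_gt_dec 0 n) as [L|L].
  - rewrite <- (Z2Nat.id n L), <- INR_IZR_INZ. apply Hn.
  - pose proof (Hn (Z.to_nat (- n)) (l * n + m)%Z (y + Im tau * IZR n)%R) as E.
    rewrite Z2Nat.id in E by lia. replace (l * - n + (l * n + m))%Z with m in E by ring.
    rewrite INR_IZR_INZ, Z2Nat.id, opp_IZR in E by lia. replace (y + Im tau * IZR n + Im tau * - IZR n)%R with y in E by ring. now rewrite E.
Qed.

(** The part over [n, n + 1] of the integral over the real line of [c (t s)] against the Gaussian. *)
Definition pair_term (tau : C) (l : Z) (w : C) (d : Z) (c : R -> C) (n : Z) : C :=
  cint (fun s => c (Im tau * (s + IZR n))%R * gauss_weight tau l w d (s + IZR n)) 0 1.

Lemma theta_pair_row tau l w f m s : (0 < Im tau)%R -> (0 < l)%Z -> (forall z, continuous f z) ->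
  let y := (Im tau * s)%R in
  fcoef m f y / theta_coef tau l w m * RtoC (exp (- wexp tau l w (s + IZR m / IZR l)))
  = RtoC (exp (- wexp tau l w s)) * cint (fun r => f (r, y) * Cconj (theta_coef tau l w m * em m (r, y))) 0 1.
Proof.
  intros Ht Hl Hf y. rewrite <- cint_scal by cont.
  rewrite (cint_ext _ (fun r => (/ theta_coef tau l w m * exp (- wexp tau l w (s + IZR m / IZR l))) * (f (r, y) * em (- m) (r, y)))).
  - rewrite cint_scal by cont. fold (fcoef m f y). field. apply theta_coef_neq_0.
  - intro r. pose proof (conj_theta_term tau l w m r s Ht Hl) as Q. fold y in Q.
    transitivity (f (r, y) * (Cconj (theta_coef tau l w m * em m (r, y)) * exp (- wexp tau l w s))); [ring|]. rewrite Q. unfold Cdiv. ring.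
Qed.
(** Unfolding. On each horizontal line the pairing is the sum over the frequencies of theta; by
    quasi-periodicity the frequency [d + l n] on the strip over [0, 1] is the frequency [d] on the
    strip over [n, n + 1]. *)
Lemma pairing_theta tau l w f d : (0 < Im tau)%R -> (0 < l)%nat -> (forall z, continuous f z) ->
  quasi_periodic tau (Z.of_nat l) w f ->
  (exists M, zdom M (pair_term tau (Z.of_nat l) w (Z.of_nat d) (fcoef (Z.of_nat d) f))) /\
  wint tau (Z.of_nat l) w (fun z => f z * Cconj (basis_H0 tau l w d z))
  = / theta_coef tau (Z.of_nat l) w (Z.of_nat d) * ZSeries (pair_term tau (Z.of_nat l) w (Z.of_nat d) (fcoef (Z.of_nat d) f)).
Proof.
  intros Ht Hl Hf Hq. set (lz := Z.of_nat l) in *. set (dz := Z.of_nat d).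
  assert (Hlz : (0 < lz)%Z) by (unfold lz; lia). assert (Hlz' := IZR_lt 0 lz Hlz).
  assert (HR : rapid (theta_coefs tau lz w dz)) by now apply theta_coefs_rapid.
  set (G := fun y n r => f (r, y) * Cconj (theta_coefs tau lz w dz n * em (lz * n + dz) (r, y))).
  assert (HGc : forall y n, ccont (G y n)) by (unfold G; cont).
  assert (HGd : forall y K M, (0 <= K)%R -> (forall r, (0 <= r <= 1)%R -> (Cmod (f (r, y)) <= K)%R) ->
    (forall z, (Rabs (Im z) <= Rabs y)%R -> zdom M (fun n => theta_coefs tau lz w dz n * em (lz * n + dz) z)) ->
    forall r, (0 <= r <= 1)%R -> zdom (K * M) (fun n => G y n r)).
  { intros y K M HK0 HK HM r Hr n. unfold G. rewrite Cmod_mult, Cmod_conj, Rmult_assoc.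
    apply Rmult_le_compat; try apply Cmod_ge_0; [now apply HK|]. apply (HM (r, y)). simpl; lra. }
  set (T := fun n s => RtoC (exp (- wexp tau lz w s)) * cint (G (Im tau * s)%R n) 0 1).
  assert (ET : forall n s, T n s = / theta_coef tau lz w dz * (fcoef dz f (Im tau * (s + IZR n)) * gauss_weight tau lz w dz (s + IZR n))).
  { intros n s. unfold T, G, theta_coefs. rewrite <- theta_pair_row by auto. rewrite (fcoef_qp_iter tau lz w f dz n) by auto. unfold gauss_weight.
    replace (Im tau * s + Im tau * IZR n)%R with (Im tau * (s + IZR n))%R by ring.
    replace (s + IZR (lz * n + dz) / IZR lz)%R with (s + IZR n + IZR dz / IZR lz)%R by (rewrite plus_IZR, mult_IZR; field; lra).
    field. apply theta_coef_neq_0. }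
  assert (HTc : forall n, ccont (T n)).
  { intro n. apply (ccont_ext (fun s => / theta_coef tau lz w dz * (fcoef dz f (Im tau * (s + IZR n)) * gauss_weight tau lz w dz (s + IZR n)))).
    { intro; now rewrite ET. }
    cont. }
  assert (Hin : forall s, ZSeries (fun n => T n s) = cint (fun r => f (r, (Im tau * s)%R) * Cconj (basis_H0 tau l w d (r, (Im tau * s)%R))) 0 1 * RtoC (exp (- wexp tau lz w s))).
  { intro s. set (y := (Im tau * s)%R).
    destruct (bounded_rectangle_C (fun z => f (Re z, y)) 0 (Rle_refl _)) as (K & HK0 & HK); [cont|].
    destruct (fser_dom lz dz _ (Rabs y) HR) as [M HM].
    assert (HD : forall r, (0 <= r <= 1)%R -> zdom (K * M) (fun n => G y n r)).
    { apply HGd; auto. intros r Hr. apply (HK (r, 0%R)); simpl; lra. }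
    assert (EG : forall r, ZSeries (fun n => G y n r) = f (r, y) * Cconj (basis_H0 tau l w d (r, y))).
    { intro r. rewrite basis_fser by auto. unfold fser. pose proof (HM (r, y) ltac:(simpl; lra)) as HM'.
      rewrite (zs_conj M) by exact HM'. rewrite <- (zs_scal M); [reflexivity|]. intro n. rewrite Cmod_conj. apply HM'. }
    destruct (zs_int (G y) 0 1 (K * M)) as [D E]; auto.
    { apply (ccont_ext (fun r => f (r, y) * Cconj (basis_H0 tau l w d (r, y)))); [intro; now rewrite EG|]. cont. }
    { intros r Hr. rewrite Rmin_left, Rmax_right in Hr by lra. now apply HD. }
    rewrite (cint_ext _ _ _ _ EG) in E. rewrite E, Cmult_comm. apply (zs_scal _ _ _ D). }
  (* Integrating the series in [s] needs a bound uniform in [s]. *)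
  assert (HD : exists M, forall s, (0 <= s <= 1)%R -> zdom M (fun n => T n s)).
  { destruct (bounded_rectangle_C f (Im tau) ltac:(lra) Hf) as (K & HK0 & HK).
    destruct (bounded_rectangle (fun z => exp (- wexp tau lz w (Re z))) 0 (Rle_refl _)) as [K2 HK2]; [cont|].
    destruct (fser_dom lz dz _ (Im tau) HR) as [M HM].
    exists (K2 * ((1 - 0) * (K * M)))%R. intros s Hs n. set (y := (Im tau * s)%R).
    assert (Hy : (0 <= y <= Im tau)%R) by (unfold y; nra).
    unfold T. rewrite Cmod_mult, Cmod_R, Rmult_assoc. apply Rmult_le_compat; [apply Rabs_pos|apply Cmod_ge_0| |].
    - apply (HK2 (s, 0%R)); simpl; lra.
    - rewrite Rmult_assoc. apply cint_bound; [lra|apply HGc|]. intros r Hr. apply HGd; auto.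
      intros z Hz. apply HM. fold y in Hz. rewrite (Rabs_pos_eq y) in Hz by lra. lra. }
  destruct HD as [M HM].
  destruct (zs_int T 0 1 M) as [D E]; auto.
  { apply (ccont_ext _ _ (fun s => eq_sym (Hin s))).
    apply (wint_integrand tau lz w (fun z => f z * Cconj (basis_H0 tau l w d z))). cont. }
  { intros s Hs. rewrite Rmin_left, Rmax_right in Hs by lra. now apply HM. }
  assert (EI : forall n, cint (T n) 0 1 = / theta_coef tau lz w dz * pair_term tau lz w dz (fcoef dz f) n).
  { intro n. unfold pair_term. rewrite <- cint_scal by cont. apply cint_ext. intro s. apply ET. }
  assert (HZ : exists M', zdom M' (pair_term tau lz w dz (fcoef dz f))).
  { eexists. intro n. replace (pair_term tau lz w dz (fcoef dz f) n) with (theta_coef tau lz w dz * cint (T n) 0 1) by (rewrite EI; field; apply theta_coef_neq_0).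
    apply (zdom_scal _ _ _ D n). }
  split; auto. destruct HZ as [M' HZ]. rewrite <- (zs_scal M') by exact HZ.
  rewrite <- (zs_ext _ _ EI), <- E. unfold wint. apply cint_ext. intro s. symmetry. apply Hin.
Qed.

(** * Orthogonal projection to holomorphic sections *)

(** The derivative in [Re z] integrates to 0 over a period, so [dIm F] may be replaced by [2 / i *
    dbar F]. *)
Lemma periodic_stokes (F : C -> C) y : smooth F -> (forall z, F (z + 1) = F z) ->
  cderiv (fun y => cint (fun r => F (r, y)) 0 1) y (2 / Ci * cint (fun r => dbar F (r, y)) 0 1).
Proof.
  intros HF Hp.
  assert (H1 := smooth_cont _ HF). assert (HR := smooth_cont _ (smooth_dRe _ HF)). assert (HI := smooth_cont _ (smooth_dIm _ HF)).
  assert (Hd := smooth_cont _ (smooth_dbar _ HF)).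
  eapply cderiv_eq.
  - apply (cint_param_deriv F (dIm F) 0 1 y); auto; [lra|]. intro z. apply (Cn_dI 0 F (HF 1%nat)).
  - assert (E0 : cint (fun r => dRe F (r, y)) 0 1 = 0).
    { rewrite (cint_FTC (fun r => F (r, y))).
      - replace ((1%R, y) : C) with (((0%R, y) : C) + 1) by (apply C_ext; simpl; ring). rewrite Hp. ring.
      - intro r. exact (Cn_dR 0 F (HF 1%nat) (r, y)).
      - cont. }
    rewrite <- cint_scal by cont.
    transitivity (cint (fun r => dIm F (r, y)) 0 1 + (/ Ci) * cint (fun r => dRe F (r, y)) 0 1); [rewrite E0; ring|].
    rewrite <- cint_scal by cont.
    rewrite <- (cint_plus (fun r => dIm F (r, y)) (fun r => / Ci * dRe F (r, y))).
    + apply cint_ext. intro r. unfold dbar. field. apply Ci_nz.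
    + cont.
    + cont.
Qed.
Lemma ex_partials_em m z : ex_partials (em m) z.
Proof. apply (Cn_em 1 m). Qed.
Lemma fcoef_deriv m f y : smooth f -> (forall z, f (z + 1) = f z) ->
  cderiv (fcoef m f) y (2 / Ci * fcoef m (dbar f) y).
Proof.
  intros Hf Hp. unfold fcoef.
  assert (HF : smooth (fun z => f z * em (- m) z)) by (apply smooth_mult; auto; intro; apply Cn_em).
  eapply cderiv_eq; [apply (periodic_stokes (fun z => f z * em (- m) z) y HF)|].
  - intro z. now rewrite Hp, em_periodic.
  - f_equal. apply cint_ext. intro r. rewrite dbar_mult; [|now apply smooth_partials|apply ex_partials_em].
    rewrite dbar_em. ring.
Qed.
Lemma fcoef_integral m f y : smooth f -> (forall z, f (z + 1) = f z) ->
  fcoef m f y = fcoef m f 0 + 2 / Ci * cint (fcoef m (dbar f)) 0 y.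
Proof.
  intros Hf Hp. assert (Hc := fcoef_cont m (dbar f) (smooth_cont _ (smooth_dbar _ Hf))).
  rewrite <- cint_scal by exact Hc. rewrite (cint_FTC (fcoef m f)).
  - ring.
  - intro t. now apply fcoef_deriv.
  - cont.
Qed.

(** The squared norm of the theta function of index [d], see [theta_norm_dom]. *)
Definition theta_norm (tau : C) (l : Z) (w : C) (d : Z) : C := ZSeries (pair_term tau l w d (fun _ => 1)).
Definition fcoef_prim (d : Z) (om : C -> C) (y : R) : C := cint (fcoef d om) 0 y.
(** The linear functional of [dbar f] by which the pairing of [f] with a theta function differs
    from the Fourier coefficient of [f] on the real axis. *)
Definition dbar_pair (tau : C) (l : Z) (w : C) (d : Z) (om : C -> C) : C := ZSeries (pair_term tau l w d (fcoef_prim d om)).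

Lemma pair_term_integrand tau l w d c n : ccont c -> ccont (fun s => c (Im tau * (s + IZR n))%R * gauss_weight tau l w d (s + IZR n)).
Proof.
  intro Hc. apply ccont_mult.
  - cont.
  - cont.
Qed.
Lemma pair_term_lin tau l w d p c c' n : ccont c -> ccont c' ->
  pair_term tau l w d (fun y => p * c y + c' y) n = p * pair_term tau l w d c n + pair_term tau l w d c' n.
Proof.
  intros Hc Hc'. unfold pair_term.
  pose proof (pair_term_integrand tau l w d c n Hc) as K. pose proof (pair_term_integrand tau l w d c' n Hc') as K'.
  set (A := fun s => c (Im tau * (s + IZR n))%R * gauss_weight tau l w d (s + IZR n)) in *.
  set (B := fun s => c' (Im tau * (s + IZR n))%R * gauss_weight tau l w d (s + IZR n)) in *.
  transitivity (cint (fun s => p * A s + B s) 0 1); [apply cint_ext; intro s; unfold A, B; ring|].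
  rewrite (cint_plus (fun s => p * A s) B), (cint_scal p A); auto. apply ccont_mult; auto. apply ccont_const.
Qed.
Lemma fcoef_prim_cont d om : (forall z, continuous om z) -> ccont (fcoef_prim d om).
Proof. intros H y. apply (cderiv_continuous (fcoef_prim d om) y (fcoef d om y)). apply cint_deriv. now apply fcoef_cont. Qed.
#[export] Hint Resolve fcoef_prim_cont : cont.
Lemma fcoef_prim_lin d p f g y : (forall z, continuous f z) -> (forall z, continuous g z) ->
  fcoef_prim d (fun z => p * f z + g z) y = p * fcoef_prim d f y + fcoef_prim d g y.
Proof.
  intros Hf Hg. unfold fcoef_prim. pose proof (fcoef_cont d f Hf). pose proof (fcoef_cont d g Hg).
  transitivity (cint (fun s => p * fcoef d f s + fcoef d g s) 0 y); [apply cint_ext; intro s; now apply fcoef_lin|].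
  rewrite (cint_plus (fun s => p * fcoef d f s) (fcoef d g)), (cint_scal p (fcoef d f)); auto. apply ccont_mult; auto. apply ccont_const.
Qed.

(** The section is bounded by the inverse square root of the metric weight, and integrating it
    costs a factor [|y|]; the full weight dominates both. *)
Lemma dbar_pair_dom tau l w d om : (0 < Im tau)%R -> (0 < l)%Z -> (forall z, continuous om z) -> quasi_periodic tau l w om ->
  exists M, zdom M (pair_term tau l w d (fcoef_prim d om)).
Proof.
  intros Ht Hl Hc Hq. assert (Hl' := IZR_lt 0 l Hl).
  destruct (section_bound tau l w om Ht Hc Hq) as (K & HK & Hb). pose proof PI_RGT_0 as Hpi.
  set (t := Im tau) in *. assert (Hpt : (0 < PI * t)%R) by (apply Rmult_lt_0_compat; lra). set (w2 := coord2 tau w). set (B := (2 * PI * t * Rabs (w2 + IZR d))%R).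
  assert (HB : (0 <= B)%R). { unfold B. apply Rmult_le_pos; [lra|apply Rabs_pos]. }
  set (C0 := (- (2 * PI * t * (IZR d ^ 2 / IZR l + 2 * IZR d * w2 / IZR l)))%R).
  set (c := (PI * t * IZR l)%R).
  assert (Hcp : (0 < c)%R) by (unfold c; apply Rmult_lt_0_compat; lra).
  (* In the variable [v = y / t] all bounds are exponentials of quadratic functions. *)
  assert (HF : forall v, (Cmod (fcoef d om (t * v)) <= K * exp (c * v ^ 2 + B * Rabs v))%R).
  { intro v. replace (K * exp (c * v ^ 2 + B * Rabs v))%R with ((1 - 0) * (K * exp (c * v ^ 2 + B * Rabs v)))%R by ring.
    unfold fcoef. apply cint_bound; [lra|now apply fcoef_integrand_cont|]. intros r _.
    rewrite Cmod_mult, Cmod_em. eapply Rle_trans; [apply Rmult_le_compat_r; [left; apply exp_pos|apply Hb]|].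
    rewrite Rmult_assoc, <- exp_plus. apply Rmult_le_compat_l; auto. apply exp_le.
    simpl Im. replace (t * v / t)%R with v by (field; lra). unfold wexp. fold t w2. rewrite opp_IZR.
    replace (2 * PI * t * (IZR l * v ^ 2 + 2 * v * w2) / 2 + - (2 * PI * - IZR d * (t * v)))%R
      with (c * v ^ 2 + (2 * PI * t) * ((w2 + IZR d) * v))%R by (unfold c; field).
    apply Rplus_le_compat_l. unfold B. rewrite !Rmult_assoc. apply Rmult_le_compat_l; [lra|].
    apply Rmult_le_compat_l; [lra|]. apply Rmult_le_compat_l; [lra|].
    rewrite <- Rabs_mult. apply Rle_abs. }
  assert (HO : forall v, (Cmod (fcoef_prim d om (t * v)) <= t * Rabs v * (K * exp (c * v ^ 2 + B * Rabs v)))%R).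
  { intro v. unfold fcoef_prim. replace (t * Rabs v)%R with (Rabs (t * v - 0))%R.
    2:{ rewrite Rminus_0_r, Rabs_mult, (Rabs_right t); auto. lra. }
    apply cint_bound_abs; [now apply fcoef_cont|]. intros y Hy.
    set (v' := (y / t)%R). assert (Ey : y = (t * v')%R) by (unfold v'; field; lra).
    rewrite Ey. eapply Rle_trans; [apply HF|]. apply Rmult_le_compat_l; auto. apply exp_le.
    assert (Hv : (Rabs v' <= Rabs v)%R).
    { assert (A1 : Rabs y = (t * Rabs v')%R) by (rewrite Ey, Rabs_mult, (Rabs_right t) by lra; reflexivity).
      assert (A2 : Rabs (t * v) = (t * Rabs v)%R) by (rewrite Rabs_mult, (Rabs_right t) by lra; reflexivity).
      apply (Rmult_le_reg_l t); [auto|]. rewrite <- A1, <- A2.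
      unfold Rmin, Rmax in Hy. destruct (Rle_dec 0 (t * v)); [rewrite !Rabs_right by lra; lra|rewrite !Rabs_left1 by lra; lra]. }
    assert (Hv2 : (v' ^ 2 <= v ^ 2)%R).
    { rewrite <- (Rabs_pos_eq (v' ^ 2)), <- (Rabs_pos_eq (v ^ 2)), <- !RPow_abs by apply pow2_ge_0. apply pow_incr. split; [apply Rabs_pos|auto]. }
    apply Rplus_le_compat; apply Rmult_le_compat_l; lra. }
  assert (HG : forall v, (Cmod (gauss_weight tau l w d v) <= exp (C0 + 2 * B * Rabs v - 2 * c * v ^ 2))%R).
  { intro v. unfold gauss_weight. rewrite Cmod_R, Rabs_right by (left; apply exp_pos). apply exp_le.
    unfold wexp. fold t w2.
    replace (- (2 * PI * t * (IZR l * (v + IZR d / IZR l) ^ 2 + 2 * (v + IZR d / IZR l) * w2)))%R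
      with (C0 + (2 * (2 * PI * t)) * ((w2 + IZR d) * - v) - 2 * c * v ^ 2)%R by (unfold C0, c; field; lra).
    apply Rplus_le_compat_r, Rplus_le_compat_l. unfold B. 
    replace (2 * (2 * PI * t * Rabs (w2 + IZR d)) * Rabs v)%R with ((2 * (2 * PI * t)) * (Rabs (w2 + IZR d) * Rabs v))%R by ring.
    apply Rmult_le_compat_l; [assert (0 < PI * t)%R by (now apply Rmult_lt_0_compat); lra|].
    rewrite <- (Rabs_Ropp v), <- Rabs_mult. apply Rle_abs. }
  destruct (gauss_dom (C0 + (1 + 3 * B)) ((1 + 3 * B) + 2 * c) c Hcp) as (M & HM & G).
  exists (t * K * M)%R. intro n. unfold pair_term.
  replace (t * K * M * (/ 2) ^ Z.abs_nat n)%R with ((1 - 0) * (t * K * (M * (/ 2) ^ Z.abs_nat n)))%R by ring.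
  apply cint_bound; [lra| |].
  - cont.
  - intros s Hs. set (v := (s + IZR n)%R). rewrite Cmod_mult.
    eapply Rle_trans; [apply Rmult_le_compat; [apply Cmod_ge_0|apply Cmod_ge_0|apply HO|apply HG]|].
    replace (t * Rabs v * (K * exp (c * v ^ 2 + B * Rabs v)) * exp (C0 + 2 * B * Rabs v - 2 * c * v ^ 2))%R
      with (t * K * (Rabs v * exp (c * v ^ 2 + B * Rabs v + (C0 + 2 * B * Rabs v - 2 * c * v ^ 2))))%R by (rewrite exp_plus; ring).
    apply Rmult_le_compat_l; [apply Rmult_le_pos; lra|].
    eapply Rle_trans; [apply Rmult_le_compat_r; [left; apply exp_pos|]|].
    { assert (Rabs v <= exp (Rabs v))%R by (pose proof (exp_ineq1_le (Rabs v)); lra). exact H. }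
    rewrite <- exp_plus. apply G.
    assert (Hv1 : (Rabs v <= Rabs (IZR n) + 1)%R).
    { unfold v. eapply Rle_trans; [apply Rabs_triang|]. rewrite (Rabs_right s) by lra. lra. }
    assert (Hv2 : (IZR n ^ 2 - 2 * Rabs (IZR n) <= v ^ 2)%R).
    { unfold v. pose proof (abs_prod_le s (IZR n) 1 ltac:(rewrite Rabs_right; lra)). pose proof (pow2_ge_0 s). 
      replace ((s + IZR n) ^ 2)%R with (IZR n ^ 2 + 2 * (IZR n * s) + s ^ 2)%R by ring. lra. }
    assert (Hv3 : ((1 + 3 * B) * Rabs v <= (1 + 3 * B) * (Rabs (IZR n) + 1))%R) by (apply Rmult_le_compat_l; lra).
    assert (Hv4 : (c * (IZR n ^ 2 - 2 * Rabs (IZR n)) <= c * v ^ 2)%R) by (apply Rmult_le_compat_l; lra).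
    lra.
Qed.
Lemma dbar_pair_lin tau l w d p f g : (0 < Im tau)%R -> (0 < l)%Z ->
  (forall z, continuous f z) -> quasi_periodic tau l w f -> (forall z, continuous g z) -> quasi_periodic tau l w g ->
  dbar_pair tau l w d (fun z => p * f z + g z) = p * dbar_pair tau l w d f + dbar_pair tau l w d g.
Proof.
  intros Ht Hl Hf Hqf Hg Hqg. unfold dbar_pair.
  destruct (dbar_pair_dom tau l w d f Ht Hl Hf Hqf) as [M1 H1]. destruct (dbar_pair_dom tau l w d g Ht Hl Hg Hqg) as [M2 H2].
  rewrite <- (zs_scal _ p _ H1), <- (zs_plus _ _ _ _ (zdom_scal _ p _ H1) H2). apply zs_ext. intro n.
  rewrite <- pair_term_lin by cont. unfold pair_term. apply cint_ext. intro s. now rewrite fcoef_prim_lin.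
Qed.

Lemma pair_term_ext tau l w d c c' : (forall y, c y = c' y) -> forall n, pair_term tau l w d c n = pair_term tau l w d c' n.
Proof. intros H n. apply cint_ext. intro s. now rewrite H. Qed.
Lemma pair_term_scal tau l w d p c n : ccont c -> pair_term tau l w d (fun y => p * c y) n = p * pair_term tau l w d c n.
Proof.
  intros Hc. unfold pair_term. rewrite <- cint_scal by now apply pair_term_integrand. apply cint_ext. intro; ring.
Qed.

Lemma theta_norm_dom tau l w d : (0 < Im tau)%R -> (0 < l)%nat -> (d < l)%nat ->
  (exists M, zdom M (pair_term tau (Z.of_nat l) w (Z.of_nat d) (fun _ => 1))) /\
  wint tau (Z.of_nat l) w (fun z => basis_H0 tau l w d z * Cconj (basis_H0 tau l w d z)) = theta_norm tau (Z.of_nat l) w (Z.of_nat d).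
Proof.
  intros Ht Hl Hd.
  destruct (pairing_theta tau l w (basis_H0 tau l w d) d Ht Hl) as [[M HM] E].
  { cont. } { now apply basis_qp. }
  set (T := theta_coef tau (Z.of_nat l) w (Z.of_nat d)) in *. assert (HT : T <> 0) by apply theta_coef_neq_0.
  assert (E1 : forall n, pair_term tau (Z.of_nat l) w (Z.of_nat d) (fcoef (Z.of_nat d) (basis_H0 tau l w d)) n = T * pair_term tau (Z.of_nat l) w (Z.of_nat d) (fun _ => 1) n).
  { intro n. rewrite <- pair_term_scal by cont. apply pair_term_ext. intro y.
    rewrite fcoef_basis_eq by auto. rewrite Z.mod_small, Z.eqb_refl by lia. fold T. ring. }
  assert (HD : zdom (Cmod (/ T) * M) (pair_term tau (Z.of_nat l) w (Z.of_nat d) (fun _ => 1))).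
  { intro n. pose proof (zdom_scal _ (/ T) _ HM n) as K. cbv beta in K. rewrite E1 in K.
    replace (/ T * (T * pair_term tau (Z.of_nat l) w (Z.of_nat d) (fun _ => 1) n)) with (pair_term tau (Z.of_nat l) w (Z.of_nat d) (fun _ => 1) n) in K by (field; auto). exact K. }
  split; [eexists; exact HD|]. rewrite E, (zs_ext _ _ E1), (zs_scal _ T _ HD). unfold theta_norm. field. auto.
Qed.
Lemma theta_norm_neq_0 tau l w d : (0 < Im tau)%R -> (0 < l)%nat -> (d < l)%nat -> theta_norm tau (Z.of_nat l) w (Z.of_nat d) <> 0.
Proof.
  intros Ht Hl Hd E. destruct (theta_norm_dom tau l w d Ht Hl Hd) as [[M HM] _].
  assert (Hpos : forall n, (0 < Re (pair_term tau (Z.of_nat l) w (Z.of_nat d) (fun _ => 1) n))%R).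
  { intro n. unfold pair_term.
    rewrite (cint_ext _ (fun s => RtoC (exp (- wexp tau (Z.of_nat l) w (s + IZR n + IZR (Z.of_nat d) / IZR (Z.of_nat l)))))).
    2:{ intro s. unfold gauss_weight. ring. }
    assert (Hc : forall s : R, continuous (fun s => exp (- wexp tau (Z.of_nat l) w (s + IZR n + IZR (Z.of_nat d) / IZR (Z.of_nat l)))) s).
    { intro s. apply (ex_derive_continuous (fun s => exp (- wexp tau (Z.of_nat l) w (s + IZR n + IZR (Z.of_nat d) / IZR (Z.of_nat l))))). unfold wexp. auto_derive. auto. }
    rewrite cint_RtoC by exact Hc. simpl. apply RInt_gt_0; [lra| |intros; apply Hc]. intros; apply exp_pos. }
  pose proof (zs_Re_pos M _ HM (fun n => Rlt_le _ _ (Hpos n))) as K. fold (theta_norm tau (Z.of_nat l) w (Z.of_nat d)) in K.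
  rewrite E in K. pose proof (Hpos 0%Z). simpl in K. simpl in H. lra.
Qed.
Lemma basis_orth tau l w c d : (0 < Im tau)%R -> (0 < l)%nat -> (c < l)%nat -> (d < l)%nat -> c <> d ->
  wint tau (Z.of_nat l) w (fun z => basis_H0 tau l w c z * Cconj (basis_H0 tau l w d z)) = 0.
Proof.
  intros Ht Hl Hc Hd Hcd.
  destruct (pairing_theta tau l w (basis_H0 tau l w c) d Ht Hl) as [_ E].
  { cont. } { now apply basis_qp. }
  rewrite E. rewrite (zs_ext _ (fun _ => 0)); [rewrite zs_0; ring|]. intro n. unfold pair_term.
  rewrite (cint_ext _ (fun _ => 0)); [rewrite cint_const; ring|]. intro s. rewrite fcoef_basis_eq by auto.
  rewrite Z.mod_small by lia. destruct (Z.eqb_spec (Z.of_nat d) (Z.of_nat c)); [lia|]. ring.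
Qed.
(** Insert the Stokes formula [fcoef_integral] into the unfolded pairing. *)
Lemma pairing_smooth tau l w f d : (0 < Im tau)%R -> (0 < l)%nat -> (d < l)%nat -> smooth f ->
  quasi_periodic tau (Z.of_nat l) w f -> quasi_periodic tau (Z.of_nat l) w (dbar f) ->
  wint tau (Z.of_nat l) w (fun z => f z * Cconj (basis_H0 tau l w d z))
  = / theta_coef tau (Z.of_nat l) w (Z.of_nat d) * (fcoef (Z.of_nat d) f 0 * theta_norm tau (Z.of_nat l) w (Z.of_nat d)
     + 2 / Ci * dbar_pair tau (Z.of_nat l) w (Z.of_nat d) (dbar f)).
Proof.
  intros Ht Hl Hd Hf Hq Hqd.
  assert (Hdc := smooth_cont _ (smooth_dbar _ Hf)).
  destruct (pairing_theta tau l w f d Ht Hl (smooth_cont _ Hf) Hq) as [_ E]. rewrite E. f_equal.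
  destruct (theta_norm_dom tau l w d Ht Hl Hd) as [[M1 H1] _].
  destruct (dbar_pair_dom tau (Z.of_nat l) w (Z.of_nat d) (dbar f) Ht ltac:(lia) Hdc Hqd) as [M2 H2].
  unfold theta_norm, dbar_pair. rewrite <- (zs_scal _ (fcoef (Z.of_nat d) f 0) _ H1), <- (zs_scal _ (2 / Ci) _ H2).
  rewrite <- (zs_plus _ _ _ _ (zdom_scal _ (fcoef (Z.of_nat d) f 0) _ H1) (zdom_scal _ (2 / Ci) _ H2)).
  apply zs_ext. intro n.
  assert (Hpc := fcoef_prim_cont (Z.of_nat d) (dbar f) Hdc).
  rewrite <- (pair_term_scal _ _ _ _ (2 / Ci) (fcoef_prim (Z.of_nat d) (dbar f))) by exact Hpc.
  rewrite <- pair_term_lin.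
  - apply pair_term_ext. intro y. rewrite (fcoef_integral (Z.of_nat d) f y Hf) by (intro; apply Hq). unfold fcoef_prim. ring.
  - cont.
  - cont.
Qed.

Lemma qp_minus tau k u f g : quasi_periodic tau k u f -> quasi_periodic tau k u g -> quasi_periodic tau k u (fun z => f z - g z).
Proof.
  intros Hf Hg x. destruct (Hf x) as [F1 F2]. destruct (Hg x) as [G1 G2]. split; [now rewrite F1, G1|].
  rewrite F2, G2. ring.
Qed.
Lemma herm_H0 tau l w f s : (0 < Im tau)%R -> (0 < l)%nat -> (forall z, continuous f z) ->
  quasi_periodic tau (Z.of_nat l) w f -> H0 tau (Z.of_nat l) w s ->
  herm tau (Z.of_nat l) w f s = wint tau (Z.of_nat l) w (fun z => f z * Cconj (s z)).
Proof.
  intros Ht Hl Hf Hq Hs. apply herm_wint; auto. { now apply (H0_cont _ _ _ _ Hs). }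
  - intro; apply Hq. - intro; apply (proj2 Hs).
Qed.
Definition pcoef (tau : C) (l : nat) (w : C) (f : C -> C) (d : nat) : C :=
  wint tau (Z.of_nat l) w (fun z => f z * Cconj (basis_H0 tau l w d z)) / theta_norm tau (Z.of_nat l) w (Z.of_nat d).
Lemma wint_comb_basis tau l w (p : nat -> C) d : (0 < Im tau)%R -> (0 < l)%nat -> (d < l)%nat ->
  wint tau (Z.of_nat l) w (fun z => Csum l (fun i => p i * basis_H0 tau l w i z) * Cconj (basis_H0 tau l w d z))
  = p d * theta_norm tau (Z.of_nat l) w (Z.of_nat d).
Proof.
  intros Ht Hl Hd.
  rewrite (wint_ext _ _ _ _ (fun z => Csum l (fun i => p i * (basis_H0 tau l w i z * Cconj (basis_H0 tau l w d z))))).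
  2:{ intro z. rewrite Cmult_comm, <- Csum_scal. apply Csum_ext. intros; ring. }
  rewrite (wint_csum _ _ _ l p (fun i z => basis_H0 tau l w i z * Cconj (basis_H0 tau l w d z))).
  2:{ cont. }
  rewrite (Csum_single l (fun i => p i * wint tau (Z.of_nat l) w (fun z => basis_H0 tau l w i z * Cconj (basis_H0 tau l w d z))) d Hd).
  - now rewrite (proj2 (theta_norm_dom tau l w d Ht Hl Hd)).
  - intros i Hi Hne. rewrite basis_orth by auto. ring.
Qed.
(** The theta functions are orthogonal with nonzero norms. Their combination with coefficients
    [pcoef] is therefore a projection, and the coordinates of any projection are forced. *)
Lemma pr_formula tau l w f : (0 < Im tau)%R -> (0 < l)%nat -> (forall z, continuous f z) ->
  quasi_periodic tau (Z.of_nat l) w f ->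
  forall x, pr tau (Z.of_nat l) w f x = Csum l (fun d => pcoef tau l w f d * basis_H0 tau l w d x).
Proof.
  intros Ht Hl Hf Hq.
  assert (Hspec : H0 tau (Z.of_nat l) w (pr tau (Z.of_nat l) w f) /\
    forall s, H0 tau (Z.of_nat l) w s -> herm tau (Z.of_nat l) w (fun x => f x - pr tau (Z.of_nat l) w f x) s = 0).
  { unfold pr. apply epsilon_spec. exists (fun x => Csum l (fun d => pcoef tau l w f d * basis_H0 tau l w d x)).
    assert (HG : H0 tau (Z.of_nat l) w (fun x => Csum l (fun d => pcoef tau l w f d * basis_H0 tau l w d x))).
    { apply H0_csum. intro i. now apply basis_H0_H0. }
    split; auto. intros s Hs. set (g := fun x => Csum l (fun d => pcoef tau l w f d * basis_H0 tau l w d x)) in *.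
    assert (Hgc := H0_cont _ _ _ _ HG). assert (Hsc := H0_cont _ _ _ _ Hs).
    change (herm tau (Z.of_nat l) w (fun x => f x - g x) s = 0).
    rewrite herm_H0; auto.
    2:{ cont. }
    2:{ apply qp_minus; [exact Hq|apply HG]. }
    rewrite (wint_ext _ _ _ _ (fun z => Csum l (fun d => Cconj (coord_H0 tau l w s d) * ((f z - g z) * Cconj (basis_H0 tau l w d z))))).
    2:{ intro z. rewrite (H0_span tau l w s Ht Hl Hs z), Csum_conj, <- Csum_scal. apply Csum_ext. intros i Hi. rewrite Cmult_conj. ring. }
    rewrite (wint_csum _ _ _ l (fun d => Cconj (coord_H0 tau l w s d)) (fun d z => (f z - g z) * Cconj (basis_H0 tau l w d z))).
    2:{ cont. }
    apply Csum_0. intros d Hd.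
    rewrite (wint_ext _ _ _ _ (fun z => (- (1)) * (g z * Cconj (basis_H0 tau l w d z)) + f z * Cconj (basis_H0 tau l w d z))) by (intro; ring).
    rewrite wint_lin.
    - unfold g. rewrite wint_comb_basis by auto. unfold pcoef. field. now apply theta_norm_neq_0.
    - cont.
    - cont. }
  destruct Hspec as [HG Ho]. set (g := pr tau (Z.of_nat l) w f) in *.
  assert (Hgc := H0_cont _ _ _ _ HG).
  intro x. rewrite (H0_span tau l w g Ht Hl HG x). apply Csum_ext. intros d Hd. f_equal.
  specialize (Ho _ (basis_H0_H0 tau l w d Ht Hl)).
  rewrite herm_H0 in Ho; auto.
  2:{ cont. }
  2:{ apply qp_minus; [exact Hq|apply HG]. }
  2: now apply basis_H0_H0.
  rewrite (wint_ext _ _ _ _ (fun z => (- (1)) * (g z * Cconj (basis_H0 tau l w d z)) + f z * Cconj (basis_H0 tau l w d z))) in Ho by (intro; ring).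
  rewrite wint_lin in Ho.
  - rewrite (wint_ext _ _ _ (fun z => g z * Cconj (basis_H0 tau l w d z)) (fun z => Csum l (fun i => coord_H0 tau l w g i * basis_H0 tau l w i z) * Cconj (basis_H0 tau l w d z))) in Ho.
    2:{ intro z. now rewrite <- (H0_span tau l w g Ht Hl HG z). }
    rewrite wint_comb_basis in Ho by auto. unfold pcoef.
    pose proof (theta_norm_neq_0 tau l w d Ht Hl Hd) as HN.
    set (X := wint _ _ _ _) in *. replace X with (coord_H0 tau l w g d * theta_norm tau (Z.of_nat l) w (Z.of_nat d)).
    + field. auto.
    + symmetry. apply Ceq_minus. rewrite <- Ho. ring.
  - cont.
  - cont.
Qed.

(** * Harmonic forms *)

Lemma cderiv_shift f c t l : cderiv f (t + c)%R l -> cderiv (fun s => f (s + c)%R) t l.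
Proof.
  intro H. eapply cderiv_eq.
  - apply (is_derive_comp (V := C_R_NormedModule) f (fun s => (s + c)%R) t l 1%R H). auto_derive; auto.
  - rewrite scal_R_Cmult. ring.
Qed.
Lemma dbar_translate f w z : ex_partials f (z + w) -> dbar (fun x => f (x + w)) z = dbar f (z + w).
Proof.
  intro H. unfold dbar at 2. apply dbar_intro.
  - apply (cderiv_ext (fun s => f ((s + Re w)%R, Im (z + w)))).
    { intro s. apply (f_equal f). apply C_ext; destruct z, w; simpl; ring. }
    apply (cderiv_shift (fun s => f (s, Im (z + w))) (Re w) (Re z)).
    replace (Re z + Re w)%R with (Re (z + w)) by apply re_plus. now apply partials_dRe.
  - apply (cderiv_ext (fun s => f (Re (z + w), (s + Im w)%R))).
    { intro s. apply (f_equal f). apply C_ext; destruct z, w; simpl; ring. }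
    apply (cderiv_shift (fun s => f (Re (z + w), s)) (Im w) (Im z)).
    replace (Im z + Im w)%R with (Im (z + w)) by apply im_plus. now apply partials_dIm.
Qed.
Lemma dbar_ext f g z : (forall x, f x = g x) -> dbar f z = dbar g z.
Proof. intro H. apply (f_equal (fun F => dbar F z)). now apply functional_extensionality. Qed.
(** The multipliers are holomorphic. *)
Lemma dbar_qp tau k u f : smooth f -> quasi_periodic tau k u f -> quasi_periodic tau k u (dbar f).
Proof.
  intros Hf Hq z. assert (Hp := smooth_partials _ Hf). split.
  - rewrite <- (dbar_translate f 1 z) by auto. apply dbar_ext. intro x. apply Hq.
  - rewrite <- (dbar_translate f tau z) by auto.
    set (c := cexp (- (PI * Ci * IZR k * tau) - 2 * PI * Ci * u)).
    rewrite (dbar_ext _ (fun x => c * (em (- k) x * f x))).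
    2:{ intro x. rewrite (proj2 (Hq x)). fold (mult_tau tau k u x). rewrite mult_tau_em. unfold c. ring. }
    assert (Hef : ex_partials (fun x => em (- k) x * f x) z).
    { apply (Cn_mult 1 (em (- k)) f); [apply Cn_em|apply Hf]. }
    rewrite (dbar_scal c (fun x => em (- k) x * f x)) by exact Hef.
    rewrite (dbar_mult (em (- k)) f), dbar_em by (auto; apply ex_partials_em).
    fold (mult_tau tau k u z). rewrite mult_tau_em. fold c. ring.
Qed.

Definition gauss_rate (tau : C) (k : Z) : R := (2 * PI * IZR k / Im tau)%R.
Lemma conj_mult_tau tau k z : (0 < Im tau)%R ->
  Cconj (mult_tau tau k 0 z) * gauss (gauss_rate tau k) (z + tau) = mult_tau tau (- k) 0 z * gauss (gauss_rate tau k) z.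
Proof.
  intro Ht. unfold mult_tau, gauss. rewrite cexp_conj, <- !cexp_R, <- !cexp_plus. apply (f_equal cexp). rewrite opp_IZR.
  unfold gauss_rate. destruct tau as [t1 t2], z as [x y]. simpl in Ht. apply C_ext; simpl; field; lra.
Qed.
Lemma conj_gauss_qp tau k f : (0 < Im tau)%R -> quasi_periodic tau k 0 f ->
  quasi_periodic tau (- k) 0 (fun z => Cconj (f z) * gauss (gauss_rate tau k) z).
Proof.
  intros Ht Hq z. destruct (Hq z) as [Q1 Q2]. split.
  - rewrite Q1. unfold gauss. replace (Im (z + 1)) with (Im z) by (destruct z; simpl; ring). reflexivity.
  - rewrite Q2. fold (mult_tau tau k 0 z) (mult_tau tau (- k) 0 z). rewrite Cmult_conj.
    transitivity (Cconj (f z) * (Cconj (mult_tau tau k 0 z) * gauss (gauss_rate tau k) (z + tau))); [ring|].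
    rewrite conj_mult_tau by auto. ring.
Qed.
Lemma gauss_inv c z : gauss c z * gauss (- c) z = 1.
Proof. unfold gauss. rewrite <- RtoC_mult, <- exp_plus. replace (- (c * Im z ^ 2) + - (- c * Im z ^ 2))%R with 0%R by ring. now rewrite exp_0. Qed.

Lemma RInt_zero (h : R -> R) : (forall t, continuous h t) -> (forall t, 0 <= h t)%R -> RInt h 0 1 = 0%R ->
  forall t, (0 <= t <= 1)%R -> h t = 0%R.
Proof.
  intros Hc Hp H0 t Ht. destruct (Rle_lt_dec (h t) 0) as [L|L]; [apply Rle_antisym; auto|]. exfalso.
  assert (He : (0 < h t / 2)%R) by lra.
  destruct (proj1 (filterlim_locally h (h t)) (Hc t) (mkposreal _ He)) as [d Hd].
  assert (Hdp := cond_pos d).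
  set (a := Rmax 0 (t - d / 2)). set (b := Rmin 1 (t + d / 2)).
  assert (Ha : (0 <= a <= t)%R /\ (t - d / 2 <= a)%R).
  { unfold a. pose proof (Rmax_l 0 (t - d / 2)). pose proof (Rmax_r 0 (t - d / 2)). repeat split; auto. apply Rmax_lub; lra. }
  assert (Hb : (t <= b <= 1)%R /\ (b <= t + d / 2)%R).
  { unfold b. pose proof (Rmin_l 1 (t + d / 2)). pose proof (Rmin_r 1 (t + d / 2)). repeat split; auto. apply Rmin_glb; lra. }
  assert (Hab : (a < b)%R).
  { unfold a, b. apply Rmax_lub_lt; apply Rmin_glb_lt; lra. }
  assert (Hex : forall u v, ex_RInt h u v) by (intros; now apply rcont_ex).
  rewrite <- (RInt_Chasles h 0 b 1), <- (RInt_Chasles h 0 a b) in H0 by auto. unfold plus in H0; simpl in H0.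
  assert (I1 : (0 <= RInt h 0 a)%R) by (apply RInt_ge_0; auto; lra).
  assert (I2 : (0 <= RInt h b 1)%R) by (apply RInt_ge_0; auto; lra).
  assert (I3 : (0 < RInt h a b)%R).
  { apply RInt_gt_0; auto. intros x Hx. assert (B : ball t d x) by (change (Rabs (x - t) < d)%R; apply Rabs_def1; lra).
    apply Hd in B. change (Rabs (h x - h t) < h t / 2)%R in B. apply Rabs_def2 in B. lra. }
  lra.
Qed.

(** The integral of [dbar F] over a horizontal period is, up to a constant, the derivative in [y]
    of that of [F], which takes the same value at 0 and [t]. *)
Lemma stokes_torus tau F : (0 < Im tau)%R -> smooth F -> (forall z, F (z + 1) = F z) -> (forall z, F (z + tau) = F z) ->
  cint (fun s => cint (fun r => dbar F (r, (Im tau * s)%R)) 0 1) 0 1 = 0.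
Proof.
  intros Ht HF Hp Hq. set (t := Im tau) in *.
  assert (HFc := smooth_cont _ HF). assert (Hdc := smooth_cont _ (smooth_dbar _ HF)).
  set (D := fun y => cint (fun r => dbar F (r, y)) 0 1).
  assert (HD : ccont D) by exact (cint_param_cont (dbar F) 0 1 Rle_0_1 Hdc).
  assert (E : cint D 0 t = 0).
  { assert (E1 : cint (fun y => 2 / Ci * D y) 0 t = 0).
    { rewrite (cint_FTC (fun y => cint (fun r => F (r, y)) 0 1)).
      - rewrite <- (cint_periodic (fun r => F (r, t)) (Re tau)).
        + rewrite (cint_ext (fun r => F ((r + Re tau)%R, t)) (fun r => F (r, 0%R))); [ring|].
          intro r. rewrite <- (Hq (r, 0%R)). apply (f_equal F). rewrite plus_tau. now rewrite Rplus_0_l.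
        + cont.
        + intro r. rewrite <- (Hp (r, t)). apply (f_equal F). apply C_ext; simpl; ring.
      - intro y. now apply periodic_stokes.
      - cont. }
    rewrite cint_scal in E1 by auto.
    replace (cint D 0 t) with (Ci / 2 * (2 / Ci * cint D 0 t)) by (field; apply Ci_nz). rewrite E1. ring. }
  pose proof (cint_lin D t 0 0 1 HD) as L. rewrite Rmult_0_r, Rmult_1_r, !Rplus_0_r in L. rewrite E in L.
  rewrite (cint_ext _ (fun s => RtoC t * D (t * s)%R)) in L by (intro s; now rewrite Rplus_0_r).
  assert (HDt : ccont (fun s => D (t * s)%R)).
  { cont. }
  rewrite (cint_scal t (fun s => D (t * s)%R)) in L by exact HDt.
  change (cint (fun s => D (t * s)%R) 0 1 = 0).
  replace (cint (fun s => D (t * s)%R) 0 1) with (/ t * (t * cint (fun s => D (t * s)%R) 0 1)).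
  - rewrite L. ring.
  - field. apply RtoC_neq_0. lra.
Qed.

Lemma exp_wexp_gauss tau k r s : (0 < Im tau)%R ->
  RtoC (exp (- wexp tau (- k) 0 s)) = gauss (- gauss_rate tau k) (r, (Im tau * s)%R).
Proof.
  intro Ht. unfold gauss, wexp, gauss_rate, coord2. apply (f_equal RtoC), (f_equal exp). rewrite opp_IZR. simpl. field. lra.
Qed.
(** Call this function [G]; it is a smooth section of L(k,0). Orthogonality of [alpha] to [dbar f]
    for [f] equal to [conj (dbar G)] times a Gaussian, integrated by parts, says that the integral
    of [|dbar G| ^ 2] against a positive weight is 0. *)
Lemma harmonic_conj_holomorphic tau k alpha : (0 < Im tau)%R -> H1 tau (- k) 0 alpha ->
  H0 tau k 0 (fun z => Cconj (alpha z) * gauss (- gauss_rate tau k) z).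
Proof.
  intros Ht [[Hs Hq] Ho]. set (G := fun z => Cconj (alpha z) * gauss (- gauss_rate tau k) z).
  assert (HGs : smooth G) by (apply smooth_mult; [now apply smooth_conj|apply smooth_gauss]).
  assert (HGq : quasi_periodic tau k 0 G).
  { pose proof (conj_gauss_qp tau (- k) alpha Ht Hq) as Q. rewrite Z.opp_involutive in Q.
    replace (gauss_rate tau (- k)) with (- gauss_rate tau k)%R in Q by (unfold gauss_rate; rewrite opp_IZR; field; lra). exact Q. }
  assert (HGd := smooth_dbar _ HGs). assert (HGdq := dbar_qp tau k 0 G HGs HGq).
  set (f := fun z => Cconj (dbar G z) * gauss (gauss_rate tau k) z).
  assert (Hfs : smooth f) by (apply smooth_mult; [now apply smooth_conj|apply smooth_gauss]).
  assert (Hfq : quasi_periodic tau (- k) 0 f) by now apply conj_gauss_qp.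
  specialize (Ho f (conj Hfs Hfq)).
  assert (Hdfq := dbar_qp _ _ _ _ Hfs Hfq).
  assert (Hdfc := smooth_cont _ (smooth_dbar _ Hfs)).
  assert (Hac := smooth_cont _ Hs). assert (HGc := smooth_cont _ HGs). assert (Hfc := smooth_cont _ Hfs). assert (HGdc := smooth_cont _ HGd).
  rewrite herm_wint in Ho; auto.
  2:{ intro z. exact (proj1 (Hdfq z)). } 2:{ intro z. exact (proj1 (Hq z)). }
  unfold wint in Ho.
  assert (E1 : cint (fun s => cint (fun r => dbar f (r, (Im tau * s)%R) * G (r, (Im tau * s)%R)) 0 1) 0 1 = 0).
  { rewrite <- Ho. apply cint_ext. intro s. rewrite Cmult_comm, <- cint_scal.
    - apply cint_ext. intro r. unfold G. rewrite <- (exp_wexp_gauss tau k r s Ht). ring.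
    - cont. }
  assert (HfG : smooth (fun z => f z * G z)) by now apply smooth_mult.
  assert (E2 : cint (fun s => cint (fun r => dbar (fun z => f z * G z) (r, (Im tau * s)%R)) 0 1) 0 1 = 0).
  { apply stokes_torus; auto.
    - intro z. destruct (Hfq z) as [F1 _]. destruct (HGq z) as [G1 _]. now rewrite F1, G1.
    - intro z. destruct (Hfq z) as [_ F2]. destruct (HGq z) as [_ G2]. rewrite F2, G2.
      transitivity (cexp (- (PI * Ci * IZR (- k) * tau) - 2 * PI * Ci * (IZR (- k) * z + 0)) * cexp (- (PI * Ci * IZR k * tau) - 2 * PI * Ci * (IZR k * z + 0)) * (f z * G z)); [ring|].
      rewrite <- cexp_plus. replace (- (PI * Ci * IZR (- k) * tau) - 2 * PI * Ci * (IZR (- k) * z + 0) + (- (PI * Ci * IZR k * tau) - 2 * PI * Ci * (IZR k * z + 0))) with (RtoC 0).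
      + rewrite cexp_0. ring.
      + rewrite opp_IZR, RtoC_opp. ring. }
  set (h := fun z => (Cmod (dbar G z) ^ 2 * exp (- (gauss_rate tau k * Im z ^ 2)))%R).
  assert (Hh : forall z, f z * dbar G z = RtoC (h z)).
  { intro z. unfold f, h, gauss. rewrite RtoC_mult, Cmod2_conj. ring. }
  assert (Hhc : forall z, continuous h z).
  { intro z. apply (continuous_ext (fun z => Re (f z * dbar G z))); [intro x; now rewrite Hh|]. apply ctn_Re, ctn_mult; auto. }
  assert (Hhp : forall z, (0 <= h z)%R).
  { intro z. apply Rmult_le_pos; [apply pow2_ge_0|left; apply exp_pos]. }
  assert (E3 : cint (fun s => cint (fun r => RtoC (h (r, (Im tau * s)%R))) 0 1) 0 1 = 0).
  { transitivity (cint (fun s => cint (fun r => dbar (fun z => f z * G z) (r, (Im tau * s)%R)) 0 1) 0 1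
      - cint (fun s => cint (fun r => dbar f (r, (Im tau * s)%R) * G (r, (Im tau * s)%R)) 0 1) 0 1); [|rewrite E1, E2; ring].
    assert (Cc : forall F : C -> C, (forall z, continuous F z) -> ccont (fun s => cint (fun r => F (r, (Im tau * s)%R)) 0 1)).
    { intros F HF s. apply (continuous_comp (fun s => (Im tau * s)%R) (fun y => cint (fun r => F (r, y)) 0 1)).
      - cont.
      - apply (cint_param_cont F 0 1); auto. lra. }
    rewrite <- cint_minus.
    - apply cint_ext. intro s. rewrite <- cint_minus.
      + apply cint_ext. intro r. rewrite dbar_mult by now apply smooth_partials. rewrite <- Hh. ring.
      + apply hslice_ccont. now apply smooth_cont, smooth_dbar.
      + cont.
    - apply Cc. now apply smooth_cont, smooth_dbar.
    - apply (Cc (fun z => dbar f z * G z)). intro z. now apply ctn_mult. }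
  assert (Hhr : forall s, forall t, continuous (fun r => h (r, (Im tau * s)%R)) t) by cont.
  rewrite (cint_ext _ (fun s => RtoC (RInt (fun r => h (r, (Im tau * s)%R)) 0 1))) in E3 by (intro s; apply cint_RtoC, Hhr).
  assert (Hout : forall s, continuous (fun s => RInt (fun r => h (r, (Im tau * s)%R)) 0 1) s).
  { intro s. apply (continuous_comp (fun s => (Im tau * s)%R) (fun y => RInt (fun r => h (r, y)) 0 1)).
    - cont.
    - apply (rint_param_cont h 0 1); auto. lra. }
  rewrite cint_RtoC in E3 by exact Hout. apply RtoC_inj in E3.
  assert (Hz : forall z, dbar G z = 0).
  { apply (lattice_reduce tau); auto.
    - intro z. now rewrite (proj1 (HGdq z)).
    - intro z. rewrite (proj2 (HGdq z)). split; intro E; [|rewrite E; ring].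
      set (e := cexp _) in E. assert (He : e <> 0) by apply cexp_neq_0.
      replace (dbar G z) with (/ e * (e * dbar G z)) by (field; auto). rewrite E. ring.
    - intros z Hx Hy. set (s := (Im z / Im tau)%R).
      assert (Hs1 : (0 <= s <= 1)%R).
      { unfold s. split; [apply Rdiv_le_0_compat; lra|]. apply (Rmult_le_reg_r (Im tau)); auto. unfold Rdiv. rewrite Rmult_assoc, Rinv_l by lra. lra. }
      assert (K1 : RInt (fun r => h (r, (Im tau * s)%R)) 0 1 = 0%R).
      { apply (RInt_zero (fun s => RInt (fun r => h (r, (Im tau * s)%R)) 0 1)); auto.
        intro x. apply RInt_ge_0; auto; [lra|]. apply rcont_ex, Hhr. }
      assert (K2 : h (Re z, (Im tau * s)%R) = 0%R) by (apply (RInt_zero (fun r => h (r, (Im tau * s)%R))); auto).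
      replace (Re z, (Im tau * s)%R) with z in K2.
      2:{ unfold s. replace (Im tau * (Im z / Im tau))%R with (Im z) by (field; lra). now rewrite pair_eta. }
      unfold h in K2. apply Rmult_integral in K2. destruct K2 as [K2|K2]; [|pose proof (exp_pos (- (gauss_rate tau k * Im z ^ 2))); lra].
      apply Cmod_eq_0. simpl in K2. rewrite Rmult_1_r in K2. apply Rmult_integral in K2. tauto. }
  split; [|exact HGq]. apply CR_entire; [exact (HGs 1%nat)|exact Hz].
Qed.

Definition H1_const (tau : C) (k : nat) : R := (PI * sqrt (2 * INR k) / sqrt (Im tau))%R.
Lemma H1_const_pos tau k : (0 < Im tau)%R -> (0 < k)%nat -> (0 < H1_const tau k)%R.
Proof.
  intros Ht Hk. apply lt_INR in Hk. simpl in Hk. unfold H1_const. apply Rdiv_lt_0_compat; [apply Rmult_lt_0_compat|].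
  - apply PI_RGT_0. - apply sqrt_lt_R0. lra. - now apply sqrt_lt_R0.
Qed.
Lemma basis_H1_eq tau k a z : (0 < Im tau)%R -> (0 < k)%nat ->
  basis_H1 tau k a z = H1_const tau k * (Cconj (basis_H0 tau k 0 a z) * gauss (gauss_rate tau (Z.of_nat k)) z).
Proof.
  intros Ht Hk. unfold basis_H1, basis_H0. 
  assert (E0 : RtoC (PI * sqrt (2 * INR k) / sqrt (Im tau)) = H1_const tau k) by reflexivity.
  replace (INR k * z + 0) with (INR k * z) by ring.
  assert (E : RtoC (exp (- (2 * PI * Im tau * INR k * coord2 tau z ^ 2))) = gauss (gauss_rate tau (Z.of_nat k)) z).
  { unfold gauss, gauss_rate, coord2. apply (f_equal RtoC), (f_equal exp). rewrite INR_IZR_INZ. field. lra. }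
  rewrite E. fold (H1_const tau k). ring.
Qed.
(** On the real axis the Gaussian is 1, so that the conjugate Fourier coefficient of [alpha] is the
    one of a holomorphic section. *)
Definition coord_H1 (tau : C) (k : nat) (alpha : C -> C) (a : nat) : C :=
  cint (fun r => alpha (r, 0%R) * em (Z.of_nat a) (r, 0%R)) 0 1 / (H1_const tau k * Cconj (theta_coef tau (Z.of_nat k) 0 (Z.of_nat a))).
(** Expand the holomorphic section of [harmonic_conj_holomorphic] in theta functions. *)
Lemma H1_span tau k alpha : (0 < Im tau)%R -> (0 < k)%nat -> H1 tau (- Z.of_nat k) 0 alpha ->
  exists A, forall x, alpha x = Csum k (fun a => A a * basis_H1 tau k a x).
Proof.
  intros Ht Hk Ha. pose proof (harmonic_conj_holomorphic tau (Z.of_nat k) alpha Ht Ha) as HG.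
  assert (Hc : RtoC (H1_const tau k) <> 0) by (apply RtoC_neq_0; pose proof (H1_const_pos tau k Ht Hk); lra).
  set (G := fun z => Cconj (alpha z) * gauss (- gauss_rate tau (Z.of_nat k)) z) in *.
  exists (fun a => Cconj (coord_H0 tau k 0 G a) / H1_const tau k). intro x.
  transitivity (Cconj (G x) * gauss (gauss_rate tau (Z.of_nat k)) x).
  - unfold G. rewrite Cmult_conj, Cconj_conj. replace (Cconj (gauss (- gauss_rate tau (Z.of_nat k)) x)) with (gauss (- gauss_rate tau (Z.of_nat k)) x) by (apply C_ext; simpl; ring).
    transitivity (alpha x * (gauss (gauss_rate tau (Z.of_nat k)) x * gauss (- gauss_rate tau (Z.of_nat k)) x)); [rewrite gauss_inv; ring|ring].
  - rewrite (H0_span tau k 0 G Ht Hk HG x), Csum_conj, Cmult_comm, <- Csum_scal. apply Csum_ext. intros i Hi.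
    rewrite basis_H1_eq, Cmult_conj by auto. field. auto.
Qed.
Lemma coord_H1_unique tau k alpha A : (0 < Im tau)%R -> (0 < k)%nat ->
  (forall x, alpha x = Csum k (fun a => A a * basis_H1 tau k a x)) -> forall a, (a < k)%nat -> A a = coord_H1 tau k alpha a.
Proof.
  intros Ht Hk HA a Ha.
  assert (Hc : RtoC (H1_const tau k) <> 0) by (apply RtoC_neq_0; pose proof (H1_const_pos tau k Ht Hk); lra).
  assert (HT : Cconj (theta_coef tau (Z.of_nat k) 0 (Z.of_nat a)) <> 0).
  { intro E. apply (theta_coef_neq_0 tau (Z.of_nat k) 0 (Z.of_nat a)). rewrite <- (Cconj_conj (theta_coef _ _ _ _)), E. apply C_ext; simpl; ring. }
  unfold coord_H1.
  set (g := fun x => Csum k (fun i => (H1_const tau k * Cconj (A i)) * basis_H0 tau k 0 i x)).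
  assert (Hgc : forall z, continuous g z).
  { intro z. apply (ctn_csum (fun i x => (H1_const tau k * Cconj (A i)) * basis_H0 tau k 0 i x)). intro i.
    apply ctn_mult; [apply continuous_const|now apply basis_cont]. }
  assert (E : cint (fun r => alpha (r, 0%R) * em (Z.of_nat a) (r, 0%R)) 0 1 = Cconj (fcoef (Z.of_nat a) g 0)).
  { unfold fcoef. rewrite <- cint_conj by cont. apply cint_ext. intro r. rewrite Cmult_conj.
    assert (Ee : Cconj (em (- Z.of_nat a) (r, 0%R)) = em (Z.of_nat a) (r, 0%R)).
    { unfold em. rewrite cexp_conj. apply (f_equal cexp). rewrite opp_IZR. apply C_ext; simpl; ring. }
    rewrite Ee. apply (f_equal (fun z => z * em (Z.of_nat a) (r, 0%R))).
    rewrite HA. unfold g. rewrite Csum_conj. apply Csum_ext. intros i Hi. rewrite basis_H1_eq by auto.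
    unfold gauss. simpl Im. replace (- (gauss_rate tau (Z.of_nat k) * 0 ^ 2))%R with 0%R by ring. rewrite exp_0.
    rewrite !Cmult_conj, Cconj_conj. replace (Cconj (H1_const tau k)) with (RtoC (H1_const tau k)) by (apply C_ext; simpl; ring). ring. }
  rewrite E. unfold g. rewrite fcoef_comb by auto. rewrite Z.mod_small, Nat2Z.id by lia. rewrite !Cmult_conj, Cconj_conj.
  replace (Cconj (H1_const tau k)) with (RtoC (H1_const tau k)) by (apply C_ext; simpl; ring). field. auto.
Qed.

(** * An explicit inverse of dbar *)

(** With these coefficients the series of Gaussians is, up to a constant, the basis form of index
    [j], and translation by [tau] shifts the index [n]. *)
Definition ecoef (tau : C) (k j n : Z) : C := / theta_coef tau k 0 (k * n + j).
Lemma ecoef_growth tau k j : (0 < Im tau)%R -> (0 < k)%Z -> growth (Im tau) k (ecoef tau k j).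
Proof.
  intros Ht Hk. assert (Hk' := IZR_lt 0 k Hk). pose proof PI_RGT_0 as Hpi.
  set (b := (2 * PI * Im tau * IZR j)%R).
  exists (PI * Im tau * IZR j ^ 2 / IZR k)%R, (Rabs b). intro n. unfold ecoef, theta_coef. rewrite <- cexp_opp, Cmod_cexp. apply exp_le.
  assert (E : Re (- (PI * Ci * tau * IZR (k * n + j) * IZR (k * n + j) / IZR k + 2 * PI * Ci * IZR (k * n + j) * 0 / IZR k))
    = (PI * Im tau * IZR j ^ 2 / IZR k + IZR n * b + PI * Im tau * IZR k * IZR n ^ 2)%R).
  { rewrite plus_IZR, mult_IZR. destruct tau as [t1 t2]. unfold b. unfold Cdiv. rewrite <- RtoC_inv by lra.
    cbn [Re Im fst snd Cplus Cmult Copp RtoC Ci]. field. lra. }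
  rewrite E. pose proof (abs_prod_le b (IZR n) (Rabs b) (Rle_refl _)). lra.
Qed.
(** The solution of dbar described at the top; it depends on the choice of [N]. *)
Definition theta_prim (tau : C) (k j N : Z) (z : C) : C := prim_series (Im tau) k j N (ecoef tau k j) z.
Lemma smooth_theta_prim tau k j N : (0 < Im tau)%R -> (0 < k)%Z -> smooth (theta_prim tau k j N).
Proof. intros Ht Hk. exact (smooth_prim_series (Im tau) k j N _ Ht Hk (ecoef_growth tau k j Ht Hk)). Qed.

Lemma conj_coef_ecoef tau k j n : (0 < Im tau)%R -> (0 < k)%Z -> conj_coef (Im tau) k j (ecoef tau k j) n = theta_coefs tau k 0 j n.
Proof.
  intros Ht Hk. assert (Hk' := IZR_lt 0 k Hk). unfold conj_coef, ecoef, theta_coefs, theta_coef.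
  rewrite <- cexp_opp, cexp_conj, <- cexp_R, <- cexp_plus. apply (f_equal cexp). unfold gauss_par, qshift. rewrite plus_IZR, mult_IZR.
  destruct tau as [t1 t2]. unfold Cdiv. rewrite <- RtoC_inv by lra. simpl in Ht. apply C_ext; simpl; field; lra.
Qed.
Lemma basis_H1_gauss_series tau k a z : (0 < Im tau)%R -> (0 < k)%nat ->
  basis_H1 tau k a z = H1_const tau k * gauss_series (Im tau) (Z.of_nat k) (Z.of_nat a) (ecoef tau (Z.of_nat k) (Z.of_nat a)) z.
Proof.
  intros Ht Hk. assert (Hkz : (0 < Z.of_nat k)%Z) by lia.
  rewrite basis_H1_eq, gauss_series_conj by (auto; now apply ecoef_growth). rewrite basis_fser by auto.
  assert (E : fser (Z.of_nat k) (Z.of_nat a) (conj_coef (Im tau) (Z.of_nat k) (Z.of_nat a) (ecoef tau (Z.of_nat k) (Z.of_nat a))) z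
     = fser (Z.of_nat k) (Z.of_nat a) (theta_coefs tau (Z.of_nat k) 0 (Z.of_nat a)) z).
  { apply zs_ext. intro n. now rewrite conj_coef_ecoef. }
  rewrite E. replace (gauss_par (Im tau) (Z.of_nat k) / Im tau ^ 2)%R with (gauss_rate tau (Z.of_nat k)) by (unfold gauss_par, gauss_rate; field; lra). ring.
Qed.
(** The constant that makes [dbar_theta_prim] an equality with the basis form. *)
Definition prim_const (tau : C) (k : nat) : C := 2 * Im tau / Ci * H1_const tau k.
Lemma dbar_theta_prim tau k a N z : (0 < Im tau)%R -> (0 < k)%nat ->
  prim_const tau k * dbar (theta_prim tau (Z.of_nat k) (Z.of_nat a) N) z = basis_H1 tau k a z.
Proof.
  intros Ht Hk. assert (Hkz : (0 < Z.of_nat k)%Z) by lia. unfold theta_prim. rewrite dbar_prim_series by (auto; now apply ecoef_growth).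
  rewrite basis_H1_gauss_series by auto. unfold prim_const. field. split; [|apply Ci_nz]. apply RtoC_neq_0. lra.
Qed.
(** The exponential of index [N]: the one whose primitive changes its constant of integration under
    translation by [tau]. *)
Definition jump_em (tau : C) (k j N : Z) (z : C) : C := ecoef tau k j N * em (- (k * N + j)) z.

Lemma theta_prim_periodic tau k j N z : theta_prim tau k j N (z + 1) = theta_prim tau k j N z.
Proof.
  unfold theta_prim, prim_series. apply zs_ext. intro n. unfold prim_term. rewrite em_periodic.
  replace (Im (z + 1)) with (Im z) by (destruct z; simpl; ring). reflexivity.
Qed.
Lemma step_jump t k N n : (step t k N (n + 1) - step t k N n = if Z.eqb (n + 1) N then 2 * ghalf (gauss_par t k) else 0)%R.
Proof.
  unfold step. destruct (Z.leb_spec N (n + 1)), (Z.leb_spec N n), (Z.eqb_spec (n + 1) N); try lia; ring.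
Qed.
(** Translation by [tau] replaces [s] by [s + 1], hence [n] by [n + 1], in the primitives; only at
    [n + 1 = N] does the step function notice. *)
Lemma theta_prim_tau tau k j N z : (0 < Im tau)%R -> (0 < k)%Z ->
  theta_prim tau k j N (z + tau) = mult_tau tau (- k) 0 z * (theta_prim tau k j N z + RtoC (2 * ghalf (gauss_par (Im tau) k)) * jump_em tau k j N z).
Proof.
  intros Ht Hk. set (b := ecoef tau k j). set (J := RtoC (2 * ghalf (gauss_par (Im tau) k))).
  assert (Hb := ecoef_growth tau k j Ht Hk). fold b in Hb.
  destruct (prim_term_dom (Im tau) k j N b (Rabs (Im z)) Ht Hk Hb) as [M HM]. specialize (HM z (Rle_refl _)).
  assert (HMs : zdom (2 * M) (fun n => prim_term (Im tau) k j N b (n + 1) z)).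
  { intro n. eapply Rle_trans; [apply (HM (n + 1)%Z)|]. pose proof (abs_nat_half n (n + 1) ltac:(lia)).
    pose proof (zdom_pos _ _ HM). nra. }
  (* [U] collects the changes of the constants of integration; only one of them is not 0. *)
  set (U := fun n => (if Z.eqb (n + 1) N then J * jump_em tau k j N z else 0)).
  assert (HU : ZSeries U = J * jump_em tau k j N z /\ exists M', zdom M' U).
  { assert (HU0 : forall n, n <> (N - 1)%Z -> U n = 0).
    { intros n Hn. unfold U. destruct (Z.eqb_spec (n + 1) N); [lia|auto]. }
    split.
    - rewrite (zs_single U (N - 1)%Z HU0). unfold U. replace (N - 1 + 1)%Z with N by ring. now rewrite Z.eqb_refl.
    - exists (Cmod (U (N - 1)%Z) * 2 ^ Z.abs_nat (N - 1))%R. intro n. destruct (Z.eq_dec n (N - 1)) as [->|Hn].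
      + right. rewrite Rmult_assoc, <- Rpow_mult_distr. replace (2 * / 2)%R with 1%R by field. rewrite pow1. ring.
      + rewrite HU0 by auto. rewrite Cmod_0. apply Rmult_le_pos; [apply Rmult_le_pos; [apply Cmod_ge_0|apply pow_le; lra]|left; apply half_pow_pos]. }
  destruct HU as [HU [M' HM']].
  assert (ES : theta_prim tau k j N z = ZSeries (fun n => prim_term (Im tau) k j N b (n + 1) z)) by (symmetry; exact (zs_shift M (fun n => prim_term (Im tau) k j N b n z) HM)).
  rewrite ES, <- HU, <- (zs_plus _ _ _ _ HMs HM'), <- (zs_scal _ _ _ (zdom_plus _ _ _ _ HMs HM')).
  unfold theta_prim, prim_series. apply zs_ext. intro n. unfold prim_term. fold b.
  assert (E1 : b n * em (- k * n + - j) (z + tau) = mult_tau tau (- k) 0 z * (b (n + 1)%Z * em (- k * (n + 1) + - j) z)).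
  { rewrite em_plus, mult_tau_em. replace (- - k)%Z with k by ring.
    assert (Ez : em (- k * n + - j) z = em k z * em (- k * (n + 1) + - j) z) by (rewrite em_add; apply (f_equal (fun m => em m z)); ring).
    rewrite Ez.
    assert (Eb : b n * em (- k * n + - j) tau = cexp (- (PI * Ci * IZR (- k) * tau) - 2 * PI * Ci * 0) * b (n + 1)%Z).
    { unfold b, ecoef. replace (k * (n + 1) + j)%Z with ((k * n + j) + k)%Z by ring. rewrite theta_coef_shift by auto.
      set (m := (k * n + j)%Z). replace (- k * n + - j)%Z with (- m)%Z by (unfold m; ring).
      pose proof (theta_coef_neq_0 tau k 0 m). pose proof (cexp_neq_0 (PI * Ci * IZR k * tau + 2 * PI * Ci * (0 + IZR m * tau))) as Hne.
      assert (Ee : em (- m) tau * cexp (PI * Ci * IZR k * tau + 2 * PI * Ci * (0 + IZR m * tau)) = cexp (- (PI * Ci * IZR (- k) * tau) - 2 * PI * Ci * 0)).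
      { unfold em. rewrite <- cexp_plus. apply (f_equal cexp). rewrite !opp_IZR, !RtoC_opp. ring. }
      rewrite <- Ee. field. auto. }
    transitivity ((b n * em (- k * n + - j) tau) * em k z * em (- k * (n + 1) + - j) z); [ring|]. rewrite Eb. ring. }
  rewrite E1.
  replace (Im (z + tau) / Im tau)%R with (Im z / Im tau + 1)%R by (rewrite im_plus; field; lra).
  assert (E2 : tail_prim (Im tau) k j N n (Im z / Im tau + 1) = (tail_prim (Im tau) k j N (n + 1) (Im z / Im tau) + (step (Im tau) k N (n + 1) - step (Im tau) k N n))%R).
  { unfold tail_prim, qshift. rewrite plus_IZR. replace (Im z / Im tau + 1 + (IZR n + IZR j / IZR k))%R with (Im z / Im tau + (IZR n + 1 + IZR j / IZR k))%R by ring. ring. }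
  rewrite E2, step_jump, RtoC_plus. unfold U, J, jump_em. fold b. destruct (Z.eqb_spec (n + 1) N) as [<-|Hn].
  - replace (- (k * (n + 1) + j))%Z with (- k * (n + 1) + - j)%Z by ring. ring.
  - ring.
Qed.

(** The boolean allows frequencies running in either direction. *)
Lemma theta_coef_bound tau k u (sg : bool) j : (0 < Im tau)%R -> (0 < k)%Z -> exists A B, forall m,
  (Cmod (theta_coef tau k u ((if sg then m else - m) + j)) <= exp (A + B * Rabs (IZR m) - PI * Im tau / IZR k * IZR m ^ 2))%R.
Proof.
  intros Ht Hk. assert (Hk' := IZR_lt 0 k Hk). pose proof PI_RGT_0 as Hpi.
  set (b := (2 * PI * Im tau * IZR j / IZR k + 2 * PI * Im u / IZR k)%R).
  exists (- (PI * Im tau * IZR j ^ 2 / IZR k) - 2 * PI * (IZR j / IZR k) * Im u)%R, (Rabs b). intro m.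
  unfold theta_coef. rewrite Cmod_cexp. apply exp_le. set (m' := (if sg then m else - m)%Z).
  assert (E : Re (PI * Ci * tau * IZR (m' + j) * IZR (m' + j) / IZR k + 2 * PI * Ci * IZR (m' + j) * u / IZR k)
    = (- (PI * Im tau * IZR j ^ 2 / IZR k) - 2 * PI * (IZR j / IZR k) * Im u + - (IZR m' * b) - PI * Im tau / IZR k * IZR m' ^ 2)%R).
  { rewrite plus_IZR. destruct tau as [t1 t2], u as [u1 u2]. unfold b. unfold Cdiv. rewrite <- RtoC_inv by lra.
    cbn [Re Im fst snd Cplus Cmult RtoC Ci]. field. lra. }
  rewrite E. pose proof (abs_prod_le b (IZR m') (Rabs b) (Rle_refl _)) as Q.
  assert (E1 : Rabs (IZR m') = Rabs (IZR m)) by (unfold m'; destruct sg; auto; rewrite opp_IZR; apply Rabs_Ropp).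
  assert (E2 : (IZR m' ^ 2 = IZR m ^ 2)%R) by (unfold m'; destruct sg; auto; rewrite opp_IZR; ring).
  rewrite E2. rewrite E1 in Q. lra.
Qed.
Lemma Cmod_zeta tau u m : Cmod (zeta tau u m) = exp (- (2 * PI * (IZR m * Im tau + Im u))).
Proof. unfold zeta. rewrite Cmod_cexp. apply (f_equal exp). destruct tau, u; simpl. ring. Qed.
Lemma finite_lower_bound (g : Z -> R) (K : nat) : (forall m, 0 < g m)%R -> exists d, (0 < d)%R /\ forall m, (Z.abs m <= Z.of_nat K)%Z -> (d <= g m)%R.
Proof.
  intro Hg. induction K.
  - exists (g 0%Z). split; auto. intros m Hm. replace m with 0%Z by lia. lra.
  - destruct IHK as (d & Hd & H). exists (Rmin d (Rmin (g (Z.of_nat (S K))) (g (- Z.of_nat (S K))%Z))).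
    split; [repeat apply Rmin_pos; auto|]. intros m Hm.
    pose proof (Rmin_l d (Rmin (g (Z.of_nat (S K))) (g (- Z.of_nat (S K))%Z))).
    pose proof (Rmin_r d (Rmin (g (Z.of_nat (S K))) (g (- Z.of_nat (S K))%Z))).
    pose proof (Rmin_l (g (Z.of_nat (S K))) (g (- Z.of_nat (S K))%Z)).
    pose proof (Rmin_r (g (Z.of_nat (S K))) (g (- Z.of_nat (S K))%Z)).
    destruct (Z_le_gt_dec (Z.abs m) (Z.of_nat K)) as [L|L]; [specialize (H m L); lra|].
    assert (Em : m = Z.of_nat (S K) \/ m = (- Z.of_nat (S K))%Z) by lia. destruct Em as [-> | ->]; lra.
Qed.
(** For large [|m|] the modulus of [zeta_m] is far from 1; finitely many [m] remain, for which
    [zeta_m] is not 1. *)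
Lemma zeta_lower tau u : (0 < Im tau)%R -> ~ in_lattice tau u -> exists d, (0 < d)%R /\ forall m, (d <= Cmod (1 - zeta tau u m))%R.
Proof.
  intros Ht Hu. pose proof PI_RGT_0 as Hpi. pose proof PI2_3_2 as Hpi2.
  assert (Hpi3 : (3 < PI)%R) by (unfold PI2 in *; lra).
  destruct (INR_unbounded ((1 + Rabs (Im u)) / Im tau)) as [K HK].
  destruct (finite_lower_bound (fun m => Cmod (1 - zeta tau u m)) K) as (d & Hd & H).
  { intro m. apply Cmod_gt_0. now apply zeta_neq_1. }
  exists (Rmin d (/ 2)). split; [apply Rmin_pos; lra|]. intro m.
  pose proof (Rmin_l d (/ 2)). pose proof (Rmin_r d (/ 2)).
  destruct (Z_le_gt_dec (Z.abs m) (Z.of_nat K)) as [L|L]; [specialize (H m L); lra|].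
  assert (Hbig : (1 <= Rabs (IZR m) * Im tau - Rabs (Im u))%R).
  { assert (INR K <= Rabs (IZR m))%R. { rewrite <- abs_IZR, INR_IZR_INZ. apply IZR_le. lia. }
    apply (Rmult_lt_compat_r (Im tau)) in HK; auto. unfold Rdiv in HK. rewrite Rmult_assoc, Rinv_l, Rmult_1_r in HK by lra. nra. }
  pose proof (Rle_abs (Im u)) as A1. pose proof (Rle_abs (- Im u)) as A2. rewrite Rabs_Ropp in A2.
  pose proof (Cmod_triangle (1 - zeta tau u m) (zeta tau u m)) as T1. replace (1 - zeta tau u m + zeta tau u m) with (RtoC 1) in T1 by ring. rewrite Cmod_1 in T1.
  pose proof (Cmod_triangle (1 - zeta tau u m) (- (1))) as T2. replace (1 - zeta tau u m + - (1)) with (- zeta tau u m) in T2 by ring. rewrite !Cmod_opp, Cmod_1 in T2.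
  rewrite Cmod_zeta in T1, T2. unfold Rabs in Hbig at 1. destruct (Rcase_abs (IZR m)) as [C0|C0].
  - assert (1 <= - (IZR m * Im tau + Im u))%R by lra.
    pose proof (exp_ineq1_le (- (2 * PI * (IZR m * Im tau + Im u)))). nra.
  - assert (1 <= IZR m * Im tau + Im u)%R by lra.
    assert (E : (exp (- (2 * PI * (IZR m * Im tau + Im u))) <= / 2)%R).
    { rewrite exp_Ropp. apply Rinv_le_contravar; [lra|]. pose proof (exp_ineq1_le (2 * PI * (IZR m * Im tau + Im u))). nra. }
    lra.
Qed.

(** * The holomorphic correction of the quasi-periodicity *)
(** The Fourier coefficient of [jump_em * beta] divided by [1 - zeta_m]. *)
Definition corr_coef (tau : C) (k : Z) (u : C) (j N : Z) (beta : C -> C) (m : Z) : C :=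
  ecoef tau k j N * fcoef (m + (k * N + j)) beta 0 / (1 - zeta tau u m).
Lemma H0_fcoef tau k u f m : (0 < Im tau)%R -> (0 < k)%nat -> H0 tau (Z.of_nat k) u f -> forall y,
  fcoef m f y = coord_H0 tau k u f (Z.to_nat (m mod Z.of_nat k)) * theta_coef tau (Z.of_nat k) u m.
Proof.
  intros Ht Hk Hf y. rewrite (fcoef_ext m f _ y (H0_span tau k u f Ht Hk Hf)). now apply fcoef_comb.
Qed.
Lemma finite_upper_bound (B : nat -> C) k : exists K, (0 < K)%R /\ forall i, (i < k)%nat -> (Cmod (B i) <= K)%R.
Proof.
  induction k.
  - exists 1%R. split; [lra|]. intros; lia.
  - destruct IHk as (K & HK & H). exists (K + Cmod (B k))%R. pose proof (Cmod_ge_0 (B k)). split; [lra|].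
    intros i Hi. destruct (Nat.eq_dec i k) as [->|Hn]; [lra|]. specialize (H i ltac:(lia)). lra.
Qed.
Lemma corr_coef_rapid tau k u j N beta : (0 < Im tau)%R -> (0 < k)%nat -> ~ in_lattice tau u -> H0 tau (Z.of_nat k) u beta ->
  rapid (corr_coef tau (Z.of_nat k) u j N beta).
Proof.
  intros Ht Hk Hu Hb. set (kz := Z.of_nat k) in *. assert (Hkz : (0 < kz)%Z) by (unfold kz; lia). assert (Hkz' := IZR_lt 0 kz Hkz).
  pose proof PI_RGT_0 as Hpi.
  destruct (zeta_lower tau u Ht Hu) as (d & Hd & HZ).
  destruct (finite_upper_bound (coord_H0 tau k u beta) k) as (K & HK & HB).
  destruct (theta_coef_bound tau kz u true (kz * N + j) Ht Hkz) as (A & B & HT).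
  set (L := (Cmod (ecoef tau kz j N) * K / d)%R).
  apply (rapid_gauss _ (A + L) B (PI * Im tau / IZR kz)).
  { apply Rdiv_lt_0_compat; auto. apply Rmult_lt_0_compat; lra. }
  intro m. unfold corr_coef. rewrite Cmod_div by now apply zeta_neq_1. rewrite Cmod_mult.
  rewrite (H0_fcoef tau k u beta _ Ht Hk Hb). fold kz. rewrite Cmod_mult.
  specialize (HZ m). specialize (HT m). cbv iota in HT. set (T := exp _) in HT.
  pose proof (Z.mod_pos_bound (m + (kz * N + j)) kz Hkz) as Hmod.
  specialize (HB (Z.to_nat ((m + (kz * N + j)) mod kz)) ltac:(unfold kz in *; lia)).
  pose proof (Cmod_ge_0 (ecoef tau kz j N)) as G1. pose proof (Cmod_ge_0 (coord_H0 tau k u beta (Z.to_nat ((m + (kz * N + j)) mod kz)))) as G2.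
  pose proof (Cmod_ge_0 (theta_coef tau kz u (m + (kz * N + j)))) as G3.
  assert (E1 : (Cmod (ecoef tau kz j N) * (Cmod (coord_H0 tau k u beta (Z.to_nat ((m + (kz * N + j)) mod kz))) * Cmod (theta_coef tau kz u (m + (kz * N + j)))) / Cmod (1 - zeta tau u m) <= L * T)%R).
  { replace (L * T)%R with (Cmod (ecoef tau kz j N) * (K * T) * / d)%R by (unfold L; field; lra). unfold Rdiv.
    apply Rmult_le_compat.
    - apply Rmult_le_pos; auto. now apply Rmult_le_pos.
    - left. apply Rinv_0_lt_compat. lra.
    - apply Rmult_le_compat_l; auto. now apply Rmult_le_compat.
    - apply Rinv_le_contravar; auto. }
  eapply Rle_trans; [exact E1|]. unfold T.
  replace (A + L + B * Rabs (IZR m) - PI * Im tau / IZR kz * IZR m ^ 2)%R with (L + (A + B * Rabs (IZR m) - PI * Im tau / IZR kz * IZR m ^ 2))%R by ring.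
  rewrite (exp_plus L). apply Rmult_le_compat_r; [left; apply exp_pos|]. pose proof (exp_ineq1_le L). lra.
Qed.
Definition corr (tau : C) (k : Z) (u : C) (j N : Z) (beta : C -> C) : C -> C := fser 1 0 (corr_coef tau k u j N beta).
(** Both sides are periodic and continuous, and their Fourier coefficients agree because of the
    denominators [1 - zeta_m]. *)
Lemma corr_tau tau k u j N beta z : (0 < Im tau)%R -> (0 < k)%nat -> ~ in_lattice tau u -> H0 tau (Z.of_nat k) u beta ->
  cexp (2 * PI * Ci * u) * corr tau (Z.of_nat k) u j N beta (z + tau)
  = corr tau (Z.of_nat k) u j N beta z - jump_em tau (Z.of_nat k) j N z * beta z.
Proof.
  intros Ht Hk Hu Hb. set (kz := Z.of_nat k) in *. set (a := corr_coef tau kz u j N beta). assert (Ra : rapid a) by now apply corr_coef_rapid.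
  set (e := cexp (2 * PI * Ci * u)).
  set (a' := fun m => (e * em (1 * m + 0) tau) * a m).
  assert (Ra' : rapid a').
  { apply (rapid_mult a _ (Cmod e + (2 * PI * Rabs (Im tau) * Rabs (IZR 0))) (2 * PI * Rabs (Im tau) * Rabs (IZR 1)) Ra).
    intro n. rewrite Cmod_mult. rewrite Rplus_assoc, (exp_plus (Cmod e)).
    apply Rmult_le_compat; try apply Cmod_ge_0; [pose proof (exp_ineq1_le (Cmod e)); lra|]. apply em_bound. lra. }
  assert (E1 : e * corr tau kz u j N beta (z + tau) = fser 1 0 a' z).
  { unfold corr. fold a. unfold fser. destruct (fser_dom1 1 0 a (z + tau) Ra) as [M HM].
    rewrite <- (zs_scal M) by exact HM. apply zs_ext. intro n. rewrite em_plus. unfold a'. ring. }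
  rewrite E1. unfold corr. fold a.
  (* The difference of the two sides; its Fourier coefficients vanish. *)
  set (D := fun z => (- (1)) * (fser 1 0 a z) + (1 * fser 1 0 a' z + jump_em tau kz j N z * beta z)).
  assert (Hbc := H0_cont _ _ _ _ Hb).
  assert (HE : forall z, jump_em tau kz j N z * beta z = ecoef tau kz j N * (beta z * em (- (kz * N + j)) z)) by (intro; unfold jump_em; ring).
  assert (C1 : forall z, continuous (fun z => jump_em tau kz j N z * beta z) z).
  { intro x. apply ctn_mult; auto. apply ctn_mult; [apply continuous_const|apply em_cont]. }
  assert (HD0 : D z = 0).
  { destruct z as [x y]. apply (fcoef_unique D y).
    - intro z. apply ctn_plus; [apply ctn_mult; [apply continuous_const|now apply fser_cont]|].
      apply ctn_plus; auto. apply ctn_mult; [apply continuous_const|now apply fser_cont].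
    - intro z. unfold D, jump_em. rewrite !fser_periodic, em_periodic, (proj1 (proj2 Hb z)). reflexivity.
    - intro m. unfold D.
      rewrite (fcoef_lin m (- (1)) (fser 1 0 a) (fun z => 1 * fser 1 0 a' z + jump_em tau kz j N z * beta z)).
      2:{ cont. }
      2:{ intro. apply ctn_plus; auto. apply ctn_mult; [apply continuous_const|now apply fser_cont]. }
      rewrite (fcoef_lin m 1 (fser 1 0 a') (fun z => jump_em tau kz j N z * beta z)) by (auto; intro; now apply fser_cont).
      assert (F1 : forall c, rapid c -> fcoef m (fser 1 0 c) y = c m).
      { intros c Rc. rewrite <- (fcoef_fser_in m 1 0 c y) by (auto; lia). apply (f_equal (fun n => fcoef n (fser 1 0 c) y)). ring. }
      rewrite (F1 a Ra), (F1 a' Ra').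
      assert (Ef : fcoef m (fun z => beta z * em (- (kz * N + j)) z) y = fcoef (m + (kz * N + j)) beta 0).
      { rewrite <- (fcoef_entire_const (m + (kz * N + j)) beta y 0 (proj1 Hb)) by (intro; apply (proj2 Hb)).
        apply cint_ext. intro r. rewrite <- Cmult_assoc, em_add. apply (f_equal (fun n => beta (r, y) * em n (r, y))). ring. }
      assert (F2 : fcoef m (fun z => jump_em tau kz j N z * beta z) y = ecoef tau kz j N * fcoef (m + (kz * N + j)) beta 0).
      { rewrite (fcoef_ext m _ _ y HE), <- Ef. apply fcoef_scal. intro x0. apply ctn_mult; auto. apply em_cont. }
      transitivity (- (1) * a m + (1 * a' m + ecoef tau kz j N * fcoef (m + (kz * N + j)) beta 0)).
      { exact (f_equal (fun v => - (1) * a m + (1 * a' m + v)) F2). }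
      unfold a', a, corr_coef. replace (1 * m + 0)%Z with m by ring.
      assert (Ez : e * em m tau = zeta tau u m) by (unfold e, em, zeta; rewrite <- cexp_plus; apply (f_equal cexp); ring).
      rewrite Ez. field. now apply zeta_neq_1. }
  unfold D in HD0.
  replace (fser 1 0 a' z) with ((- (1)) * fser 1 0 a z + (1 * fser 1 0 a' z + jump_em tau kz j N z * beta z) + fser 1 0 a z - jump_em tau kz j N z * beta z) by ring.
  rewrite HD0. ring.
Qed.

Definition jump_const (tau : C) (k : nat) : C := RtoC (2 * ghalf (gauss_par (Im tau) (Z.of_nat k))).
(** The solution of dbar for the basis form of index [a] times [beta]. *)
Definition dbar_sol (tau : C) (k : nat) (u : C) (a : nat) (N : Z) (beta : C -> C) (z : C) : C :=
  prim_const tau k * (beta z * theta_prim tau (Z.of_nat k) (Z.of_nat a) N z + jump_const tau k * corr tau (Z.of_nat k) u (Z.of_nat a) N beta z).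

(** Read off from the expansion in theta functions. *)
Lemma H0_smooth tau k u f : (0 < Im tau)%R -> (0 < k)%nat -> H0 tau (Z.of_nat k) u f -> smooth f /\ forall z, dbar f z = 0.
Proof.
  intros Ht Hk Hf.
  assert (E : f = fun z => Csum k (fun a => coord_H0 tau k u f a * basis_H0 tau k u a z)).
  { apply functional_extensionality. now apply H0_span. }
  set (B := coord_H0 tau k u f) in *. rewrite E. split.
  - apply (smooth_csum k (fun a z => B a * basis_H0 tau k u a z)). intro i. apply smooth_scal. now apply basis_smooth.
  - intro z. assert (HP : forall i, ex_partials (basis_H0 tau k u i) z) by (intro; apply smooth_partials; now apply basis_smooth).
    rewrite (proj2 (dbar_csum k (fun a z => B a * basis_H0 tau k u a z) z (fun i => ex_partials_scal _ _ _ (HP i)))).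
    apply Csum_0. intros i Hi. rewrite dbar_scal by apply HP. rewrite basis_dbar by auto. ring.
Qed.
Lemma dbar_sol_spec tau k u a N beta : (0 < Im tau)%R -> (0 < k)%nat -> ~ in_lattice tau u -> H0 tau (Z.of_nat k) u beta ->
  smooth_section tau 0 u (dbar_sol tau k u a N beta) /\ forall z, dbar (dbar_sol tau k u a N beta) z = basis_H1 tau k a z * beta z.
Proof.
  intros Ht Hk Hu Hb. assert (Hkz : (0 < Z.of_nat k)%Z) by lia.
  destruct (H0_smooth tau k u beta Ht Hk Hb) as [Hbs Hbd].
  assert (Rc := corr_coef_rapid tau k u (Z.of_nat a) N beta Ht Hk Hu Hb).
  assert (HSs := smooth_theta_prim tau (Z.of_nat k) (Z.of_nat a) N Ht Hkz).
  assert (HHs : smooth (corr tau (Z.of_nat k) u (Z.of_nat a) N beta)) by now apply smooth_fser.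
  assert (H1s : smooth (fun z => beta z * theta_prim tau (Z.of_nat k) (Z.of_nat a) N z)) by now apply smooth_mult.
  assert (H2s : smooth (fun z => jump_const tau k * corr tau (Z.of_nat k) u (Z.of_nat a) N beta z)) by now apply smooth_scal.
  assert (H3s : smooth (fun z => beta z * theta_prim tau (Z.of_nat k) (Z.of_nat a) N z + jump_const tau k * corr tau (Z.of_nat k) u (Z.of_nat a) N beta z)) by now apply smooth_plus.
  split; [split|].
  - now apply smooth_scal.
  - intro z. unfold dbar_sol. destruct (proj2 Hb z) as [B1 B2]. split.
    + rewrite B1, theta_prim_periodic. unfold corr. rewrite fser_periodic. reflexivity.
    + rewrite B2, theta_prim_tau by auto. fold (jump_const tau k). fold (mult_tau tau (Z.of_nat k) u z).
      set (e := cexp (2 * PI * Ci * u)). assert (He : e <> 0) by apply cexp_neq_0.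
      assert (EH : corr tau (Z.of_nat k) u (Z.of_nat a) N beta (z + tau) = / e * (corr tau (Z.of_nat k) u (Z.of_nat a) N beta z - jump_em tau (Z.of_nat k) (Z.of_nat a) N z * beta z)).
      { rewrite <- corr_tau by auto. fold e. field. auto. }
      rewrite EH.
      assert (Em : mult_tau tau (Z.of_nat k) u z * mult_tau tau (- Z.of_nat k) 0 z = / e).
      { unfold mult_tau, e. rewrite <- cexp_plus, <- cexp_opp. apply (f_equal cexp). rewrite opp_IZR, RtoC_opp. ring. }
      assert (E0 : cexp (- (PI * Ci * 0 * tau) - 2 * PI * Ci * (0 * z + u)) = / e).
      { unfold e. rewrite <- cexp_opp. apply (f_equal cexp). ring. }
      rewrite E0.
      transitivity (prim_const tau k * ((mult_tau tau (Z.of_nat k) u z * mult_tau tau (- Z.of_nat k) 0 z) * beta z * (theta_prim tau (Z.of_nat k) (Z.of_nat a) N z + jump_const tau k * jump_em tau (Z.of_nat k) (Z.of_nat a) N z) +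
         jump_const tau k * (/ e * (corr tau (Z.of_nat k) u (Z.of_nat a) N beta z - jump_em tau (Z.of_nat k) (Z.of_nat a) N z * beta z)))); [ring|].
      rewrite Em. ring.
  - intro z. unfold dbar_sol.
    rewrite (dbar_scal (prim_const tau k) (fun z => beta z * theta_prim tau (Z.of_nat k) (Z.of_nat a) N z + jump_const tau k * corr tau (Z.of_nat k) u (Z.of_nat a) N beta z)) by now apply smooth_partials.
    rewrite (dbar_plus (fun z => beta z * theta_prim tau (Z.of_nat k) (Z.of_nat a) N z) (fun z => jump_const tau k * corr tau (Z.of_nat k) u (Z.of_nat a) N beta z)) by now apply smooth_partials.
    rewrite dbar_mult by now apply smooth_partials. rewrite dbar_scal by now apply smooth_partials.
    unfold corr. rewrite dbar_fser by auto. rewrite Hbd, <- (dbar_theta_prim tau k a N z Ht Hk). ring.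
Qed.

(** Two solutions differ by a holomorphic section of L(0,u). *)
Lemma dbar_inv_unique tau u om h : ~ in_lattice tau u -> smooth_section tau 0 u h -> (forall z, dbar h z = om z) ->
  forall z, dbar_inv tau u om z = h z.
Proof.
  intros Hu Hh Hd.
  assert (Hspec : smooth_section tau 0 u (dbar_inv tau u om) /\ forall x, dbar (dbar_inv tau u om) x = om x).
  { unfold dbar_inv. apply epsilon_spec. exists h. auto. }
  destruct Hspec as [[Gs Gq] Gd]. destruct Hh as [Hs Hq]. set (g := dbar_inv tau u om) in *.
  assert (HD : H0 tau 0 u (fun z => g z + (- (1)) * h z)).
  { split; [|now apply qp_plus].
    apply CR_entire; [apply Cn_plus; [apply Gs|apply Cn_scal, Hs]|].
    intro z. rewrite (dbar_plus g (fun z => (- (1)) * h z)), dbar_scal, Gd, Hd; try (now apply smooth_partials); [ring|].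
    apply ex_partials_scal. now apply smooth_partials. }
  intro z. pose proof (H00_zero tau u _ Hu HD z) as E. cbv beta in E.
  replace (g z) with (g z + - (1) * h z + h z) by ring. rewrite E. ring.
Qed.

(** * Comparison with the Fukaya product *)

(** The jump is the full Gaussian integral [sqrt (pi / (2 pi t k))], whose square roots cancel
    those in the normalisation of the basis forms. *)
Lemma prim_const_jump_const tau k : (0 < Im tau)%R -> (0 < k)%nat -> prim_const tau k * jump_const tau k = - (2 * PI * Ci).
Proof.
  intros Ht Hk. apply lt_INR in Hk. simpl in Hk. pose proof PI_RGT_0 as Hpi.
  assert (E : (2 * Im tau * H1_const tau k * (2 * ghalf (gauss_par (Im tau) (Z.of_nat k))) = 2 * PI)%R).
  { unfold H1_const, ghalf, gauss_par. rewrite <- INR_IZR_INZ. set (t := Im tau) in *. set (n := INR k) in *.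
    replace (PI / (2 * PI * t * n))%R with (/ (t * (2 * n)))%R by (field; lra).
    rewrite sqrt_inv, (sqrt_mult t (2 * n)) by lra.
    assert (H1 : (0 < sqrt t)%R) by now apply sqrt_lt_R0. assert (H2 : (0 < sqrt (2 * n))%R) by (apply sqrt_lt_R0; lra).
    pose proof (sqrt_sqrt t ltac:(lra)) as H3.
    set (T := sqrt t) in *. set (S := sqrt (2 * n)) in *. clearbody T S. rewrite <- H3. field. lra. }
  unfold prim_const, jump_const.
  transitivity (RtoC (2 * Im tau * H1_const tau k * (2 * ghalf (gauss_par (Im tau) (Z.of_nat k)))) / Ci).
  - rewrite !RtoC_mult. unfold Cdiv. ring.
  - rewrite E, RtoC_mult. unfold Cdiv. rewrite Ci_inv. ring.
Qed.

Lemma qp_mult tau k k' u u' f g : quasi_periodic tau k u f -> quasi_periodic tau k' u' g ->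
  quasi_periodic tau (k + k') (u + u') (fun z => f z * g z).
Proof.
  intros Hf Hg z. destruct (Hf z) as [F1 F2]. destruct (Hg z) as [G1 G2]. split; [now rewrite F1, G1|].
  rewrite F2, G2. rewrite plus_IZR, RtoC_plus.
  replace (cexp (- (PI * Ci * (IZR k + IZR k') * tau) - 2 * PI * Ci * ((IZR k + IZR k') * z + (u + u'))))
   with (cexp (- (PI * Ci * IZR k * tau) - 2 * PI * Ci * (IZR k * z + u)) * cexp (- (PI * Ci * IZR k' * tau) - 2 * PI * Ci * (IZR k' * z + u'))).
  - ring.
  - rewrite <- cexp_plus. apply (f_equal cexp). ring.
Qed.

(** Fourier coefficients of a product are convolutions; the series for [corr] is integrated term by
    term. *)
Lemma fcoef_corr_mult tau k u j N beta1 beta2 d : (0 < Im tau)%R -> (0 < k)%nat -> ~ in_lattice tau u ->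
  H0 tau (Z.of_nat k) u beta1 -> (forall z, continuous beta2 z) ->
  fcoef d (fun z => corr tau (Z.of_nat k) u j N beta1 z * beta2 z) 0
  = ZSeries (fun m => corr_coef tau (Z.of_nat k) u j N beta1 m * fcoef (d - m) beta2 0).
Proof.
  intros Ht Hk Hu Hb Hc2. set (a := corr_coef tau (Z.of_nat k) u j N beta1). assert (Ra : rapid a) by now apply corr_coef_rapid.
  destruct (fser_dom 1 0 a 0 Ra) as [M HM].
  destruct (bounded_rectangle_C beta2 0 (Rle_refl _) Hc2) as (K & HK0 & HK).
  set (T := fun m r => a m * (beta2 (r, 0%R) * em (- (d - m)) (r, 0%R))).
  assert (HTc : forall m, ccont (T m)).
  { intro m. apply ccont_mult; [apply ccont_const|]. now apply fcoef_integrand_cont. }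
  assert (HTe : forall m r, T m r = (a m * em (1 * m + 0) (r, 0%R)) * (beta2 (r, 0%R) * em (- d) (r, 0%R))).
  { intros m r. unfold T. replace (- (d - m))%Z with ((1 * m + 0) + - d)%Z by ring. rewrite <- em_add. ring. }
  assert (HTd : forall r, (0 <= r <= 1)%R -> zdom (K * M) (fun m => T m r)).
  { intros r Hr m. rewrite HTe, Cmod_mult. specialize (HM (r, 0%R) ltac:(simpl; rewrite Rabs_R0; lra) m). cbv beta in HM.
    assert (E : (Cmod (beta2 (r, 0%R) * em (- d) (r, 0%R)) <= K)%R).
    { rewrite Cmod_mult, Cmod_em. simpl Im. rewrite Rmult_0_r, Ropp_0, exp_0, Rmult_1_r.
      apply (HK (r, 0%R)); simpl; lra. }
    replace (K * M * (/ 2) ^ Z.abs_nat m)%R with (M * (/ 2) ^ Z.abs_nat m * K)%R by ring.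
    apply Rmult_le_compat; auto; apply Cmod_ge_0. }
  assert (HS : forall r, ZSeries (fun m => T m r) = fser 1 0 a (r, 0%R) * beta2 (r, 0%R) * em (- d) (r, 0%R)).
  { intro r. rewrite (zs_ext _ _ (fun m => HTe m r)).
    rewrite (zs_ext _ (fun m => (beta2 (r, 0%R) * em (- d) (r, 0%R)) * (a m * em (1 * m + 0) (r, 0%R)))) by (intro; ring).
    rewrite (zs_scal M) by (apply HM; simpl; rewrite Rabs_R0; lra). unfold fser. ring. }
  destruct (zs_int T 0 1 (K * M)) as [_ E]; auto.
  { apply (ccont_ext _ _ (fun r => eq_sym (HS r))). apply ccont_mult; [apply ccont_mult|apply em_slice].
    - cont.
    - cont. }
  { intros r Hr. rewrite Rmin_left, Rmax_right in Hr by lra. now apply HTd. }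
  transitivity (cint (fun r => ZSeries (fun m => T m r)) 0 1).
  - apply cint_ext. intro r. rewrite HS. reflexivity.
  - rewrite E. apply zs_ext. intro m. unfold T. rewrite cint_scal by cont. reflexivity.
Qed.

Lemma residue_eqb m a b k : (0 < k)%Z -> (0 <= b < k)%Z -> Z.eqb (m mod k) ((b - a) mod k) = Z.eqb ((m + a) mod k) b.
Proof.
  intros Hk Hb. apply Bool.eq_true_iff_eq. rewrite !Z.eqb_eq. split; intro E.
  - rewrite <- Zplus_mod_idemp_l, E, Zplus_mod_idemp_l. replace (b - a + a)%Z with b by ring. now apply Z.mod_small.
  - rewrite <- E, Zminus_mod_idemp_l. apply (f_equal (fun x => (x mod k)%Z)). ring.
Qed.
Lemma residue_eqb_sub m c d l : (0 < l)%Z -> (0 <= c < l)%Z -> Z.eqb (m mod l) ((d - c) mod l) = Z.eqb ((d - m) mod l) c.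
Proof.
  intros Hk Hb. apply Bool.eq_true_iff_eq. rewrite !Z.eqb_eq. split; intro E.
  - rewrite <- Zminus_mod_idemp_r, E, Zminus_mod_idemp_r. replace (d - (d - c))%Z with c by ring. now apply Z.mod_small.
  - rewrite <- E, Zminus_mod_idemp_r. apply (f_equal (fun x => (x mod l)%Z)). ring.
Qed.

Definition Fukaya_term (tau : C) (k l a d : nat) (u w : C) (m : Z) : C :=
  cexp (PI * Ci * (INR k + INR l) / (INR k * INR l) * (tau * (IZR m * IZR m) + 2 * IZR m * u)
        - 2 * PI * Ci * (IZR m * w / INR l)
        + 2 * PI * Ci * (IZR m * tau + u) * (IZR (n_zero tau k l a d w) - INR d / INR l + INR a / INR k))
  / (1 - cexp (2 * PI * Ci * (IZR m * tau + u))).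
(** The congruences on [m] in the definition of [Fukaya_coef]. *)
Definition Fukaya_cond (k l a b c d : nat) (m : Z) : bool :=
  (Z.eqb (m mod Z.of_nat k) ((Z.of_nat b - Z.of_nat a) mod Z.of_nat k) &&
   Z.eqb (m mod Z.of_nat l) ((Z.of_nat d - Z.of_nat c) mod Z.of_nat l))%Z%bool.
Lemma Fukaya_coef_eq tau k l a b c d u w :
  Fukaya_coef tau k l a b c d u w = - (2 * PI * Ci) * ZSeries (fun m => if Fukaya_cond k l a b c d m then Fukaya_term tau k l a d u w m else 0).
Proof. reflexivity. Qed.

(** Expanding the quadratic exponents: the Fukaya summand is a product of theta coefficients of
    L(k,u), L(l,w-u) and inverses of such for L(k,0), L(l,w), with [N] in the role of the free
    integer. *)
Lemma Fukaya_term_eq tau k l a d u w m : (0 < Im tau)%R -> (0 < k)%nat -> (0 < l)%nat ->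
  let N := n_zero tau k l a d w in
  Fukaya_term tau k l a d u w m = / theta_coef tau (Z.of_nat l) w (Z.of_nat d) * (ecoef tau (Z.of_nat k) (Z.of_nat a) N
     * theta_coef tau (Z.of_nat k) u (m + (Z.of_nat k * N + Z.of_nat a)) / (1 - zeta tau u m)) * theta_coef tau (Z.of_nat l) (w - u) (Z.of_nat d - m).
Proof.
  intros Ht Hk Hl N. unfold Fukaya_term. fold (zeta tau u m). fold N.
  assert (Hk' : RtoC (IZR (Z.of_nat k)) <> 0) by (apply RtoC_neq_0, not_0_IZR; lia).
  assert (Hl' : RtoC (IZR (Z.of_nat l)) <> 0) by (apply RtoC_neq_0, not_0_IZR; lia).
  unfold Cdiv at 1. 
  match goal with |- cexp ?E * / ?z = / ?p * (?q * ?r / ?z) * ?s =>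
    transitivity (/ p * q * r * s * / z); [|unfold Cdiv; ring]; apply (f_equal (fun x => x * / z)) end.
  unfold ecoef, theta_coef. rewrite <- !cexp_opp, <- !cexp_plus. apply (f_equal cexp).
  rewrite !INR_IZR_INZ. rewrite minus_IZR, !plus_IZR, mult_IZR, RtoC_minus, !RtoC_plus, RtoC_mult.
  field. auto.
Qed.

Lemma Fukaya_term_dom tau k l a d u w : (0 < Im tau)%R -> (0 < k)%nat -> (0 < l)%nat -> ~ in_lattice tau u ->
  exists M, zdom M (Fukaya_term tau k l a d u w).
Proof.
  intros Ht Hk Hl Hu. pose proof PI_RGT_0 as Hpi. set (N := n_zero tau k l a d w).
  assert (Hkz : (0 < Z.of_nat k)%Z) by lia. assert (Hlz : (0 < Z.of_nat l)%Z) by lia.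
  assert (Hkz' := IZR_lt _ _ Hkz). assert (Hlz' := IZR_lt _ _ Hlz).
  destruct (zeta_lower tau u Ht Hu) as (dl & Hdl & HZ).
  destruct (theta_coef_bound tau (Z.of_nat k) u true (Z.of_nat k * N + Z.of_nat a) Ht Hkz) as (A1 & B1 & H1).
  destruct (theta_coef_bound tau (Z.of_nat l) (w - u) false (Z.of_nat d) Ht Hlz) as (A2 & B2 & H2).
  set (c1 := (PI * Im tau / IZR (Z.of_nat k))%R) in *. set (c2 := (PI * Im tau / IZR (Z.of_nat l))%R) in *.
  assert (Hc1 : (0 < c1)%R) by (apply Rdiv_lt_0_compat; auto; apply Rmult_lt_0_compat; lra).
  assert (Hc2 : (0 < c2)%R) by (apply Rdiv_lt_0_compat; auto; apply Rmult_lt_0_compat; lra).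
  destruct (gauss_dom (A1 + A2) (B1 + B2) (c1 + c2) ltac:(lra)) as (M & HM & G).
  set (L := (Cmod (/ theta_coef tau (Z.of_nat l) w (Z.of_nat d)) * Cmod (ecoef tau (Z.of_nat k) (Z.of_nat a) N) * / dl)%R).
  assert (HL : (0 <= L)%R).
  { apply Rmult_le_pos; [apply Rmult_le_pos; apply Cmod_ge_0|left; now apply Rinv_0_lt_compat]. }
  exists (L * M)%R. intro m. rewrite Fukaya_term_eq by auto. fold N.
  rewrite !Cmod_mult. unfold Cdiv. rewrite !Cmod_mult, (Cmod_inv (1 - zeta tau u m)) by now apply zeta_neq_1.
  specialize (H1 m). specialize (H2 m). cbv iota in H1, H2. specialize (HZ m).
  replace (Z.of_nat d - m)%Z with (- m + Z.of_nat d)%Z by ring.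
  assert (E : (exp (A1 + B1 * Rabs (IZR m) - c1 * IZR m ^ 2) * exp (A2 + B2 * Rabs (IZR m) - c2 * IZR m ^ 2) <= M * (/ 2) ^ Z.abs_nat m)%R).
  { rewrite <- exp_plus. apply G. lra. }
  set (X1 := Cmod (/ theta_coef tau (Z.of_nat l) w (Z.of_nat d))) in *. set (X2 := Cmod (ecoef tau (Z.of_nat k) (Z.of_nat a) N)) in *.
  set (Y1 := Cmod (theta_coef tau (Z.of_nat k) u _)) in *. set (Y2 := Cmod (theta_coef tau (Z.of_nat l) (w - u) _)) in *.
  set (Z1 := Cmod (1 - zeta tau u m)) in *.
  assert (HY1 : (0 <= Y1)%R) by apply Cmod_ge_0. assert (HY2 : (0 <= Y2)%R) by apply Cmod_ge_0.
  assert (HX1 : (0 <= X1)%R) by apply Cmod_ge_0. assert (HX2 : (0 <= X2)%R) by apply Cmod_ge_0.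
  assert (HZi : (0 <= / Z1 <= / dl)%R).
  { split; [left; apply Rinv_0_lt_compat; lra|apply Rinv_le_contravar; auto]. }
  replace (X1 * (X2 * Y1 * / Z1) * Y2)%R with (X1 * X2 * / Z1 * (Y1 * Y2))%R by ring.
  apply Rle_trans with (L * (Y1 * Y2))%R.
  - apply Rmult_le_compat_r; [now apply Rmult_le_pos|]. unfold L.
    apply Rmult_le_compat_l; [now apply Rmult_le_pos|tauto].
  - rewrite (Rmult_assoc L M). apply Rmult_le_compat_l; auto. eapply Rle_trans; [|exact E]. now apply Rmult_le_compat.
Qed.

(** For each [m] the two congruences hold for exactly one pair of indices. *)
Lemma Csum_residues k l (B G : nat -> C) (a d : nat) (m : Z) (X : C) : (0 < k)%nat -> (0 < l)%nat ->
  Csum k (fun b => Csum l (fun c => B b * G c * (if Fukaya_cond k l a b c d m then X else 0)))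
  = B (Z.to_nat ((m + Z.of_nat a) mod Z.of_nat k)) * G (Z.to_nat ((Z.of_nat d - m) mod Z.of_nat l)) * X.
Proof.
  intros Hk Hl.
  pose proof (Z.mod_pos_bound (m + Z.of_nat a) (Z.of_nat k) ltac:(lia)) as Hb.
  pose proof (Z.mod_pos_bound (Z.of_nat d - m) (Z.of_nat l) ltac:(lia)) as Hc.
  set (b0 := Z.to_nat ((m + Z.of_nat a) mod Z.of_nat k)). set (c0 := Z.to_nat ((Z.of_nat d - m) mod Z.of_nat l)).
  assert (Hcond : forall b c, (b < k)%nat -> (c < l)%nat -> Fukaya_cond k l a b c d m = (Nat.eqb b b0 && Nat.eqb c c0)%bool).
  { intros b c Hbk Hcl. unfold Fukaya_cond. rewrite residue_eqb, residue_eqb_sub by lia.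
    f_equal; apply Bool.eq_true_iff_eq; rewrite Z.eqb_eq, Nat.eqb_eq; unfold b0, c0; lia. }
  rewrite (Csum_single k (fun b => Csum l (fun c => B b * G c * (if Fukaya_cond k l a b c d m then X else 0))) b0).
  - rewrite (Csum_single l (fun c => B b0 * G c * (if Fukaya_cond k l a b0 c d m then X else 0)) c0).
    + rewrite Hcond, !Nat.eqb_refl by (unfold b0, c0; lia). reflexivity.
    + unfold c0; lia.
    + intros c Hcl Hne. rewrite Hcond by (unfold b0; lia). apply Nat.eqb_neq in Hne. rewrite Hne, Bool.andb_false_r. ring.
  - unfold b0; lia.
  - intros b Hbk Hne. apply Csum_0. intros c Hcl. rewrite Hcond by auto. apply Nat.eqb_neq in Hne. rewrite Hne. simpl. ring.
Qed.

(** Both sides are sums over [m] of the same terms; on the left the indices [b] and [c] are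
    determined by [m], on the right [m] is restricted by them. *)
Lemma Fukaya_sum tau k l u w a d beta1 beta2 : (0 < Im tau)%R -> (0 < k)%nat -> (0 < l)%nat -> ~ in_lattice tau u ->
  H0 tau (Z.of_nat k) u beta1 -> H0 tau (Z.of_nat l) (w - u) beta2 ->
  / theta_coef tau (Z.of_nat l) w (Z.of_nat d) * (prim_const tau k * (jump_const tau k *
     fcoef (Z.of_nat d) (fun z => corr tau (Z.of_nat k) u (Z.of_nat a) (n_zero tau k l a d w) beta1 z * beta2 z) 0))
  = Csum k (fun b => Csum l (fun c => coord_H0 tau k u beta1 b * coord_H0 tau l (w - u) beta2 c * Fukaya_coef tau k l a b c d u w)).
Proof.
  intros Ht Hk Hl Hu Hb1 Hb2. set (B := coord_H0 tau k u beta1). set (G := coord_H0 tau l (w - u) beta2).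
  set (N := n_zero tau k l a d w). set (T := / theta_coef tau (Z.of_nat l) w (Z.of_nat d)).
  destruct (Fukaya_term_dom tau k l a d u w Ht Hk Hl Hu) as [M HM].
  assert (HMc : forall b c, zdom M (fun m => if Fukaya_cond k l a b c d m then Fukaya_term tau k l a d u w m else 0)).
  { intros b c m. destruct (Fukaya_cond k l a b c d m); [apply HM|]. rewrite Cmod_0.
    apply Rmult_le_pos; [now apply (zdom_pos _ _ HM)|left; apply half_pow_pos]. }
  rewrite (fcoef_corr_mult tau k u (Z.of_nat a) N beta1 beta2 (Z.of_nat d) Ht Hk Hu Hb1 (H0_cont _ _ _ _ Hb2)).
  assert (EF : forall m, Csum k (fun b => Csum l (fun c => B b * G c * (if Fukaya_cond k l a b c d m then Fukaya_term tau k l a d u w m else 0)))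
     = T * (corr_coef tau (Z.of_nat k) u (Z.of_nat a) N beta1 m * fcoef (Z.of_nat d - m) beta2 0)).
  { intro m. rewrite Csum_residues by auto. rewrite Fukaya_term_eq by auto. fold N T. unfold corr_coef.
    rewrite (H0_fcoef tau k u beta1 _ Ht Hk Hb1), (H0_fcoef tau l (w - u) beta2 _ Ht Hl Hb2). fold B G.
    replace ((m + (Z.of_nat k * N + Z.of_nat a)) mod Z.of_nat k)%Z with ((m + Z.of_nat a) mod Z.of_nat k)%Z.
    2:{ replace (m + (Z.of_nat k * N + Z.of_nat a))%Z with (m + Z.of_nat a + N * Z.of_nat k)%Z by ring. rewrite Z.mod_add by lia. reflexivity. }
    unfold Cdiv. ring. }
  assert (Hcol : forall b, (exists M', zdom M' (fun m => Csum l (fun c => B b * G c * (if Fukaya_cond k l a b c d m then Fukaya_term tau k l a d u w m else 0)))) /\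
     ZSeries (fun m => Csum l (fun c => B b * G c * (if Fukaya_cond k l a b c d m then Fukaya_term tau k l a d u w m else 0)))
     = Csum l (fun c => B b * G c * ZSeries (fun m => if Fukaya_cond k l a b c d m then Fukaya_term tau k l a d u w m else 0))).
  { intro b. destruct (zs_csum l (fun c m => B b * G c * (if Fukaya_cond k l a b c d m then Fukaya_term tau k l a d u w m else 0))) as [D E].
    - intros c _. eexists. apply zdom_scal. apply (HMc b c).
    - split; auto. rewrite E. apply Csum_ext. intros c _. apply (zs_scal M _ _ (HMc b c)). }
  destruct (zs_csum k (fun b m => Csum l (fun c => B b * G c * (if Fukaya_cond k l a b c d m then Fukaya_term tau k l a d u w m else 0)))) as [[M' D] E].
  { intros b _. apply Hcol. }
  assert (HT : T <> 0).
  { unfold T. intro E0. pose proof (theta_coef_neq_0 tau (Z.of_nat l) w (Z.of_nat d)) as Hn. apply Hn.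
    rewrite <- (Cmult_1_l (theta_coef _ _ _ _)), <- (Cinv_l _ Hn) at 1. rewrite E0. ring. }
  assert (ET : ZSeries (fun m => T * (corr_coef tau (Z.of_nat k) u (Z.of_nat a) N beta1 m * fcoef (Z.of_nat d - m) beta2 0))
    = T * ZSeries (fun m => corr_coef tau (Z.of_nat k) u (Z.of_nat a) N beta1 m * fcoef (Z.of_nat d - m) beta2 0)).
  { apply (zs_scal (Cmod (/ T) * M')). intro m. pose proof (zdom_scal _ (/ T) _ D m) as K. cbv beta in K. rewrite EF in K.
    rewrite Cmult_assoc, Cinv_l, Cmult_1_l in K by auto. exact K. }
  rewrite (zs_ext _ _ EF), ET in E.
  match goal with |- T * (?c * (?j * ?s)) = _ => transitivity ((c * j) * (T * s)); [ring|] end.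
  rewrite E, prim_const_jump_const, <- Csum_scal by auto. apply Csum_ext. intros b _.
  rewrite (proj2 (Hcol b)), <- Csum_scal. apply Csum_ext. intros c _. rewrite Fukaya_coef_eq. ring.
Qed.

(** The part of the coordinate of index [d] of m_3 that involves [beta1] and [beta2] only through
    [beta = beta1 * beta2]. *)
Definition n2coef (tau : C) (k l : nat) (w : C) (alpha beta : C -> C) (d : nat) : C :=
  / theta_coef tau (Z.of_nat l) w (Z.of_nat d) *
  (Csum k (fun a => coord_H1 tau k alpha a * (prim_const tau k *
      fcoef (Z.of_nat d) (fun z => beta z * theta_prim tau (Z.of_nat k) (Z.of_nat a) (n_zero tau k l a d w) z) 0))
   + 2 / Ci * dbar_pair tau (Z.of_nat l) w (Z.of_nat d) (fun z => alpha z * beta z) / theta_norm tau (Z.of_nat l) w (Z.of_nat d)).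
Definition n2map (tau : C) (k l : nat) (w : C) (alpha beta : C -> C) (x : C) : C :=
  Csum l (fun d => n2coef tau k l w alpha beta d * basis_H0 tau l w d x).

Lemma coord_H1_lin tau k p f g a : (forall z, continuous f z) -> (forall z, continuous g z) ->
  coord_H1 tau k (fun z => p * f z + g z) a = p * coord_H1 tau k f a + coord_H1 tau k g a.
Proof.
  intros Hf Hg. unfold coord_H1.
  assert (Kf : ccont (fun r => f (r, 0%R) * em (Z.of_nat a) (r, 0%R))) by cont.
  assert (Kg : ccont (fun r => g (r, 0%R) * em (Z.of_nat a) (r, 0%R))) by cont.
  set (F := fun r => f (r, 0%R) * em (Z.of_nat a) (r, 0%R)) in *. set (G := fun r => g (r, 0%R) * em (Z.of_nat a) (r, 0%R)) in *.
  rewrite (cint_ext _ (fun r => p * F r + G r)) by (intro; unfold F, G; ring).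
  rewrite (cint_plus (fun r => p * F r) G), (cint_scal p F); auto.
  - unfold Cdiv. ring.
  - cont.
Qed.
Lemma product_qp tau k l w alpha beta : quasi_periodic tau (- Z.of_nat k) 0 alpha -> quasi_periodic tau (Z.of_nat (k + l)) w beta ->
  quasi_periodic tau (Z.of_nat l) w (fun z => alpha z * beta z).
Proof.
  intros Ha Hb. pose proof (qp_mult _ _ _ _ _ _ _ Ha Hb) as Q.
  replace (- Z.of_nat k + Z.of_nat (k + l))%Z with (Z.of_nat l) in Q by lia. replace (0 + w) with w in Q by ring. exact Q.
Qed.
Lemma dbar_pair_ext tau l w d f g : (forall z, f z = g z) -> dbar_pair tau l w d f = dbar_pair tau l w d g.
Proof. intro H. apply (f_equal (dbar_pair tau l w d)). now apply functional_extensionality. Qed.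

Lemma n2map_bilinear tau k l w : (0 < Im tau)%R -> (0 < k)%nat -> (0 < l)%nat ->
  bilinear_on (H1 tau (- Z.of_nat k) 0) (H0 tau (Z.of_nat (k + l)) w) (H0 tau (Z.of_nat l) w) (n2map tau k l w).
Proof.
  intros Ht Hk Hl. assert (Hkz : (0 < Z.of_nat k)%Z) by lia. assert (Hlz : (0 < Z.of_nat l)%Z) by lia.
  assert (HSc : forall a N z, continuous (theta_prim tau (Z.of_nat k) (Z.of_nat a) N) z).
  { intros a N. now apply smooth_cont, smooth_theta_prim. }
  split; [|split].
  - intros f g _ _. apply H0_csum. intro i. now apply basis_H0_H0.
  - intros p f1 f2 g [[S1 Q1] _] [[S2 Q2] _] Hg x.
    assert (C1 := smooth_cont _ S1). assert (C2 := smooth_cont _ S2). assert (Cg := H0_cont _ _ _ _ Hg).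
    unfold n2map. rewrite <- Csum_scal, <- Csum_plus. apply Csum_ext. intros d Hd. unfold n2coef.
    rewrite (dbar_pair_ext _ _ _ _ (fun z : C => (p * f1 z + f2 z) * g z) (fun z : C => p * (f1 z * g z) + f2 z * g z)) by (intro; ring).
    rewrite (dbar_pair_lin tau (Z.of_nat l) w (Z.of_nat d) p (fun z : C => f1 z * g z) (fun z : C => f2 z * g z)); auto.
    2:{ cont. } 2:{ apply (product_qp tau k l); [exact Q1|apply Hg]. }
    2:{ cont. } 2:{ apply (product_qp tau k l); [exact Q2|apply Hg]. }
    rewrite (Csum_ext k _ (fun a => p * (coord_H1 tau k f1 a * (prim_const tau k * fcoef (Z.of_nat d) (fun z : C => g z * theta_prim tau (Z.of_nat k) (Z.of_nat a) (n_zero tau k l a d w) z) 0))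
      + coord_H1 tau k f2 a * (prim_const tau k * fcoef (Z.of_nat d) (fun z : C => g z * theta_prim tau (Z.of_nat k) (Z.of_nat a) (n_zero tau k l a d w) z) 0))).
    2:{ intros a _. rewrite coord_H1_lin by auto. ring. }
    rewrite Csum_plus, Csum_scal. unfold Cdiv. ring.
  - intros p f g1 g2 [[S Q] _] Hg1 Hg2 x.
    assert (Cf := smooth_cont _ S). assert (C1 := H0_cont _ _ _ _ Hg1). assert (C2 := H0_cont _ _ _ _ Hg2).
    unfold n2map. rewrite <- Csum_scal, <- Csum_plus. apply Csum_ext. intros d Hd. unfold n2coef.
    rewrite (dbar_pair_ext _ _ _ _ (fun z : C => f z * (p * g1 z + g2 z)) (fun z : C => p * (f z * g1 z) + f z * g2 z)) by (intro; ring).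
    rewrite (dbar_pair_lin tau (Z.of_nat l) w (Z.of_nat d) p (fun z : C => f z * g1 z) (fun z : C => f z * g2 z)); auto.
    2:{ cont. } 2:{ apply (product_qp tau k l); [exact Q|apply Hg1]. }
    2:{ cont. } 2:{ apply (product_qp tau k l); [exact Q|apply Hg2]. }
    rewrite (Csum_ext k _ (fun a => p * (coord_H1 tau k f a * (prim_const tau k * fcoef (Z.of_nat d) (fun z : C => g1 z * theta_prim tau (Z.of_nat k) (Z.of_nat a) (n_zero tau k l a d w) z) 0))
      + coord_H1 tau k f a * (prim_const tau k * fcoef (Z.of_nat d) (fun z : C => g2 z * theta_prim tau (Z.of_nat k) (Z.of_nat a) (n_zero tau k l a d w) z) 0))).
    2:{ intros a _. set (S1 := theta_prim tau (Z.of_nat k) (Z.of_nat a) (n_zero tau k l a d w)).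
        rewrite (fcoef_ext _ (fun z : C => (p * g1 z + g2 z) * S1 z) (fun z : C => p * (g1 z * S1 z) + g2 z * S1 z)) by (intro; ring).
        rewrite (fcoef_lin (Z.of_nat d) p (fun z : C => g1 z * S1 z) (fun z : C => g2 z * S1 z)).
        - ring.
        - intro z. apply ctn_mult; auto. apply HSc.
        - intro z. apply ctn_mult; auto. apply HSc. }
    rewrite Csum_plus, Csum_scal. unfold Cdiv. ring.
Qed.

Lemma coord_H0_unique tau k u f B : (0 < Im tau)%R -> (0 < k)%nat ->
  (forall x, f x = Csum k (fun a => B a * basis_H0 tau k u a x)) -> forall a, (a < k)%nat -> B a = coord_H0 tau k u f a.
Proof.
  intros Ht Hk HB a Ha. unfold coord_H0. rewrite (fcoef_ext _ _ _ 0 HB), fcoef_comb by auto.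
  rewrite Z.mod_small, Nat2Z.id by lia. field. apply theta_coef_neq_0.
Qed.
Lemma coords_spec n e f : (exists c, forall x, f x = Csum n (fun a => c a * e a x)) ->
  forall x, f x = Csum n (fun a => coords n e f a * e a x).
Proof. intro H. unfold coords. now apply epsilon_spec. Qed.

Lemma m3'_formula tau k l u w alpha beta1 beta2 x : (0 < Im tau)%R -> (0 < k)%nat -> (0 < l)%nat ->
  H1 tau (- Z.of_nat k) 0 alpha -> H0 tau (Z.of_nat k) u beta1 -> H0 tau (Z.of_nat l) (w - u) beta2 ->
  m3' tau k l u w alpha beta1 beta2 x = Csum l (fun d => Csum k (fun a => coord_H1 tau k alpha a *
    Csum k (fun b => Csum l (fun c => coord_H0 tau k u beta1 b * coord_H0 tau l (w - u) beta2 c * Fukaya_coef tau k l a b c d u w)))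
    * basis_H0 tau l w d x).
Proof.
  intros Ht Hk Hl Ha Hb1 Hb2. unfold m3'. cbv zeta.
  pose proof (coord_H1_unique tau k alpha _ Ht Hk (coords_spec _ _ _ (H1_span tau k alpha Ht Hk Ha))) as EA.
  pose proof (coord_H0_unique tau k u beta1 _ Ht Hk (coords_spec _ _ _ (ex_intro _ _ (H0_span tau k u beta1 Ht Hk Hb1)))) as EB.
  pose proof (coord_H0_unique tau l (w - u) beta2 _ Ht Hl (coords_spec _ _ _ (ex_intro _ _ (H0_span tau l (w - u) beta2 Ht Hl Hb2)))) as EG.
  transitivity (Csum k (fun a => Csum l (fun d => coord_H1 tau k alpha a * Csum k (fun b => Csum l (fun c => coord_H0 tau k u beta1 b * coord_H0 tau l (w - u) beta2 c * Fukaya_coef tau k l a b c d u w)) * basis_H0 tau l w d x))).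
  - apply Csum_ext. intros a Hak. rewrite (EA a Hak).
    transitivity (Csum k (fun b => Csum l (fun d => Csum l (fun c => coord_H1 tau k alpha a * coord_H0 tau k u beta1 b * coord_H0 tau l (w - u) beta2 c * (Fukaya_coef tau k l a b c d u w * basis_H0 tau l w d x))))).
    + apply Csum_ext. intros b Hbk. rewrite (EB b Hbk).
      rewrite (Csum_swap l l). apply Csum_ext. intros c Hcl. rewrite (EG c Hcl), <- Csum_scal. reflexivity.
    + rewrite Csum_swap. apply Csum_ext. intros d Hdl.
      rewrite Cmult_comm, Cmult_assoc, <- Csum_scal. apply Csum_ext. intros b Hbk.
      rewrite <- Csum_scal. apply Csum_ext. intros c Hcl. ring.
  - rewrite Csum_swap. apply Csum_ext. intros d Hdl.
    rewrite (Cmult_comm (Csum k _)), <- Csum_scal. apply Csum_ext. intros; ring.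
Qed.

(** For each [d] the inverse of dbar is written with its own integers [n_zero], one for each [a];
    uniqueness of the inverse makes this legitimate. *)
Lemma m3_formula tau k l u w alpha beta1 beta2 x : (0 < Im tau)%R -> (0 < k)%nat -> (0 < l)%nat -> ~ in_lattice tau u ->
  H1 tau (- Z.of_nat k) 0 alpha -> H0 tau (Z.of_nat k) u beta1 -> H0 tau (Z.of_nat l) (w - u) beta2 ->
  m3 tau l u w alpha beta1 beta2 x = Csum l (fun d =>
    (n2coef tau k l w alpha (fun y => beta1 y * beta2 y) d +
     / theta_coef tau (Z.of_nat l) w (Z.of_nat d) * Csum k (fun a => coord_H1 tau k alpha a * (prim_const tau k * (jump_const tau k *
       fcoef (Z.of_nat d) (fun z : C => corr tau (Z.of_nat k) u (Z.of_nat a) (n_zero tau k l a d w) beta1 z * beta2 z) 0))))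
    * basis_H0 tau l w d x).
Proof.
  intros Ht Hk Hl Hu Hal Hb1 Hb2. assert (Hkz : (0 < Z.of_nat k)%Z) by lia.
  set (A := coord_H1 tau k alpha).
  assert (EA : forall x, alpha x = Csum k (fun a => A a * basis_H1 tau k a x)).
  { destruct (H1_span tau k alpha Ht Hk Hal) as [A0 HA0]. intro y. rewrite (HA0 y). apply Csum_ext. intros a Hak.
    now rewrite (coord_H1_unique tau k alpha A0 Ht Hk HA0 a Hak). }
  destruct (H0_smooth tau l (w - u) beta2 Ht Hl Hb2) as [B2s B2d].
  assert (B2c := smooth_cont _ B2s). assert (B1c := H0_cont _ _ _ _ Hb1).
  set (om := fun y => alpha y * beta1 y).
  set (h := fun (d : nat) z => Csum k (fun a => A a * dbar_sol tau k u a (n_zero tau k l a d w) beta1 z)).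
  assert (Hhs : forall a N, smooth (dbar_sol tau k u a N beta1)) by (intros a N; apply (dbar_sol_spec tau k u a N beta1 Ht Hk Hu Hb1)).
  assert (Hh : forall d, smooth_section tau 0 u (h d) /\ forall z, dbar (h d) z = om z).
  { intro d. split; [split|].
    - apply (smooth_csum k (fun a z => A a * dbar_sol tau k u a (n_zero tau k l a d w) beta1 z)). intro a. apply smooth_scal, Hhs.
    - apply (qp_csum tau 0 u k (fun a z => A a * dbar_sol tau k u a (n_zero tau k l a d w) beta1 z)). intro a. apply qp_scal.
      apply (dbar_sol_spec tau k u a _ beta1 Ht Hk Hu Hb1).
    - intro z. assert (HP : forall a, ex_partials (dbar_sol tau k u a (n_zero tau k l a d w) beta1) z) by (intro a; apply smooth_partials, Hhs).
      unfold h. rewrite (proj2 (dbar_csum k (fun a z => A a * dbar_sol tau k u a (n_zero tau k l a d w) beta1 z) z (fun a => ex_partials_scal _ _ _ (HP a)))).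
      unfold om. rewrite EA, Cmult_comm, <- Csum_scal. apply Csum_ext. intros a Hak. rewrite dbar_scal by apply HP.
      rewrite (proj2 (dbar_sol_spec tau k u a _ beta1 Ht Hk Hu Hb1)). ring. }
  assert (Hinv : forall d z, dbar_inv tau u om z = h d z).
  { intros d z. destruct (Hh d) as [H1 H2]. now apply dbar_inv_unique. }
  set (F := fun z => h 0%nat z * beta2 z).
  (* The integers [N] occurring in [h d] are those required by the coordinate of index [d]. *)
  assert (HFd : forall d, F = fun z => h d z * beta2 z).
  { intro d. apply functional_extensionality. intro z. unfold F. now rewrite <- (Hinv 0%nat z), (Hinv d z). }
  assert (Fs : smooth F) by (apply smooth_mult; auto; apply (Hh 0%nat)).
  assert (Fq : quasi_periodic tau (Z.of_nat l) w F).
  { pose proof (qp_mult _ _ _ _ _ _ _ (proj2 (proj1 (Hh 0%nat))) (proj2 Hb2)) as Q.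
    replace (u + (w - u)) with w in Q by ring. exact Q. }
  assert (Fd : forall z, dbar F z = alpha z * (beta1 z * beta2 z)).
  { intro z. unfold F. rewrite dbar_mult by (apply smooth_partials; auto; apply (Hh 0%nat)).
    rewrite B2d, (proj2 (Hh 0%nat)). unfold om. ring. }
  assert (Fdq := dbar_qp _ _ _ _ Fs Fq).
  assert (E0 : m3 tau l u w alpha beta1 beta2 x = pr tau (Z.of_nat l) w F x).
  { unfold m3. apply (f_equal (fun G => pr tau (Z.of_nat l) w G x)). apply functional_extensionality. intro z.
    fold om. now rewrite (Hinv 0%nat z). }
  rewrite E0, (pr_formula tau l w F Ht Hl (smooth_cont _ Fs) Fq). apply Csum_ext. intros d Hd.
  apply (f_equal (fun v => v * basis_H0 tau l w d x)). unfold pcoef.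
  rewrite (pairing_smooth tau l w F d Ht Hl Hd Fs Fq Fdq).
  rewrite (dbar_pair_ext tau (Z.of_nat l) w (Z.of_nat d) (dbar F) (fun z : C => alpha z * (beta1 z * beta2 z)) Fd).
  pose proof (theta_norm_neq_0 tau l w d Ht Hl Hd) as HN. pose proof (theta_coef_neq_0 tau (Z.of_nat l) w (Z.of_nat d)) as HT.
  assert (Ef : fcoef (Z.of_nat d) F 0 =
     Csum k (fun a => A a * (prim_const tau k * fcoef (Z.of_nat d) (fun z : C => beta1 z * beta2 z * theta_prim tau (Z.of_nat k) (Z.of_nat a) (n_zero tau k l a d w) z) 0))
     + Csum k (fun a => A a * (prim_const tau k * (jump_const tau k * fcoef (Z.of_nat d) (fun z : C => corr tau (Z.of_nat k) u (Z.of_nat a) (n_zero tau k l a d w) beta1 z * beta2 z) 0)))).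
  { rewrite (HFd d).
    assert (Sc : forall a, (forall z, continuous (fun z : C => beta1 z * beta2 z * theta_prim tau (Z.of_nat k) (Z.of_nat a) (n_zero tau k l a d w) z) z)).
    { intros a z. apply ctn_mult; [now apply ctn_mult|]. now apply smooth_cont, smooth_theta_prim. }
    assert (Hc2 : forall a, (forall z, continuous (fun z : C => corr tau (Z.of_nat k) u (Z.of_nat a) (n_zero tau k l a d w) beta1 z * beta2 z) z)).
    { intros a z. apply ctn_mult; auto. apply fser_cont. now apply corr_coef_rapid. }
    rewrite (fcoef_ext _ _ (fun z : C => Csum k (fun a => (A a * prim_const tau k) *
       (jump_const tau k * (corr tau (Z.of_nat k) u (Z.of_nat a) (n_zero tau k l a d w) beta1 z * beta2 z) + beta1 z * beta2 z * theta_prim tau (Z.of_nat k) (Z.of_nat a) (n_zero tau k l a d w) z)))).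
    2:{ intro z. unfold h. rewrite Cmult_comm, <- Csum_scal. apply Csum_ext. intros a _. unfold dbar_sol. ring. }
    rewrite (fcoef_csum (Z.of_nat d) k (fun a z => (A a * prim_const tau k) *
       (jump_const tau k * (corr tau (Z.of_nat k) u (Z.of_nat a) (n_zero tau k l a d w) beta1 z * beta2 z) + beta1 z * beta2 z * theta_prim tau (Z.of_nat k) (Z.of_nat a) (n_zero tau k l a d w) z))).
    2:{ intros a z. apply ctn_mult; [apply continuous_const|]. apply ctn_plus; [|apply Sc]. apply ctn_mult; [apply continuous_const|apply Hc2]. }
    rewrite <- Csum_plus. apply Csum_ext. intros a _.
    rewrite (fcoef_scal (Z.of_nat d) (A a * prim_const tau k) (fun z : C => jump_const tau k * (corr tau (Z.of_nat k) u (Z.of_nat a) (n_zero tau k l a d w) beta1 z * beta2 z) + beta1 z * beta2 z * theta_prim tau (Z.of_nat k) (Z.of_nat a) (n_zero tau k l a d w) z)).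
    2:{ intros z. apply ctn_plus; [|apply Sc]. apply ctn_mult; [apply continuous_const|apply Hc2]. }
    rewrite (fcoef_lin (Z.of_nat d) (jump_const tau k) (fun z : C => corr tau (Z.of_nat k) u (Z.of_nat a) (n_zero tau k l a d w) beta1 z * beta2 z)
       (fun z : C => beta1 z * beta2 z * theta_prim tau (Z.of_nat k) (Z.of_nat a) (n_zero tau k l a d w) z) 0 (Hc2 a) (Sc a)). ring. }
  rewrite Ef. unfold n2coef. fold A. field. repeat split; auto. apply Ci_nz.
Qed.

Theorem mainTheorem3 (tau : C) (htau : (0 < Im tau)%R)
    (k l : nat) (hk : (0 < k)%nat) (hl : (0 < l)%nat) (w : C) :
  exists n2 : (C -> C) -> (C -> C) -> (C -> C),
    bilinear_on (H1 tau (- Z.of_nat k) 0)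
                (H0 tau (Z.of_nat (k + l)) w)
                (H0 tau (Z.of_nat l) w) n2 /\
    forall u : C, ~ in_lattice tau u ->
    forall alpha beta1 beta2 : C -> C,
      H1 tau (- Z.of_nat k) 0 alpha ->
      H0 tau (Z.of_nat k) u beta1 ->
      H0 tau (Z.of_nat l) (w - u) beta2 ->
      forall x : C,
        m3 tau l u w alpha beta1 beta2 x - m3' tau k l u w alpha beta1 beta2 x
        = n2 alpha (fun y => beta1 y * beta2 y) x.
Proof.
  exists (n2map tau k l w). split; [now apply n2map_bilinear|].
  intros u Hu alpha beta1 beta2 Ha Hb1 Hb2 x.
  rewrite (m3_formula tau k l u w alpha beta1 beta2 x htau hk hl Hu Ha Hb1 Hb2).
  rewrite (m3'_formula tau k l u w alpha beta1 beta2 x htau hk hl Ha Hb1 Hb2).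
  unfold n2map.
  match goal with |- Csum l ?P - Csum l ?Q = Csum l ?R => transitivity (Csum l (fun d => R d + Q d) - Csum l Q); [|rewrite Csum_plus; ring] end.
  apply (f_equal (fun v => v - _)). apply Csum_ext. intros d Hd.
  rewrite Cmult_plus_distr_r. apply (f_equal (fun v => _ + v * _)).
  rewrite <- Csum_scal. apply Csum_ext. intros a Hak.
  rewrite <- Fukaya_sum by auto. ring.
Qed.
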